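(* Let $A_1=\mathbb{Z}\alpha$ with $(\alpha,\alpha)=2$, let $\varpi=\alpha/2$, let $V_{A_1}$ be the lattice vertex operator algebra and $V_{A_1^\circ}$ the lattice generalized vertex algebra (both described in the context), let $W\subset V_{A_1}$ be the vertex subalgebra generated by $e^\alpha$, and let $C=\{v\in V_{A_1}\mid [u(n),v(m)]=0 \text{ for all } u\in W,\ n,m\in\mathbb{Z}\}$ be the commutant of $W$ in $V_{A_1}$. For $n\geq 0$ put $\phi_n=e^\varpi(-n-3/2)e^\varpi(-n-1)\mathbf{1}$ and $S=\{\phi_n\mid n=0,1,2,\ldots\}$. Then $S\subset C$, $S$ strongly generates $C$, and $S$ is a minimal set of generators of $C$ in the sense that no proper subset of $S$ generates $C$.
   Context: Let $\mathfrak{h}=\mathbb{C}\otimes_{\mathbb{Z}}A_1$ with the induced bilinear form and $\widehat{\mathfrak{h}}=\mathfrak{h}[t,t^{-1}]\oplus\mathbb{C}K$ the Heisenberg Lie algebra, $[h_1(n_1),h_2(n_2)]=n_1(h_1,h_2)\delta_{n_1+n_2,0}K$ where $h(n)=ht^n$. For $\lambda\in A_1^\circ=\mathbb{Z}\varpi$, $M(1,\lambda)$ is the Fock module generated by $e^\lambda$ with $Ke^\lambda=e^\lambda$, $h(0)e^\lambda=(h,\lambda)e^\lambda$, $h(n)e^\lambda=0$ for $n\ge1$. For $\beta\in A_1^\circ$ the vertex operator is $e^\beta(z)=\exp\bigl(\sum_{n<0}\frac{\beta(n)}{-n}z^{-n}\bigr)\exp\bigl(\sum_{n>0}\frac{\beta(n)}{-n}z^{-n}\bigr)z^{\beta(0)}e_\beta$,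 where $e_\beta e^\lambda=e^{\beta+\lambda}$, $z^{\beta(0)}e^\lambda=z^{(\beta,\lambda)}e^\lambda$; write $e^\beta(z)=\sum_{n\in\frac12\mathbb{Z}}e^\beta(n)z^{-n-1}$. $V_{A_1}=\bigoplus_{n\in\mathbb{Z}}M(1,n\alpha)$ is the lattice vertex operator algebra with vacuum $\mathbf 1=e^0$, $Y(\varpi(-1)\mathbf1,z)=\sum\varpi(n)z^{-n-1}$, $Y(e^\beta,z)=e^\beta(z)$ ($\beta\in A_1$); $V_{A_1^\circ}=\bigoplus_{n\in\mathbb{Z}}M(1,n\varpi)$ is the analogous lattice generalized vertex algebra (fields with powers in $\frac12\mathbb{Z}$), containing $V_{A_1}$. For any element $v$, modes are defined by $Y(v,z)=\sum_n v(n)z^{-n-1}$. A subset $S\subset C$ generates $C$ if monomials $a_1(n_1)\cdots a_r(n_r)\mathbf1$ ($r\ge0$, $a_i\in S$, $n_i\in\mathbb{Z}$) span $C$; it strongly generates $C$ if those with all $n_i\le -1$ already span $C$. *)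

(* Defs.v *)
From HB Require Import structures.
From mathcomp Require Import all_boot all_order all_algebra.
From mathcomp.multinomials Require Import freeg.
From mathcomp Require Import reals Rstruct realfun complex.

Set Implicit Arguments.
Unset Strict Implicit.
Unset Printing Implicit Defensive.

Import Order.TTheory GRing.Theory Num.Theory.
Local Open Scope ring_scope.

Definition CC : fieldType := (Rdefinitions.R)[i].

(* Partitions: nonincreasing sequences of positive integers.  The      *)
(* partition [n1; ...; nr] (n1 >= ... >= nr >= 1) encodes the Fock     *)
(* space monomial  varpi(-n1) ... varpi(-nr).                          *)
Definition is_part (s : seq nat) : bool := sorted geq s && all (fun n => 0 < n)%N s.

Definition part := {s : seq nat | is_part s}.

Lemma is_part_norm (s : seq nat) :
  is_part (sort geq [seq n <- s | (0 < n)%N]).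
Proof.
apply/andP; split.
  by apply: sort_sorted => x y; exact: leq_total.
by rewrite all_sort; apply/allP => x; rewrite mem_filter => /andP [].
Qed.

Definition mkpart (s : seq nat) : part :=
  exist _ (sort geq [seq n <- s | (0 < n)%N]) (is_part_norm s).

Definition part0 : part := mkpart [::].
Definition pwt (l : part) : nat := sumn (sval l).
Definition pmult (n : nat) (l : part) : nat := count_mem n (sval l).
Definition pins (n : nat) (l : part) : part := mkpart (n :: sval l).
Definition prem (n : nat) (l : part) : part := mkpart (rem n (sval l)).

(* Basis of V_{A_1^o}: keys (m, l) stand for                           *)
(*    varpi(-n1) ... varpi(-nr) e^{m varpi},   l = [n1;...;nr].        *)
(* V_{A_1^o} = free K-vector space on the keys.                        *)
Definition key := (int * part)%type.

Section LatticeVA.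
Variable K : fieldType.

Definition V := {freeg key / K}.

Definition bvec (k : key) : V := << k >>.

(* The Heisenberg modes varpi(q), q in Z ; (varpi,varpi) = 1/2. *)
Definition hop (q : int) (k : key) : V :=
  match q with
  | Posz 0 => << (k.1%:~R / 2%:R) *g k >>
  | Posz q' => << ((q'%:R / 2%:R) * (pmult q' k.2)%:R) *g (k.1, prem q' k.2) >>
  | Negz q' => << (k.1, pins q'.+1 k.2) >>
  end.

Definition hmode (q : int) : V -> V := fglift (hop q).

(* Coefficients S_i of z^i in exp(sum_{n>0} beta(-n)/n z^n), and       *)
(* T_j of z^(-j) in exp(sum_{n>0} beta(n)/(-n) z^(-n)), beta = b varpi; *)
(* via i S_i = sum_{n=1}^i beta(-n) S_{i-n}  (resp. for T_j).          *)
Fixpoint Saux (b : int) (fuel i : nat) (v : V) : V :=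
  match fuel with
  | 0 => v
  | f.+1 => if i == 0%N then v else
      (i%:R)^-1 *: \sum_(n < i) (b%:~R *: hmode (Negz n) (Saux b f (i - n.+1) v))
  end.
Definition Sop (b : int) (i : nat) : V -> V := Saux b i i.

Fixpoint Taux (b : int) (fuel j : nat) (v : V) : V :=
  match fuel with
  | 0 => v
  | f.+1 => if j == 0%N then v else
      (j%:R)^-1 *: \sum_(n < j) ((- b%:~R) *: hmode (Posz n.+1) (Taux b f (j - n.+1) v))
  end.
Definition Top (b : int) (j : nat) : V -> V := Taux b j j.

(* The mode e^{b varpi}(P/2)  (P an integer, so that the mode index   *)
(* P/2 ranges over (1/2)Z), acting on the basis vector e^{m varpi}-    *)
(* sector key k = (m, l):                                              *)
(*   e^beta(z) v = sum_{i,j} z^{(beta,m varpi) + i - j} S_i T_j e_beta v  *)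
(* and e^beta(P/2) is the coefficient of z^{-P/2-1}, i.e. the terms    *)
(* with  b m + 2 i - 2 j = - P - 2.  (T_j vanishes for j > weight.)    *)
Definition ekey (b P : int) (k : key) : V :=
  let d := - P - 2%:Z - b * k.1 in
  \sum_(j < (pwt k.2).+1)
   \sum_(i < (pwt k.2 + `|d|).+1)
     (if (2 * i)%N%:Z == (2 * j)%N%:Z + d
      then Sop b i (Top b j (bvec (k.1 + b, k.2))) else 0).

Definition emode (b P : int) : V -> V := fglift (ekey b P).

Definition zbin (a : int) (k : nat) : K :=
  match a with
  | Posz a' => 'C(a', k)%:R
  | Negz a' => (-1) ^+ k * 'C(a' + k, k)%:R
  end.

(* The vertex operator of the basis vector                              *)
(*   v = varpi(-n1)...varpi(-nr) e^{g varpi}:                            *)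
(*   Y(v,z) = : d^{(n1-1)}varpi(z) ... d^{(nr-1)}varpi(z) e^{g varpi}(z) :, *)
(* where  d^{(n-1)}varpi(z) = sum_q binom(-q-1,n-1) varpi(q) z^{-q-n}   *)
(* and normal ordering puts varpi(q), q < 0, to the left and            *)
(* varpi(q), q >= 0, to the right of e^{g varpi}(z).  Ykey v N w is the *)
(* mode v(N) applied to the basis vector w; the finite ranges used are  *)
(* large enough to contain every nonzero contribution.                  *)
Definition Ykey (v : key) (N : int) (w : key) : V :=
  let g := v.1 in
  let ns := sval v.2 in
  let wt := pwt w.2 in
  let E := (`|N| + absz (g * w.1)%R + (size ns).+1 * wt + sumn ns)%N in
  let fix F (ns : seq nat) (s : int) (x : V) : V :=
    match ns with
    | [::] => emode g (2%:Z * N - 2%:Z * s) x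
    | n :: ns' =>
        \sum_(q < wt.+1)
           (zbin (- q%:Z - 1) n.-1 *: F ns' (s + q%:Z + n%:Z) (hmode q%:Z x))
      + \sum_(t < E + n)
           (zbin (t%:Z) n.-1 *:
              hmode (Negz t) (F ns' (s + Negz t + n%:Z) x))
    end in
  F ns 0 (bvec w).

Definition Ymode (v : V) (N : int) (x : V) : V :=
  fglift (fun kv => fglift (Ykey kv N) x) v.

Definition vac : V := bvec (0, part0).

(* V_{A_1}: the span of the keys with m even (lattice Z alpha, alpha = 2 varpi) *)
Definition inVA1 (v : V) : Prop := forall k, k \in dom v -> ~~ odd `|k.1|%N.

Definition monom (l : seq (V * int)) : V :=
  foldr (fun an x => Ymode an.1 an.2 x) vac l.

Definition gen_span (S : V -> Prop) (strong : bool) (v : V) : Prop :=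
  exists l : seq (K * seq (V * int)),
    (forall t, t \in l -> forall an, an \in t.2 -> S an.1 /\ (strong -> an.2 <= -1)) /\
    v = \sum_(t <- l) t.1 *: monom t.2.

Definition generates (S C : V -> Prop) : Prop := forall v, C v <-> gen_span S false v.
Definition strongly_generates (S C : V -> Prop) : Prop :=
  forall v, C v <-> gen_span S true v.

End LatticeVA.

Arguments vac {K}.

Definition ealpha : V CC := bvec CC (2%:Z, part0).

Definition Wsub : V CC -> Prop := gen_span (fun u => u = ealpha) false.

Definition Comm : V CC -> Prop := fun v =>
  inVA1 v /\
  forall u, Wsub u -> forall n m : int, forall w, inVA1 w ->
    Ymode u n (Ymode v m w) = Ymode v m (Ymode u n w).

Definition phi (n : nat) : V CC :=
  emode 1 (- (2 * n + 3)%N%:Z) (emode 1 (- (2 * n + 2)%N%:Z) vac).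

Definition Sset : V CC -> Prop := fun x => exists n : nat, x = phi n.

(* Main.v *)
(* Let [h_i] be the coefficients of [exp (sum_(t > 0) varpi(-t) z^t / t)] and let [C'] be the
   span of the vectors [h_(c_1) ... h_(c_r) e^(r varpi)] with [r] even.

   [C = C']: the field of such a vector commutes with the modes of [e^alpha] up to [(-1)^r]
   and a shift of indices, and the fields of the elements of [W] are combinations of products
   of these modes.  Conversely, [v] in [C] is killed by [e^alpha(n)], [n >= 0], so on charge
   [m] the coefficients [T_j], [j > m], of the annihilation part of [e^alpha(z)] kill [v];
   as [T_j] lowers all the indices of an [h]-monomial of degree [j], [v] has degree at most
   [m] in the [h_i].

   Strong generation: [(h_(i+t) h_(k+t) e^alpha)(-1) v = h_i h_k e_alpha v] modulo lower
   terms, for [v] of charge [2 t], and the charge 2 part of [C'] is spanned by the [phi_n] and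
   by derivatives, because modulo derivatives [phi_n] is
   [(-1)^n binom(2 n + 1/2, n) h_0 h_(2n) e^alpha].

   Minimality: the functional [h_a h_b e^alpha |-> (-1)^a binom(2 n, a)], [a + b = 2 n], kills
   all derivatives and every [phi_k] with [k <> n], but not [phi_n]. *)

Require Import Defs.
From HB Require Import structures.
From mathcomp Require Import all_boot all_order all_algebra.
From mathcomp.multinomials Require Import freeg.
From mathcomp Require Import Rstruct complex boolp zify ring.

Set Implicit Arguments.
Unset Strict Implicit.
Unset Printing Implicit Defensive.

Import Order.TTheory GRing.Theory Num.Theory.
Local Open Scope ring_scope.

(** * Finitely supported sums and binomial coefficients *)

(** Two contractions carry the argument. Since [(alpha, varpi) = 1], moving [e^alpha(z)] past
    [e^varpi(w)] costs the factor [1 - w / z]: there is no pole, and the two orders of the product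
    differ only by a sign. The same factor is what makes [T_j] lower the indices of an h-monomial.
    Since [(varpi, varpi) = 1/2], two fields [e^varpi] contract to a square root, the origin of the
    [1/2] in [binom(2 n + 1/2, n)]. The obstacle is that h-monomials are built one factor at a time,
    hence through odd charges, where powers of [z] may be half-integral and integer modes do not
    describe the field. Fields are therefore indexed by the degree of their output, an integer in
    every charge, and are translated back into modes only when the product of the two charges is
    even. The infinite sums that arise are finite on vectors of fixed charge and degree, so
    identities between them are proved on such vectors and then extended by linearity. *)

Section FinSum.
Variables (I : choiceType) (M : zmodType).
Implicit Types (F G : I -> M) (r : seq I).

Definition fin F := exists r, forall i, i \notin r -> F i = 0.

(* Finitely supported sums over an infinite index type; [0] when the support is infinite. *)
Definition fsum F : M :=
  if pselect (fin F) is left h then \sum_(i <- undup (projT1 (cid h))) F i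
  else 0.

Lemma fsumE r F : uniq r -> (forall i, i \notin r -> F i = 0) ->
  fsum F = \sum_(i <- r) F i.
Proof.
move=> ur hr; rewrite /fsum; case: pselect => [h|[]]; last by exists r.
case: cid => s hs /=; have us := undup_uniq s.
have red (q : seq I) : \sum_(i <- q) F i = \sum_(i <- [seq i <- q | F i != 0]) F i.
  rewrite big_filter [RHS]big_mkcond; apply: eq_bigr => i _.
  by case: eqP.
rewrite red [RHS]red; apply/perm_big/uniq_perm; rewrite ?filter_uniq // => i.
rewrite !mem_filter mem_undup; case: eqP => //= nz.
apply/idP/idP => _.
  by apply: contraT => /hr.
by apply: contraT => /hs.
Qed.

Lemma fsumE_fin F : fin F -> exists2 r, uniq r &
  (forall i, i \notin r -> F i = 0) /\ fsum F = \sum_(i <- r) F i.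
Proof.
move=> [r hr]; exists (undup r); first exact: undup_uniq.
split=> [i|]; first by rewrite mem_undup; exact: hr.
by apply: fsumE; rewrite ?undup_uniq // => i; rewrite mem_undup; exact: hr.
Qed.

Lemma eq_fsum F G : F =1 G -> fsum F = fsum G.
Proof. by move=> /funext ->. Qed.

Lemma fsum_eq0 F : (forall i, F i = 0) -> fsum F = 0.
Proof.
move=> h; rewrite (@fsumE [::]) // ?big_nil //.
Qed.

Lemma fsum_eq1 i0 F : (forall i, i != i0 -> F i = 0) -> fsum F = F i0.
Proof.
move=> h; rewrite (@fsumE [:: i0]) // ?big_seq1 // => i.
by rewrite inE; exact: h.
Qed.

Lemma fin_eq F G : F =1 G -> fin F -> fin G.
Proof. by move=> /funext ->. Qed.

Lemma finD F G : fin F -> fin G -> fin (fun i => F i + G i).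
Proof.
move=> [r hr] [s hs]; exists (r ++ s) => i.
by rewrite mem_cat negb_or => /andP[/hr -> /hs ->]; rewrite addr0.
Qed.

Lemma fsumD F G : fin F -> fin G -> fsum (fun i => F i + G i) = fsum F + fsum G.
Proof.
move=> [r hr] [s hs].
have u := undup_uniq (r ++ s).
have zF i : i \notin undup (r ++ s) -> F i = 0.
  by rewrite mem_undup mem_cat negb_or => /andP[/hr].
have zG i : i \notin undup (r ++ s) -> G i = 0.
  by rewrite mem_undup mem_cat negb_or => /andP[_ /hs].
rewrite (fsumE u zF) (fsumE u zG) -big_split; apply: fsumE => // i hi.
by rewrite zF // zG // addr0.
Qed.

Lemma fsum_closed (Z : M -> Prop) F : Z 0 -> (forall x y, Z x -> Z y -> Z (x + y)) ->
  (forall i, Z (F i)) -> Z (fsum F).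
Proof.
move=> Z0 ZD ZF; rewrite /fsum; case: pselect => [h|_ //].
by apply: big_ind.
Qed.

End FinSum.

Lemma fin_comp (I : choiceType) (M N : zmodType) (f : M -> N) (F : I -> M) :
  f 0 = 0 -> fin F -> fin (fun i => f (F i)).
Proof. by move=> f0 [r hr]; exists r => i /hr ->. Qed.

Lemma fsum_morph (I : choiceType) (M N : zmodType) (f : M -> N) (F : I -> M) :
  (forall x y, f (x + y) = f x + f y) -> fin F ->
  f (fsum F) = fsum (fun i => f (F i)).
Proof.
move=> fD /fsumE_fin [r ur [hr ->]].
have f0 : f 0 = 0 by apply: (addrI (f 0)); rewrite -fD !addr0.
rewrite (fsumE ur) => [|i /hr ->] //.
by rewrite (big_morph f fD f0).
Qed.

Lemma fsumN (I : choiceType) (M : zmodType) (F : I -> M) : fin F ->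
  fsum (fun i => - F i) = - fsum F.
Proof. by move=> hF; rewrite (fsum_morph (@opprD M)). Qed.

Lemma fsumB (I : choiceType) (M : zmodType) (F G : I -> M) : fin F -> fin G ->
  fsum (fun i => F i - G i) = fsum F - fsum G.
Proof.
move=> hF hG; rewrite fsumD ?fsumN //.
by apply: (@fin_comp _ _ _ -%R); rewrite ?oppr0.
Qed.

Lemma fsumZ (I : choiceType) (R : pzRingType) (M : lmodType R) (c : R) (F : I -> M) :
  fin F -> fsum (fun i => c *: F i) = c *: fsum F.
Proof. by move=> hF; rewrite (fsum_morph (scalerDr c)). Qed.

Lemma finZ (I : choiceType) (R : pzRingType) (M : lmodType R) (c : I -> R) (F : I -> M) :
  fin F -> fin (fun i => c i *: F i).
Proof. by move=> [r hr]; exists r => i /hr ->; rewrite scaler0. Qed.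

Lemma fin_big (I : choiceType) (J : Type) (M : zmodType) (s : seq J) (F : J -> I -> M) :
  (forall j, fin (F j)) -> fin (fun i => \sum_(j <- s) F j i).
Proof.
move=> h; elim: s => [|j s IH]; first by exists [::] => i _; rewrite big_nil.
by apply: fin_eq (finD (h j) IH) => i; rewrite big_cons.
Qed.

Lemma fsum_big (I : choiceType) (J : Type) (M : zmodType) (s : seq J) (F : J -> I -> M) :
  (forall j, fin (F j)) -> fsum (fun i => \sum_(j <- s) F j i) = \sum_(j <- s) fsum (F j).
Proof.
move=> h; elim: s => [|j s IH].
  by rewrite big_nil fsum_eq0 // => i; rewrite big_nil.
rewrite big_cons -IH -fsumD //; last exact: fin_big.
by apply: eq_fsum => i; rewrite big_cons.
Qed.

Lemma fin_reindex (I J : choiceType) (M : zmodType) (h : J -> I) (g : I -> J)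
    (F : I -> M) : cancel h g -> fin F -> fin (fun j => F (h j)).
Proof.
move=> hg [r hr]; exists (map g r) => j hj; apply: hr.
by apply: contra hj => hj; apply/mapP; exists (h j).
Qed.

Lemma fsum_reindex (I J : choiceType) (M : zmodType) (h : J -> I) (g : I -> J)
    (F : I -> M) : cancel h g -> cancel g h -> fin F ->
  fsum (fun j => F (h j)) = fsum F.
Proof.
move=> hg gh /fsumE_fin [r ur [hr ->]].
rewrite (@fsumE _ _ (map g r)); first 1 last.
- by rewrite map_inj_uniq //; exact: can_inj gh.
- move=> j hj; apply: hr.
  by apply: contra hj => hj; apply/mapP; exists (h j).
by rewrite big_map; apply: eq_bigr => i _; rewrite gh.
Qed.

Lemma fin_pairl (I J : choiceType) (M : zmodType) (F : I * J -> M) :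
  fin F -> forall i, fin (fun j => F (i, j)).
Proof.
move=> [r hr] i; exists (map snd r) => j hj; apply: hr.
by apply: contra hj => hj; apply/mapP; exists (i, j).
Qed.

Lemma fin_pair1 (I J : choiceType) (M : zmodType) (F : I * J -> M) :
  fin F -> fin (fun i => fsum (fun j => F (i, j))).
Proof.
move=> [r hr]; exists (map fst r) => i hi; apply: fsum_eq0 => j; apply: hr.
by apply: contra hi => hi; apply/mapP; exists (i, j).
Qed.

Lemma fsum_pair (I J : choiceType) (M : zmodType) (F : I * J -> M) :
  fin F -> fsum F = fsum (fun i => fsum (fun j => F (i, j))).
Proof.
move=> [r hr].
pose r1 := undup (map fst r); pose r2 := undup (map snd r).
have u1 : uniq r1 by exact: undup_uniq.
have u2 : uniq r2 by exact: undup_uniq.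
have z1 i j : i \notin r1 -> F (i, j) = 0.
  rewrite mem_undup => hi; apply: hr.
  by apply: contra hi => hi; apply/mapP; exists (i, j).
have z2 i j : j \notin r2 -> F (i, j) = 0.
  rewrite mem_undup => hi; apply: hr.
  by apply: contra hi => hi; apply/mapP; exists (i, j).
rewrite (@fsumE _ _ [seq (i, j) | i <- r1, j <- r2]); first last.
- move=> [i j] hij.
  have [hi|/z1 //] := boolP (i \in r1); have [hj|/z2 //] := boolP (j \in r2).
  by case/negP: hij; exact: allpairs_f.
- by apply: allpairs_uniq => // -[? ?] [? ?] _ _ [-> ->].
rewrite big_allpairs (@fsumE _ _ r1) => [|//|i hi]; last first.
  by apply: fsum_eq0 => j; exact: z1.
by apply: eq_bigr => i _; rewrite (fsumE u2) // => j; exact: z2.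
Qed.

Lemma fin_swap (I J : choiceType) (M : zmodType) (F : I * J -> M) :
  fin F -> fin (fun x : J * I => F (x.2, x.1)).
Proof.
move=> hF; pose h (x : J * I) := (x.2, x.1).
by apply: (@fin_reindex _ _ _ h (fun x => (x.2, x.1))) => // -[].
Qed.

Lemma fsum_exchange (I J : choiceType) (M : zmodType) (F : I * J -> M) :
  fin F -> fsum (fun i => fsum (fun j => F (i, j))) =
           fsum (fun j => fsum (fun i => F (i, j))).
Proof.
move=> hF; rewrite -fsum_pair //.
pose h (x : J * I) := (x.2, x.1).
rewrite -(@fsum_reindex _ _ _ h (fun x => (x.2, x.1))) //; try by case.
by rewrite (fsum_pair (fin_swap hF)).
Qed.

Definition itv_seq (a b : int) : seq int :=
  [seq a + k%:Z | k <- iota 0 `|b - a|.+1].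

Lemma mem_itv_seq a b i : a <= i -> i <= b -> i \in itv_seq a b.
Proof.
by move=> ai ib; apply/mapP; exists `|i - a|%N; rewrite ?mem_iota; lia.
Qed.

Lemma fin_itv (M : zmodType) (a b : int) (F : int -> M) :
  (forall i : int, (i < a) || (b < i) -> F i = 0) -> fin F.
Proof.
move=> h; exists (itv_seq a b) => i; apply: contraNeq => nz.
by apply: mem_itv_seq; rewrite leNgt; apply: contraNN nz => lt;
  rewrite h ?lt ?orbT.
Qed.

Lemma fin_itv2 (M : zmodType) (a b c d : int) (F : int * int -> M) :
  (forall i j : int, [|| i < a, b < i, j < c | d < j] -> F (i, j) = 0) -> fin F.
Proof.
move=> h; exists [seq (i, j) | i <- itv_seq a b, j <- itv_seq c d] => -[i j].
apply: contraNeq => nz; apply: allpairs_f; apply: mem_itv_seq; rewrite leNgt;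
  by apply: contraNN nz => lt; rewrite h ?lt ?orbT.
Qed.

Lemma fin_itv3 (M : zmodType) (a b c d e f : int) (F : int * (int * int) -> M) :
  (forall i j k : int, [|| i < a, b < i, j < c, d < j, k < e | f < k] -> F (i, (j, k)) = 0) ->
  fin F.
Proof.
move=> h; exists [seq (i, x) | i <- itv_seq a b,
   x <- [seq (j, k) | j <- itv_seq c d, k <- itv_seq e f]] => -[i [j k]].
apply: contraNeq => nz; apply: allpairs_f; last apply: allpairs_f;
  apply: mem_itv_seq; rewrite leNgt;
  by apply: contraNN nz => lt; rewrite h ?lt ?orbT.
Qed.

Lemma fsum_ord (M : zmodType) n (F : int -> M) :
  (forall i : int, (i < 0) || (n%:Z <= i) -> F i = 0) ->
  fsum F = \sum_(i < n) F i%:Z.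
Proof.
move=> h; rewrite (@fsumE _ _ (map Posz (iota 0 n))).
- rewrite big_map -(big_mkord xpredT (fun i => F i%:Z)) /index_iota subn0 //.
- by rewrite map_inj_uniq ?iota_uniq // => ? ? [].
- move=> i hi; apply: h; apply: contraNT hi; rewrite negb_or -leNgt -ltNge.
  move=> /andP[i0 iN]; apply/mapP; exists `|i|%N; rewrite ?mem_iota; lia.
Qed.

Lemma eq_zsum (M : zmodType) (F G : int -> M) :
  (forall i : int, F i = G i) -> fsum F = fsum G.
Proof. exact: eq_fsum. Qed.

Lemma eq_zsum2 (M : zmodType) (F G : int * int -> M) :
  (forall i j : int, F (i, j) = G (i, j)) -> fsum F = fsum G.
Proof. by move=> h; apply: eq_fsum => -[i j]. Qed.

Lemma zsum_eq0 (M : zmodType) (F : int -> M) :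
  (forall i : int, F i = 0) -> fsum F = 0.
Proof. exact: fsum_eq0. Qed.

Lemma zsum_eq1 (M : zmodType) (i0 : int) (F : int -> M) :
  (forall i : int, i != i0 -> F i = 0) -> fsum F = F i0.
Proof. exact: fsum_eq1. Qed.

Lemma zsum_closed (M : zmodType) (Z : M -> Prop) (F : int -> M) : Z 0 ->
  (forall x y, Z x -> Z y -> Z (x + y)) -> (forall i : int, Z (F i)) -> Z (fsum F).
Proof. exact: fsum_closed. Qed.

Lemma fsum_shift (M : zmodType) (c : int) (F : int -> M) :
  fin F -> fsum (fun i => F (i + c)) = fsum F.
Proof.
move=> hF; pose h (i : int) := i + c.
by rewrite (@fsum_reindex _ _ _ h (fun i => i - c)) // => i; rewrite /h ?addrK ?subrK.
Qed.

(** * Generalized binomial coefficients in characteristic zero *)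

Section Binomial.
Variable K : fieldType.
Hypothesis char0 : forall n : nat, n.+1%:R != 0 :> K.

Definition gbin (x : K) (k : nat) : K := (\prod_(i < k) (x - i%:R)) / k`!%:R.

Lemma natK_neq0 n : (0 < n)%N -> n%:R != 0 :> K.
Proof. by case: n. Qed.

Lemma gbin0 x : gbin x 0 = 1.
Proof. by rewrite /gbin big_ord0 fact0 divr1. Qed.

Lemma gbinSr x k : k.+1%:R * gbin x k.+1 = (x - k%:R) * gbin x k.
Proof.
rewrite /gbin big_ord_recr /= factS natrM.
by move: (char0 k) (natK_neq0 (fact_gt0 k)); move: (k`!%:R) (k.+1%:R) => a b hb ha; field; rewrite ha hb.
Qed.

Lemma gbinSl x k : k.+1%:R * gbin x k.+1 = x * gbin (x - 1) k.
Proof.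
rewrite /gbin big_ord_recl /= subr0 factS natrM.
rewrite (eq_bigr (fun i : 'I_k => x - 1 - i%:R)) => [|i _]; last first.
  by rewrite /bump add1n -natr1; ring.
by move: (char0 k) (natK_neq0 (fact_gt0 k)); move: (k`!%:R) (k.+1%:R) => a b hb ha;
  field; rewrite ha hb.
Qed.

Lemma gbinS x k : gbin (x + 1) k.+1 = gbin x k.+1 + gbin x k.
Proof.
apply: (mulfI (char0 k)); rewrite mulrDr gbinSl gbinSr addrK.
by rewrite -natr1; ring.
Qed.

Lemma gbin_nat (n k : nat) : gbin n%:R k = 'C(n, k)%:R.
Proof.
elim: n k => [|n IH] [|k]; rewrite ?gbin0 ?bin0n //.
- apply: (mulfI (char0 k)); rewrite gbinSl mul0r /= mulr0 //.
- by rewrite -(natr1 n) gbinS !IH binS natrD.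
Qed.

(** At [z = - (n + 1)] this is the reflection [binom(- (n + 1), k) = (-1)^k binom(n + k, k)],
    obtained by induction on [k]. *)
Lemma zbinE (z : int) k : zbin K z k = gbin z%:~R k.
Proof.
case: z => n; first by rewrite /= gbin_nat.
rewrite NegzE /=; elim: k => [|k IH]; first by rewrite gbin0 expr0 mul1r bin0.
apply: (mulfI (char0 k)); rewrite gbinSr -IH.
have -> : (k.+1%:R * ((-1) ^+ k.+1 * 'C(n + k.+1, k.+1)%:R) : K)
   = (-1) ^+ k.+1 * (k.+1 * 'C(n + k.+1, k.+1))%N%:R by rewrite natrM; ring.
have e : ((n + k).+1%:R = n.+1%:R + k%:R :> K) by rewrite -natrD addSn.
rewrite addnS -mul_bin_diag /= natrM e exprS mulrNz -pmulrn; ring.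
Qed.

(** Both sides obey Pascal's rule in [z], so the identity spreads up and down from [z = 0]; this is
    why one argument is an integer. The way down also needs an induction on the lower index. *)
Lemma vandermonde (x : K) (z : int) a :
  \sum_(k < a.+1) gbin x k * gbin z%:~R (a - k) = gbin (x + z%:~R) a.
Proof.
pose W z a := \sum_(k < a.+1) gbin x k * gbin (z%:~R : K) (a - k).
have W0 y : W y 0%N = 1 by rewrite /W big_ord1 !gbin0 mulr1.
have WS y b : W (y + 1) b.+1 = W y b.+1 + W y b.
  rewrite /W big_ord_recr [X in _ = X + _]big_ord_recr /= subnn !gbin0.
  rewrite addrAC -big_split /=; congr (_ + _); apply: eq_bigr => k _.
  by rewrite subSn -1?ltnS // rmorphD /= gbinS mulrDr.
rewrite -/(W z a).
have up y : (forall b, W y b = gbin (x + y%:~R) b) ->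
     forall b, W (y + 1) b = gbin (x + (y + 1)%:~R) b.
  move=> h [|b]; first by rewrite W0 gbin0.
  by rewrite WS !h rmorphD /= addrA gbinS.
have down y : (forall b, W (y + 1) b = gbin (x + (y + 1)%:~R) b) ->
     forall b, W y b = gbin (x + y%:~R) b.
  move=> h; elim=> [|b IH]; first by rewrite W0 gbin0.
  apply: (addIr (W y b)); rewrite -WS h IH rmorphD /= addrA gbinS //.
have base b : W 0 b = gbin (x + 0%:~R) b.
  rewrite /W big_ord_recr /= subnn gbin0 mulr1 big1 ?add0r ?addr0 // => k _.
  rewrite -(subnSK (ltn_ord k)) (_ : 0%:~R = 0%:R :> K) // gbin_nat bin0n mulr0 //.
case: z => n.
  elim: n a => [|n IH] a; first exact: base.
  by rewrite -addn1 PoszD; exact: up.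
elim: n a => [|n IH] a.
  by apply: down => b; rewrite (_ : Negz 0 + 1 = 0) //; exact: base.
by apply: down => b; rewrite (_ : Negz n.+1 + 1 = Negz n) //; lia.
Qed.

End Binomial.

(** Coefficients of power series are extended by zero to negative indices, which spares side
    conditions when indices are shifted; the negative indices are the base case of this
    induction. *)
Lemma zind (P : int -> Prop) : (forall i : int, i < 0 -> P i) ->
  (forall i : int, 0 <= i -> (forall j : int, j < i -> P j) -> P i) ->
  forall i : int, P i.
Proof.
move=> hneg hpos [] n; last by apply: hneg.
have [k] := ubnP n; elim: k n => // k IH n nk.
apply: hpos => // -[] j hj; last by apply: hneg.
by apply: IH; lia.
Qed.

(** * The Fock space and its Heisenberg modes *)

Section Linear.
Variable K : fieldType.
Variables M N : lmodType K.

Definition lin (f : M -> N) := forall c u v, f (c *: u + v) = c *: f u + f v.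

Lemma linD f u v : lin f -> f (u + v) = f u + f v.
Proof. by move=> h; have := h 1 u v; rewrite !scale1r. Qed.

Lemma lin0 f : lin f -> f 0 = 0.
Proof. by move=> h; apply: (addrI (f 0)); rewrite -linD // !addr0. Qed.

Lemma linZ f c u : lin f -> f (c *: u) = c *: f u.
Proof. by move=> h; have := h c u 0; rewrite (lin0 h) !addr0. Qed.

Lemma linN f u : lin f -> f (- u) = - f u.
Proof. by move=> h; rewrite -scaleN1r linZ // scaleN1r. Qed.

Lemma linB f u v : lin f -> f (u - v) = f u - f v.
Proof. by move=> h; rewrite linD // linN. Qed.

Lemma lin_sum f (I : Type) (r : seq I) (P : pred I) F : lin f ->
  f (\sum_(i <- r | P i) F i) = \sum_(i <- r | P i) f (F i).
Proof.
by move=> h; apply: (big_morph f) => [x y|]; rewrite ?(lin0 h) ?(linD _ _ h).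
Qed.

Lemma lin_fsum f (I : choiceType) (F : I -> M) : lin f -> fin F ->
  f (fsum F) = fsum (fun i => f (F i)).
Proof. by move=> h; apply: fsum_morph => x y; exact: linD. Qed.

End Linear.

Lemma lin_comp (K : fieldType) (M N P : lmodType K) (f : N -> P) (g : M -> N) :
  lin f -> lin g -> lin (fun x => f (g x)).
Proof. by move=> hf hg c u v; rewrite hg hf. Qed.

Lemma linscale (K : fieldType) (M N : lmodType K) (c : K) (f : M -> N) :
  lin f -> lin (fun x => c *: f x).
Proof. by move=> hf a u v; rewrite hf scalerDr !scalerA mulrC. Qed.

Lemma perm_rem (T : eqType) (x : T) s s' : perm_eq s s' -> perm_eq (rem x s) (rem x s').
Proof.
move=> h; apply/permP => p; rewrite !count_rem (permP h) (perm_mem h) //.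
Qed.

Lemma scaleC (K : fieldType) (M : lmodType K) (a b : K) (u : M) :
  a *: (b *: u) = b *: (a *: u).
Proof. by rewrite !scalerA mulrC. Qed.

Lemma linadd (K : fieldType) (M N : lmodType K) (f g : M -> N) :
  lin f -> lin g -> lin (fun x => f x + g x).
Proof. by move=> hf hg a u v; rewrite hf hg scalerDr addrACA. Qed.

(** * Partitions under insertion and removal of a part *)

Section Parts.

Implicit Types l : part.

Lemma part_eq l l' : perm_eq (sval l) (sval l') -> l = l'.
Proof.
move=> h; apply: val_inj; apply: (@sorted_eq _ geq) => //.
- by move=> x y z /= h1 h2; exact: leq_trans h2 h1.
- by move=> x y /=; rewrite andbC -eqn_leq => /eqP.
- by case: l {h} => s /= /andP[].
- by case: l' {h} => s /= /andP[].
Qed.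

Lemma part_pos l n : n \in sval l -> (0 < n)%N.
Proof. by case: l => s /= /andP[_ /allP]; apply. Qed.

Lemma perm_mkpart s : all (fun n => 0 < n)%N s -> perm_eq (sval (mkpart s)) s.
Proof. by move=> /all_filterP h; rewrite /= h perm_sort. Qed.

Lemma mkpartK l : mkpart (sval l) = l.
Proof. by apply/part_eq/perm_mkpart/allP => n; exact: part_pos. Qed.

Lemma perm_pins n l : (0 < n)%N -> perm_eq (sval (pins n l)) (n :: sval l).
Proof.
move=> n0; apply: perm_mkpart; rewrite /= n0 /=.
by apply/allP => m; exact: part_pos.
Qed.

Lemma perm_prem n l : perm_eq (sval (prem n l)) (rem n (sval l)).
Proof. by apply/perm_mkpart/allP => m /mem_rem; exact: part_pos. Qed.

Lemma pmult_pins n t l : (0 < t)%N -> pmult n (pins t l) = ((n == t) + pmult n l)%N.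
Proof. by move=> t0; rewrite /pmult (permP (perm_pins l t0)) /= eq_sym. Qed.

Lemma pmult_prem n t l : pmult n (prem t l) = (pmult n l - ((t == n) && (t \in sval l)))%N.
Proof. by rewrite /pmult (permP (perm_prem t l)) count_rem /= andbC. Qed.

Lemma pwt_pins n l : (0 < n)%N -> pwt (pins n l) = (n + pwt l)%N.
Proof. by move=> n0; rewrite /pwt (perm_sumn (perm_pins l n0)). Qed.

Lemma pinsC n t l : (0 < n)%N -> (0 < t)%N -> pins n (pins t l) = pins t (pins n l).
Proof.
move=> n0 t0; apply: part_eq.
apply: (perm_trans (perm_pins _ n0)).
rewrite perm_sym; apply: (perm_trans (perm_pins _ t0)).
have h1 := perm_pins l n0; have h2 := perm_pins l t0.
apply: (@perm_trans _ [:: t, n & sval l]); first by rewrite perm_cons.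
rewrite -[_ :: _ :: _]/([:: t] ++ [:: n] ++ _) perm_catCA /= perm_cons.
by rewrite perm_sym.
Qed.

Lemma prem_pins n t l : (0 < n)%N -> (0 < t)%N ->
  prem n (pins t l) = if n == t then l else pins t (prem n l).
Proof.
move=> n0 t0; apply: part_eq; apply: (perm_trans (perm_prem _ _)).
have h := perm_rem n (perm_pins l t0).
apply: (perm_trans h) => /=; rewrite eq_sym; case: eqP => // _.
rewrite perm_sym; apply: (perm_trans (perm_pins _ t0)); rewrite perm_cons.
exact: perm_prem.
Qed.

Lemma pins_prem n l : n \in sval l -> pins n (prem n l) = l.
Proof.
move=> nl; apply: part_eq; apply: (perm_trans (perm_pins _ (part_pos nl))).
rewrite perm_sym; apply: (perm_trans (perm_to_rem nl)).
by rewrite perm_cons perm_sym; exact: perm_prem.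
Qed.

Lemma premC n t l : prem n (prem t l) = prem t (prem n l).
Proof.
apply: part_eq; apply: (perm_trans (perm_prem _ _)).
rewrite perm_sym; apply: (perm_trans (perm_prem _ _)).
apply: (perm_trans (perm_rem _ (perm_prem _ _))).
rewrite perm_sym; apply: (perm_trans (perm_rem _ (perm_prem _ _))).
apply/permP => p; rewrite !count_rem; move: (sval l) => s.
have [->//|nt] := eqVneq n t.
have in1 : (n \in rem t s) = (n \in s).
  rewrite -!has_pred1 !has_count count_rem /= eq_sym (negPf nt) andbF subn0 //.
have in2 : (t \in rem n s) = (t \in s).
  rewrite -!has_pred1 !has_count count_rem /= (negPf nt) andbF subn0 //.
by rewrite in1 in2 subnAC.
Qed.

Lemma pmult_mem n l : (pmult n l != 0)%N = (n \in sval l).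
Proof. by rewrite /pmult -has_pred1 has_count lt0n. Qed.

Lemma pwt_prem n l : n \in sval l -> (n + pwt (prem n l))%N = pwt l.
Proof. by move=> nl; rewrite -pwt_pins ?pins_prem // (part_pos nl). Qed.

End Parts.

Section Fock.
Variable K : fieldType.
Hypothesis char0 : forall n : nat, n.+1%:R != 0 :> K.
Definition Fock : lmodType K := V K.
Local Notation V := Fock.

Lemma intK_neq0 (i : int) : i != 0 -> i%:~R != 0 :> K.
Proof.
case: i => [[//|n]|n] _; first by rewrite -pmulrn.
by rewrite NegzE mulrNz oppr_eq0 -pmulrn.
Qed.

Definition mono (a : K) (k : key) : V := << a *g k >>.
Definition bv (k : key) : V := bvec K k.
Definition cf (k : key) (w : V) : K := coeff k w.

Lemma cf_lin k c u v : cf k (c *: u + v) = c * cf k u + cf k v.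
Proof. by rewrite /cf (@coeffD K key) (@coeffZ K key). Qed.

Lemma cf_mono k a k' : cf k (mono a k') = a * (k' == k)%:R.
Proof. exact: (@coeffU K key). Qed.

Lemma cf0 k : cf k 0 = 0. Proof. exact: (@coeff0 K key). Qed.

Lemma cf_eq u v : (forall k, cf k u = cf k v) -> u = v.
Proof. by move=> h; apply/eqP/(@freeg_eqP K key). Qed.

Lemma scale_mono c a k : c *: mono a k = mono (c * a) k.
Proof.
by apply: cf_eq => x; rewrite -[_ *: _]addr0 cf_lin cf0 addr0 !cf_mono mulrA.
Qed.

Lemma monoE a k : mono a k = a *: bv k.
Proof. by rewrite /bv -[bvec K k]/(mono 1 k) scale_mono mulr1. Qed.

Lemma cf_bv k k' : cf k (bv k') = (k' == k)%:R.
Proof. by rewrite /bv -[bvec K k']/(mono 1 k') cf_mono mul1r. Qed.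

Lemma mono_sum (w : V) : w = \sum_(k <- dom (w : Defs.V K)) mono (cf k w) k.
Proof. by rewrite {1}[w](esym (@freeg_sumE K key w)). Qed.

Lemma vec_sum (w : V) : w = \sum_(k <- dom (w : Defs.V K)) cf k w *: bv k.
Proof. by rewrite {1}[w]mono_sum; apply: eq_bigr => k _; rewrite monoE. Qed.

Definition lft (M : lmodType K) (f : key -> M) (w : V) : M := fglift f w.

Lemma lftD (M : lmodType K) (f : key -> M) u v : lft f (u + v) = lft f u + lft f v.
Proof.
pose g : {additive V -> M} := HB.pack (lft f)
  (GRing.isZmodMorphism.Build V M _ (@lift_is_additive K key M f)).
exact: (raddfD g).
Qed.

Lemma lft_mono (M : lmodType K) (f : key -> M) a k : lft f (mono a k) = a *: f k.
Proof. exact: (@liftU K M key). Qed.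

Lemma fglift_lin (M : lmodType K) (f : key -> M) : lin (lft f).
Proof.
move=> c u v; rewrite lftD; congr (_ + _).
have z : lft f 0 = 0 by apply: (addrI (lft f 0)); rewrite -lftD !addr0.
rewrite [u]mono_sum; move: (dom _) (fun k => cf k u) => r a.
elim: r => [|k r IH]; first by rewrite !big_nil scaler0 z scaler0.
by rewrite !big_cons scalerDr !lftD IH [RHS]scalerDr scale_mono !lft_mono scalerA.
Qed.

Lemma fgliftb (M : lmodType K) (f : key -> M) k : lft f (bv k) = f k.
Proof. by rewrite /bv -[bvec K k]/(mono 1 k) lft_mono scale1r. Qed.

Lemma lin_ext (M : lmodType K) (f g : V -> M) : lin f -> lin g ->
  (forall k, f (bv k) = g (bv k)) -> forall w, f w = g w.
Proof.
move=> hf hg h w; rewrite (vec_sum w) !lin_sum //.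
by apply: eq_bigr => k _; rewrite !linZ // h.
Qed.

Definition supp (P : key -> Prop) (w : V) := forall k, cf k w != 0 -> P k.

Lemma suppA P c u v : supp P u -> supp P v -> supp P (c *: u + v).
Proof.
move=> hu hv k; rewrite cf_lin => h.
have [e|/hu //] := eqVneq (cf k u) 0.
by apply: hv; move: h; rewrite e mulr0 add0r.
Qed.

Lemma supp0 P : supp P 0. Proof. by move=> k; rewrite cf0 eqxx. Qed.

Lemma suppb (P : key -> Prop) k : P k -> supp P (bv k).
Proof.
by move=> pk x; rewrite cf_bv; have [<- //|ne] := eqVneq k x; rewrite eqxx.
Qed.

Lemma suppD P u v : supp P u -> supp P v -> supp P (u + v).
Proof. by rewrite -[u in _ (u + v)]scale1r; exact: suppA. Qed.

Lemma suppZ P c u : supp P u -> supp P (c *: u).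
Proof. by rewrite -[c *: u]addr0 => h; apply: suppA => //; exact: supp0. Qed.

Lemma supp_sum P (I : eqType) (r : seq I) (F : I -> V) :
  (forall i, i \in r -> supp P (F i)) -> supp P (\sum_(i <- r) F i).
Proof.
move=> h; rewrite big_seq; apply: big_ind => //; first exact: supp0.
by move=> u v; exact: suppD.
Qed.

Lemma supp_fsum P (I : choiceType) (F : I -> V) :
  (forall i, supp P (F i)) -> supp P (fsum F).
Proof. by apply: fsum_closed; [exact: supp0 | move=> u v; exact: suppD]. Qed.

Lemma supp_op (P Q : key -> Prop) (f : V -> V) w : lin f ->
  (forall k, P k -> supp Q (f (bv k))) -> supp P w -> supp Q (f w).
Proof.
move=> hf h hw; rewrite (vec_sum w) lin_sum //; apply: supp_sum => k.
rewrite mem_dom => /hw pk.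
by rewrite linZ //; apply: suppZ; exact: h.
Qed.

Lemma supp_zsum P (F : int -> V) : (forall i : int, supp P (F i)) -> supp P (fsum F).
Proof. exact: supp_fsum. Qed.

(** The degree [d] leaves out the [m^2 / 4] that [e^(m varpi)] adds to the conformal weight, so it
    is an integer in odd charge too. *)
Definition homog (m d : int) := supp (fun k => k.1 = m /\ (pwt k.2)%:Z = d).

Lemma hom_neg m d w : homog m d w -> d < 0 -> w = 0.
Proof.
move=> h d0; apply: cf_eq => k; rewrite cf0; apply/eqP.
by apply/negPn/negP => /h [_ e]; move: d0; rewrite -e.
Qed.

Lemma hom_sum m d w : homog m d w ->
  exists s : seq (K * key), [/\ w = \sum_(x <- s) x.1 *: bv x.2 &
    forall x, x \in s -> x.2.1 = m /\ (pwt x.2.2)%:Z = d].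
Proof.
move=> h; exists [seq (cf k w, k) | k <- dom (w : Defs.V K)]; rewrite big_map.
split; first exact: vec_sum.
by move=> x /mapP[k kd ->]; apply: h; rewrite -mem_dom.
Qed.

Lemma homb k : homog k.1 (pwt k.2) (bv k).
Proof. by apply: suppb. Qed.

Lemma homog_ind (m d : int) (P : V -> Prop) : P 0 ->
  (forall c k w, k.1 = m -> (pwt k.2)%:Z = d -> homog m d w -> P w -> P (c *: bv k + w)) ->
  forall w, homog m d w -> P w.
Proof.
move=> P0 PA w /hom_sum [s [-> hs]].
suff [] : homog m d (\sum_(x <- s) x.1 *: bv x.2) /\
     P (\sum_(x <- s) x.1 *: bv x.2) by [].
elim: s hs => [|x s IH] hs.
  by rewrite big_nil; split=> //; exact: supp0.
rewrite big_cons; have [y ys|h1 h2] := IH; first by apply: hs; rewrite inE ys orbT.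
have [e1 e2] := hs x (mem_head _ _).
split; last exact: PA.
by apply: suppA => //; rewrite -e1 -e2; exact: homb.
Qed.

Lemma hom_ext (M : lmodType K) m d (f g : V -> M) :
  (forall c u v, homog m d u -> homog m d v -> f (c *: u + v) = c *: f u + f v) ->
  (forall c u v, homog m d u -> homog m d v -> g (c *: u + v) = c *: g u + g v) ->
  (forall k, k.1 = m -> (pwt k.2)%:Z = d -> f (bv k) = g (bv k)) ->
  forall w, homog m d w -> f w = g w.
Proof.
move=> hf hg h.
have z (q : V -> M) : (forall c u v, homog m d u -> homog m d v ->
    q (c *: u + v) = c *: q u + q v) -> q 0 = 0.
  move=> hq; have := hq 1 0 0 (@supp0 _) (@supp0 _); rewrite !scale1r addr0.
  by move=> e; apply: (addrI (q 0)); rewrite addr0.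
apply: homog_ind; first by rewrite (z f hf) (z g hg).
move=> c k w km kd hw e.
have hb : homog m d (bv k) by rewrite -km -kd; exact: homb.
by rewrite hf // hg // h // e.
Qed.

(** Operators given by infinite sums have coefficients that depend on the charge and are finite only
    on homogeneous vectors. They are defined on keys, and this lemma carries the formula over to all
    homogeneous vectors. *)
Lemma fglift_hom (M : lmodType K) m d (g : key -> M) (f : V -> M) :
  (forall c u v, homog m d u -> homog m d v -> f (c *: u + v) = c *: f u + f v) ->
  (forall k, k.1 = m -> (pwt k.2)%:Z = d -> g k = f (bv k)) ->
  forall w, homog m d w -> lft g w = f w.
Proof.
move=> hf h; apply: hom_ext => //.
  by move=> c u v _ _; exact: fglift_lin.
by move=> k km kd; rewrite fgliftb; exact: h.
Qed.

Lemma hom_op m d m' d' (f : V -> V) w : lin f ->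
  (forall k, k.1 = m -> (pwt k.2)%:Z = d -> homog m' d' (f (bv k))) ->
  homog m d w -> homog m' d' (f w).
Proof. by move=> hf h; apply: supp_op => // k []; exact: h. Qed.

(* [cr t] is [varpi(-t)] and [an q] is [varpi(q)]; both are [0] on nonpositive indices, so
   that sums over modes can range over all of [int]. *)
Definition cr (t : int) : V -> V :=
  if t is Posz n.+1 then @hmode K (Negz n) else fun=> 0.
Definition an (q : int) : V -> V :=
  if q is Posz n.+1 then @hmode K (Posz n.+1) else fun=> 0.
Definition sh (b : int) : V -> V := lft (fun k => bv (k.1 + b, k.2)).

Lemma hmode_lin q : lin (@hmode K q). Proof. exact: fglift_lin. Qed.
Lemma lin_cst0 : lin (fun _ : V => 0 : V).
Proof. by move=> c u v; rewrite scaler0 addr0. Qed.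
Lemma cr_lin t : lin (cr t).
Proof. by case: t => [[|n]|n] /=; [exact: lin_cst0|exact: hmode_lin|exact: lin_cst0]. Qed.
Lemma an_lin t : lin (an t).
Proof. by case: t => [[|n]|n] /=; [exact: lin_cst0|exact: hmode_lin|exact: lin_cst0]. Qed.
Lemma sh_lin b : lin (sh b). Proof. exact: fglift_lin. Qed.

Lemma cr_le0 (t : int) w : t <= 0 -> cr t w = 0. Proof. by case: t => [[|n]|n]. Qed.
Lemma an_le0 (t : int) w : t <= 0 -> an t w = 0. Proof. by case: t => [[|n]|n]. Qed.

Lemma crb n m l : cr n.+1 (bv (m, l)) = bv (m, pins n.+1 l).
Proof. exact: (@fgliftb V (@hop K (Negz n))). Qed.
Lemma anb n m l : an n.+1 (bv (m, l)) =
  ((n.+1%:R / 2%:R) * (pmult n.+1 l)%:R) *: bv (m, prem n.+1 l).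
Proof.
by rewrite -monoE; exact: (@fgliftb V (@hop K (Posz n.+1))).
Qed.
Lemma shb b m l : sh b (bv (m, l)) = bv (m + b, l).
Proof. by rewrite /sh fgliftb. Qed.

Lemma sh_cr b t w : sh b (cr t w) = cr t (sh b w).
Proof.
case: t => [[|n]|n]; try by rewrite !cr_le0 // lin0 //; exact: sh_lin.
move: w; apply: lin_ext; try (apply: lin_comp; [exact: sh_lin|exact: cr_lin]).
  by apply: lin_comp; [exact: cr_lin|exact: sh_lin].
by case=> m l; rewrite crb !shb crb.
Qed.

Lemma sh_an b t w : sh b (an t w) = an t (sh b w).
Proof.
case: t => [[|n]|n]; try by rewrite !an_le0 // lin0 //; exact: sh_lin.
move: w; apply: lin_ext; try (apply: lin_comp; [exact: sh_lin|exact: an_lin]).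
  by apply: lin_comp; [exact: an_lin|exact: sh_lin].
by case=> m l; rewrite anb linZ ?shb ?anb //; exact: sh_lin.
Qed.

Lemma sh_sh b b' w : sh b (sh b' w) = sh (b + b') w.
Proof.
move: w; apply: lin_ext; first by apply: lin_comp; exact: sh_lin.
  exact: sh_lin.
by case=> m l; rewrite !shb -addrA (addrC b).
Qed.

Lemma sh0 w : sh 0 w = w.
Proof.
move: w; apply: (@lin_ext _ _ id) => //; first exact: sh_lin.
by case=> m l; rewrite shb addr0.
Qed.

Lemma cr_cr t t' w : cr t (cr t' w) = cr t' (cr t w).
Proof.
case: t t' => [[|n]|n] [[|n']|n'] //; try by rewrite lin0 //; exact: cr_lin.
move: w; apply: lin_ext; try by apply: lin_comp; exact: cr_lin.
by case=> m l; rewrite !crb pinsC.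
Qed.

Lemma an_an t t' w : an t (an t' w) = an t' (an t w).
Proof.
case: t t' => [[|n]|n] [[|n']|n'] //; try by rewrite lin0 //; exact: an_lin.
move: w; apply: lin_ext; try by apply: lin_comp; exact: an_lin.
case=> m l; rewrite !anb !linZ; try exact: an_lin.
rewrite !anb !scalerA premC.
have [-> //|nn'] := eqVneq n n'; congr (_ *: _).
rewrite !pmult_prem !eqSS (eq_sym n') (negPf nn') /= !subn0.
ring.
Qed.

Lemma an_cr q t w : an q (cr t w) =
  cr t (an q w) + (if (q == t) && (0 < q) then (q%:~R / 2%:R) *: w else 0).
Proof.
have [q0|q0] := lerP q 0; first by rewrite andbF !an_le0 // lin0 ?addr0 //; exact: cr_lin.
have [t0|] := lerP t 0.
  rewrite (cr_le0 w t0) (cr_le0 _ t0) (gt_eqF (le_lt_trans t0 q0)) lin0 ?addr0 //.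
  exact: an_lin.
case: t => [[//|n]|//] _; case: q q0 => [[//|p]|//] _; rewrite andbT.
have lL : lin (fun w => an p.+1 (cr n.+1 w)).
  by apply: lin_comp; [exact: an_lin|exact: cr_lin].
have lR : lin (fun w => cr n.+1 (an p.+1 w)).
  by apply: lin_comp; [exact: cr_lin|exact: an_lin].
rewrite [Posz _ == _]eqSS; have [-> {p lL lR}|np] := eqVneq p n; last first.
  rewrite addr0; move: w; apply: lin_ext => // -[m l].
  rewrite crb !anb (linZ _ _ (@cr_lin _)).
  by rewrite crb prem_pins // pmult_pins // eqSS (negPf np) add0n.
move: w; apply: lin_ext.
- by apply: lin_comp; [exact: an_lin|exact: cr_lin].
- apply: linadd; last exact: (linscale _ (fun _ _ _ => erefl)).
  by apply: lin_comp; [exact: cr_lin|exact: an_lin].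
case=> m l; rewrite crb !anb (linZ _ _ (@cr_lin _)).
rewrite crb prem_pins // pmult_pins // eqxx.
have [z|nz] := eqVneq (pmult n.+1 l) 0%N.
  by rewrite z mulr0 scale0r add0r mulr1 -pmulrn.
rewrite pins_prem -?pmult_mem ?nz // -scalerDl -pmulrn /= add1n; congr (_ *: _).
by rewrite -(natr1 (pmult _ _)) mulrDr mulr1.
Qed.

Lemma hom_cr m d t w : homog m d w -> homog m (d + t) (cr t w).
Proof.
case: t => [[|n]|n]; try by move=> _; exact: supp0.
apply: hom_op; first exact: cr_lin.
move=> [i l] e; move: (e : i = m) => {e} -> hd; rewrite (crb n).
by apply: suppb => /=; split=> //; rewrite pwt_pins // PoszD hd addrC.
Qed.

Lemma hom_an m d t w : homog m d w -> homog m (d - t) (an t w).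
Proof.
case: t => [[|n]|n]; try by move=> _; exact: supp0.
apply: hom_op; first exact: an_lin.
move=> [i l] e; move: (e : i = m) => {e} -> hd; rewrite (anb n).
have [z|nz] := eqVneq (pmult n.+1 l) 0%N.
  by rewrite z mulr0 scale0r; exact: supp0.
apply: suppZ; apply: suppb => /=; split=> //.
by rewrite -hd -(@pwt_prem n.+1 l) -?pmult_mem // PoszD addrC addKr.
Qed.

Lemma hom_sh m d b w : homog m d w -> homog (m + b) d (sh b w).
Proof.
apply: hom_op; first exact: sh_lin.
by case=> i l /= <- <-; rewrite shb; exact: homb.
Qed.

(** * Exponentials of Heisenberg modes *)

(* The coefficients of [exp (sum_(t > 0) beta c_t x^t / t)] for a commuting
   family [c_t]; both [Sop] and [Top] are instances. *)
Section Exp.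
Variable c : int -> V -> V.
Hypothesis c_lin : forall t, lin (c t).
Hypothesis c_le0 : forall (t : int) w, t <= 0 -> c t w = 0.
Hypothesis cC : forall t t' w, c t (c t' w) = c t' (c t w).

Fixpoint expaux (beta : K) (fuel i : nat) (v : V) : V :=
  match fuel with
  | 0 => v
  | f.+1 => if i == 0%N then v else
      (i%:R)^-1 *: \sum_(n < i) (beta *: c n.+1 (expaux beta f (i - n.+1) v))
  end.

Definition expz (beta : K) (i : int) (v : V) : V :=
  if i is Posz n then expaux beta n n v else 0.

Lemma expaux_fuel beta f i v : (i <= f)%N -> expaux beta f i v = expaux beta i i v.
Proof.
move: i; elim/ltn_ind: f => f IH [|i]; first by case: f {IH}.
case: f IH => // f IH hi /=; congr (_ *: _); apply: eq_bigr => n _.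
by rewrite !subSS !IH //; lia.
Qed.

Lemma expz_neg beta (i : int) v : i < 0 -> expz beta i v = 0.
Proof. by case: i. Qed.

Lemma fin_exprec (F : int -> V) (i : int) : (forall t : int, t > i -> F t = 0) ->
  fin (fun t => c t (F t)).
Proof.
move=> h; apply: (@fin_itv _ 1 i) => t /orP[t1|/h ->]; first by rewrite c_le0 //; lia.
exact: lin0.
Qed.

Lemma fin_expz beta i v : fin (fun t => c t (expz beta (i - t) v)).
Proof. by apply: (@fin_exprec _ i) => t ti; rewrite expz_neg //; lia. Qed.

Lemma expz_rec beta i v :
  i%:~R *: expz beta i v = beta *: fsum (fun t => c t (expz beta (i - t) v)).
Proof.
have small (j : int) : j <= 0 -> fsum (fun t => c t (expz beta (j - t) v)) = 0.
  move=> j0; apply: zsum_eq0 => t; have [t0|t0] := lerP t 0; first by rewrite c_le0.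
  by rewrite expz_neg ?lin0 //; lia.
case: i => [[|n]|n].
- by rewrite scale0r small // scaler0.
- rewrite /= -(@fsum_shift _ 1); last exact: fin_expz.
  rewrite (@fsum_ord _ n.+1); last first.
    move=> t /orP[t0|tn]; first by rewrite c_le0 //; lia.
    by rewrite expz_neg ?lin0 //; lia.
  rewrite scalerA -pmulrn mulfV // scale1r scaler_sumr; apply: eq_bigr => t _.
  have tn := ltn_ord t; rewrite subSS (_ : t%:Z + 1 = t.+1); last by lia.
  have -> : n.+1%:Z - t.+1%:Z = (n - t)%N by lia.
  by rewrite expaux_fuel //; lia.
- by rewrite expz_neg // scaler0 small ?scaler0.
Qed.

Lemma expz_lin beta i : lin (expz beta i).
Proof.
elim/zind: i => [i i0 a u v|i i0 IH a u v].
  by rewrite !expz_neg // scaler0 addr0.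
have [->|nz] := eqVneq i 0; first by [].
apply: (scalerI (intK_neq0 nz)).
rewrite expz_rec [RHS]scalerDr [i%:~R *: (a *: _)]scaleC !expz_rec [a *: (beta *: _)]scaleC.
rewrite -[RHS]scalerDr -[a *: fsum _]fsumZ; last exact: fin_expz.
rewrite -fsumD; [|apply: (finZ (fun=> a)); exact: fin_expz|exact: fin_expz].
congr (_ *: _); apply: eq_zsum => t; have [t0|t0] := lerP t 0.
  by rewrite !c_le0 // scaler0 addr0.
by rewrite IH ?c_lin //; lia.
Qed.

Lemma expz_comm beta (f : V -> V) : lin f -> (forall t w, f (c t w) = c t (f w)) ->
  forall i w, f (expz beta i w) = expz beta i (f w).
Proof.
move=> hf hc i w; elim/zind: i => [i i0|i i0 IH].
  by rewrite !expz_neg // lin0.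
have [->|nz] := eqVneq i 0; first by [].
apply: (scalerI (intK_neq0 nz)).
rewrite -linZ // !expz_rec linZ // lin_fsum //; last exact: fin_expz.
congr (_ *: _); apply: eq_zsum => t; have [t0|t0] := lerP t 0.
  by rewrite !c_le0 // lin0.
by rewrite hc IH //; lia.
Qed.

Lemma c_expz beta i t w : c t (expz beta i w) = expz beta i (c t w).
Proof. exact: expz_comm. Qed.

Lemma fin_conv beta beta' i w :
  fin (fun k => expz beta k (expz beta' (i - k) w)).
Proof.
apply: (@fin_itv _ 0 i) => k /orP[k0|ki]; first by rewrite expz_neg.
by rewrite (@expz_neg beta') ?lin0 //; [exact: expz_lin|lia].
Qed.

Lemma expz_conv beta beta' i w :
  expz (beta + beta') i w = fsum (fun k => expz beta k (expz beta' (i - k) w)).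
Proof.
elim/zind: i w => [i i0 w|i i0 IH w].
  rewrite expz_neg // zsum_eq0 // => k; have [k0|k0] := ltrP k 0.
    by rewrite expz_neg.
  by rewrite (@expz_neg beta') ?lin0 //; [exact: expz_lin|lia].
have [->|nz] := eqVneq i 0.
  rewrite (@zsum_eq1 _ 0) // => k k0; have [k1|k1] := ltrP k 0.
    by rewrite expz_neg.
  by rewrite (@expz_neg beta') ?lin0 //; [exact: expz_lin|lia].
apply: (scalerI (intK_neq0 nz)); rewrite expz_rec.
(* Leibniz rule: [i = k + (i - k)] splits [i] times the convolution in two, and the recursion of
   either factor turns its share into [beta] or [beta'] times this same double sum. *)
pose F (x : int * int) := expz beta x.2 (c x.1 (expz beta' (i - x.1 - x.2) w)).
have finF : fin F.
  apply: (@fin_itv2 _ 1 i 0 i) => t k h; rewrite /F /=.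
  have [t0|t0] := lerP t 0; first by rewrite c_le0 // lin0 //; exact: expz_lin.
  have [k0|k0] := ltrP k 0; first by rewrite expz_neg.
  rewrite (@expz_neg beta') ?(lin0 (@c_lin _)) ?(lin0 (@expz_lin _ _)) //; lia.
have -> : fsum (fun t => c t (expz (beta + beta') (i - t) w)) = fsum F.
  rewrite fsum_pair //; apply: eq_zsum => t; have [t0|t0] := lerP t 0.
    rewrite c_le0 // zsum_eq0 // => k.
    by rewrite /F /= c_le0 // lin0 //; exact: expz_lin.
  rewrite IH ?lin_fsum //; [|exact: fin_conv|lia].
  by apply: eq_zsum => k; rewrite /F /= c_expz.
have e1 : beta *: fsum F = fsum (fun k => k%:~R *: expz beta k (expz beta' (i - k) w)).
  pose h (x : int * int) := (x.1, x.2 - x.1).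
  have hK : cancel h (fun x => (x.1, x.2 + x.1)) by case=> a b; rewrite /h /= subrK.
  have hK' : cancel (fun x => (x.1, x.2 + x.1)) h by case=> a b; rewrite /h /= addrK.
  rewrite -(fsum_reindex hK hK' finF) (fsum_pair (fin_reindex hK finF)).
  rewrite (fsum_exchange (fin_reindex hK finF)) -fsumZ; last first.
    exact: (fin_pair1 (fin_swap (fin_reindex hK finF))).
  apply: eq_zsum => k; rewrite expz_rec; congr (_ *: _); apply: eq_zsum => t.
  by rewrite /F /= -c_expz (_ : i - t - (k - t) = i - k) //; lia.
have e2 : beta' *: fsum F =
    fsum (fun k => (i - k)%:~R *: expz beta k (expz beta' (i - k) w)).
  rewrite fsum_pair // fsum_exchange // -fsumZ; last first.
    exact: (fin_pair1 (fin_swap finF)).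
  apply: eq_zsum => k; rewrite -(linZ _ _ (expz_lin beta k)) expz_rec.
  rewrite (linZ _ _ (expz_lin beta k)) (lin_fsum (expz_lin beta k)); last exact: fin_expz.
  congr (_ *: _); apply: eq_zsum => t.
  by rewrite /F /= (_ : i - t - k = i - k - t) //; lia.
rewrite scalerDl e1 e2 -fsumD; try exact/finZ/fin_conv.
rewrite -fsumZ; last exact: fin_conv.
by apply: eq_zsum => k; rewrite -scalerDl -rmorphD /= addrC subrK.
Qed.

Lemma expz_beta0 (i : int) w : i != 0 -> expz 0 i w = 0.
Proof.
move=> nz; apply: (scalerI (intK_neq0 nz)).
by rewrite expz_rec scale0r scaler0.
Qed.

Lemma expz_closed (Z : V -> Prop) : Z 0 ->
  (forall a u v, Z u -> Z v -> Z (a *: u + v)) -> (forall t w, Z w -> Z (c t w)) ->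
  forall beta i w, Z w -> Z (expz beta i w).
Proof.
move=> Z0 ZA Zc beta i w Zw; elim/zind: i => [i i0|i i0 IH]; first by rewrite expz_neg.
have [->|nz] := eqVneq i 0; first by [].
have ZZ a u : Z u -> Z (a *: u) by move=> zu; rewrite -[_ *: _]addr0; exact: ZA.
have ZD u v : Z u -> Z v -> Z (u + v) by move=> zu; rewrite -[u]scale1r; exact: ZA.
rewrite -[expz _ _ _]scale1r -(mulVf (intK_neq0 nz)) -scalerA expz_rec.
apply/ZZ/ZZ; apply: zsum_closed => // t.
have [t0|t0] := lerP t 0; first by rewrite c_le0.
by apply/Zc/IH; lia.
Qed.

Lemma hom_expz s : (forall m d (t : int) w, homog m d w -> homog m (d + s * t) (c t w)) ->
  forall beta m d i w, homog m d w -> homog m (d + s * i) (expz beta i w).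
Proof.
move=> hc beta m d i w hw; elim/zind: i => [i i0|i i0 IH].
  by rewrite expz_neg //; exact: supp0.
have [->|nz] := eqVneq i 0; first by rewrite mulr0 addr0.
rewrite -[expz _ _ _]scale1r -(mulVf (intK_neq0 nz)) -scalerA expz_rec.
apply: suppZ; apply: suppZ; apply: supp_zsum => t.
have [t0|t0] := lerP t 0; first by rewrite c_le0 //; exact: supp0.
rewrite (_ : d + s * i = (d + s * (i - t)) + s * t); last by ring.
by apply/hc/IH; lia.
Qed.

End Exp.

Definition Sz (b : int) := expz cr b%:~R.
Definition Tz (b : int) := expz an (- b%:~R).

Lemma SopE b n (v : V) : Sop b n v = Sz b n v :> V.
Proof.
suff h f m : Saux b f m v = expaux cr b%:~R f m v :> V by exact: h.
elim: f m => //= f IH m; case: eqP => // _.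
apply: (f_equal (fun x : V => m%:R^-1 *: x)); apply: eq_bigr => i _.
by apply: (f_equal (fun x : V => b%:~R *: cr i.+1 x)); exact: IH.
Qed.

Lemma TopE b n (v : V) : Top b n v = Tz b n v :> V.
Proof.
suff h f m : Taux b f m v = expaux an (- b%:~R) f m v :> V by exact: h.
elim: f m => //= f IH m; case: eqP => // _.
apply: (f_equal (fun x : V => m%:R^-1 *: x)); apply: eq_bigr => i _.
by apply: (f_equal (fun x : V => - b%:~R *: an i.+1 x)); exact: IH.
Qed.

End Fock.

(** * Commutation relations between the exponentials *)

Section Relations.
Variable K : fieldType.
Hypothesis char0 : forall n : nat, n.+1%:R != 0 :> K.
Local Notation V := (Fock K).

Lemma Sz_lin b i : lin (@Sz K b i).
Proof. by apply: expz_lin => //; [exact: cr_lin | exact: cr_le0]. Qed.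
Lemma Tz_lin b i : lin (@Tz K b i).
Proof. by apply: expz_lin => //; [exact: an_lin | exact: an_le0]. Qed.

Lemma Sz_neg b (i : int) (w : V) : i < 0 -> Sz b i w = 0.
Proof. exact: expz_neg. Qed.
Lemma Tz_neg b (i : int) (w : V) : i < 0 -> Tz b i w = 0.
Proof. exact: expz_neg. Qed.
Lemma Sz0 b (w : V) : Sz b 0 w = w. Proof. by []. Qed.
Lemma Tz0 b (w : V) : Tz b 0 w = w. Proof. by []. Qed.

Lemma Sz_rec b i (w : V) :
  i%:~R *: Sz b i w = b%:~R *: fsum (fun t => cr t (Sz b (i - t) w)).
Proof. by apply: expz_rec => //; [exact: cr_lin | exact: cr_le0]. Qed.
Lemma Tz_rec b i (w : V) :
  i%:~R *: Tz b i w = - b%:~R *: fsum (fun t => an t (Tz b (i - t) w)).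
Proof. by apply: expz_rec => //; [exact: an_lin | exact: an_le0]. Qed.

Lemma fin_Sz b i (w : V) : fin (fun t => cr t (Sz b (i - t) w)).
Proof. by apply: fin_expz; [exact: cr_lin | exact: cr_le0]. Qed.
Lemma fin_Tz b i (w : V) : fin (fun t => an t (Tz b (i - t) w)).
Proof. by apply: fin_expz; [exact: an_lin | exact: an_le0]. Qed.

Lemma Sz_comm (f : V -> V) : lin f -> (forall t w, f (cr t w) = cr t (f w)) ->
  forall b i w, f (Sz b i w) = Sz b i (f w).
Proof. by move=> hf hc b; apply: expz_comm => //; [exact: cr_lin | exact: cr_le0]. Qed.
Lemma Tz_comm (f : V -> V) : lin f -> (forall t w, f (an t w) = an t (f w)) ->
  forall b i w, f (Tz b i w) = Tz b i (f w).
Proof. by move=> hf hc b; apply: expz_comm => //; [exact: an_lin | exact: an_le0]. Qed.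

Lemma sh_Sz b b' i (w : V) : sh b (Sz b' i w) = Sz b' i (sh b w).
Proof. by apply: Sz_comm; [exact: sh_lin | exact: sh_cr]. Qed.
Lemma sh_Tz b b' i (w : V) : sh b (Tz b' i w) = Tz b' i (sh b w).
Proof. by apply: Tz_comm; [exact: sh_lin | exact: sh_an]. Qed.
Lemma cr_Sz t b i (w : V) : cr t (Sz b i w) = Sz b i (cr t w).
Proof. by apply: Sz_comm; [exact: cr_lin | exact: cr_cr]. Qed.
Lemma an_Tz t b i (w : V) : an t (Tz b i w) = Tz b i (an t w).
Proof. by apply: Tz_comm; [exact: an_lin | exact: an_an]. Qed.
Lemma Sz_Sz b i b' i' (w : V) : Sz b i (Sz b' i' w) = Sz b' i' (Sz b i w).
Proof. by apply: Sz_comm => [|t u]; [exact: Sz_lin | rewrite cr_Sz]. Qed.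
Lemma Tz_Tz b i b' i' (w : V) : Tz b i (Tz b' i' w) = Tz b' i' (Tz b i w).
Proof. by apply: Tz_comm => [|t u]; [exact: Tz_lin | rewrite an_Tz]. Qed.

Lemma Sz_conv b b' i (w : V) :
  Sz (b + b') i w = fsum (fun k => Sz b k (Sz b' (i - k) w)).
Proof.
rewrite /Sz rmorphD; apply: expz_conv => //.
- exact: cr_lin.
- exact: cr_le0.
- exact: cr_cr.
Qed.
Lemma Tz_conv b b' i (w : V) :
  Tz (b + b') i w = fsum (fun k => Tz b k (Tz b' (i - k) w)).
Proof.
rewrite /Tz rmorphD opprD; apply: expz_conv => //.
- exact: an_lin.
- exact: an_le0.
- exact: an_an.
Qed.

Lemma hom_Sz b m d i (w : V) : homog m d w -> homog m (d + i) (Sz b i w).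
Proof.
rewrite (_ : d + i = d + 1 * i); last by rewrite mul1r.
apply: hom_expz => //.
- exact: cr_lin.
- exact: cr_le0.
- by move=> m' d' t u; rewrite mul1r; exact: hom_cr.
Qed.
Lemma hom_Tz b m d i (w : V) : homog m d w -> homog m (d - i) (Tz b i w).
Proof.
rewrite (_ : d - i = d + -1 * i); last by rewrite mulN1r.
apply: hom_expz => //.
- exact: an_lin.
- exact: an_le0.
- by move=> m' d' t u; rewrite mulN1r; exact: hom_an.
Qed.

Lemma Tz_big b m (d j : int) (w : V) : homog m d w -> d < j -> Tz b j w = 0.
Proof. by move=> hw dj; apply: (@hom_neg _ m (d - j)); [exact: hom_Tz | lia]. Qed.

Lemma an_big m (d j : int) (w : V) : homog m d w -> d < j -> an j w = 0.
Proof. by move=> hw dj; apply: (@hom_neg _ m (d - j)); [exact: hom_an | lia]. Qed.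

(** The commutator of [varpi(q)] with the exponent [b sum_t varpi(-t) x^t / t] is the scalar
    [(b / 2) x^q]. In the recursion the commutator contributes [q] and the induction hypothesis
    [i - q], together the required factor [i]. *)
Lemma an_Sz b (q i : int) (w : V) : 0 < q ->
  an q (Sz b i w) = Sz b i (an q w) + (b%:~R / 2%:R) *: Sz b (i - q) w.
Proof.
move=> q0; elim/zind: i => [i i0|i i0 IH].
  by rewrite !Sz_neg ?(lin0 (@an_lin _ _)) ?scaler0 ?addr0 //; lia.
have [->|nz] := eqVneq i 0.
  by rewrite !Sz0 Sz_neg ?scaler0 ?addr0 //; lia.
apply: (scalerI (intK_neq0 char0 nz)).
rewrite -(linZ _ _ (@an_lin K q)) Sz_rec (linZ _ _ (@an_lin K q)).
rewrite (lin_fsum (@an_lin K q)); last exact: fin_Sz.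
pose G (t : int) : V := if q == t then (q%:~R / 2%:R) *: Sz b (i - t) w else 0.
have finG : fin G by exists [:: q] => t; rewrite inE /G eq_sym => /negPf ->.
have fA := @fin_Sz b i (an q w).
have fB := @fin_Sz b (i - q) w.
have -> : fsum (fun t => an q (cr t (Sz b (i - t) w))) =
  fsum (fun t => (cr t (Sz b (i - t) (an q w)) +
    (b%:~R / 2%:R) *: cr t (Sz b (i - q - t) w)) + G t).
  apply: eq_zsum => t; rewrite an_cr q0 andbT; congr (_ + _).
  have [t0|t0] := lerP t 0; first by rewrite !cr_le0 // scaler0 addr0.
  rewrite IH; last by lia.
  rewrite (linD _ _ (@cr_lin K t)) (linZ _ _ (@cr_lin K t)).
  by rewrite (_ : i - t - q = i - q - t) //; lia.
rewrite fsumD //; last by apply: finD => //; exact: (finZ (fun=> _)).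
rewrite fsumD //; last exact: (finZ (fun=> _)).
rewrite fsumZ // (@zsum_eq1 _ q G) => [|t]; last by rewrite /G; case: (q =P t) => // ->; rewrite eqxx.
rewrite /G eqxx !scalerDr -Sz_rec (scaleC b%:~R (_ / _)) -Sz_rec -addrA; congr (_ + _).
rewrite !scalerA -scalerDl; congr (_ *: _).
by rewrite rmorphB /=; ring.
Qed.

(** The two exponentials contract to [exp (- (b b' / 2) sum_t x^t / t) = (1 - x)^(b b' / 2)], which
    is [1 - x] for [b * b' = 2]. *)
Lemma Tz_Sz (b b' j i : int) (w : V) : b * b' = 2 ->
  Tz b' j (Sz b i w) = Sz b i (Tz b' j w) - Sz b (i - 1) (Tz b' (j - 1) w).
Proof.
move=> bb; have bbK : b'%:~R * (b%:~R / 2%:R) = 1 :> K.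
  rewrite mulrCA mulrA -rmorphM bb /= -(pmulrn 1 2) divff //.
elim/zind: j i => [j j0 i|j j0 IH i].
  by rewrite !Tz_neg ?(lin0 (@Sz_lin _ _)) ?subr0 //; lia.
have [->|nz] := eqVneq j 0.
  by rewrite !Tz0 (@Tz_neg b' (0 - 1)) ?(lin0 (@Sz_lin _ _)) ?subr0 //; lia.
apply: (scalerI (intK_neq0 char0 nz)).
pose A t := an t (Tz b' (j - t) w); pose B t := an t (Tz b' (j - 1 - t) w).
have fA : fin A by exact: fin_Tz.
have fB : fin B by exact: fin_Tz.
(* The terms created when [an t] passes [Sz]. They occur as differences [P t - P (t + 1)] and
   telescope to [P 1], which completes the factor [j - 1] of the shifted term to [j]. *)
pose P t : V := if 0 < t then Sz b (i - t) (Tz b' (j - t) w) else 0.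
have fP : fin P.
  apply: (@fin_itv _ 1 j) => t /orP[t1|tj]; rewrite /P; first by rewrite ifF //; lia.
  by case: ifP => // _; rewrite Tz_neg ?(lin0 (@Sz_lin _ _)) //; lia.
have lA : lin (@Sz K b i) by exact: Sz_lin.
have lB : lin (@Sz K b (i - 1)) by exact: Sz_lin.
rewrite Tz_rec.
have -> : fsum (fun t => an t (Tz b' (j - t) (Sz b i w))) =
   fsum (fun t => (Sz b i (A t) - Sz b (i - 1) (B t)) +
        (b%:~R / 2%:R) *: (P t - P (t + 1))) + (b%:~R / 2%:R) *: P 1.
  have fPs : fin (fun t => P (t + 1)).
    by apply: (@fin_reindex _ _ _ (fun t => t + 1) (fun t => t - 1)) => // t; rewrite addrK.
  (* Over all integers the differences sum to zero. At [t = 0] the operator [an t] vanishes while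
     [P 0 - P 1] is [- P 1]; [Q] compensates for that one term. *)
  pose Q (t : int) : V := if t == 0 then P 1 else 0.
  have fQ : fin Q by exists [:: 0] => t; rewrite inE /Q => /negPf ->.
  rewrite -[P 1]/(Q 0) -(@zsum_eq1 _ 0 Q); last by move=> t; rewrite /Q => /negPf ->.
  rewrite -(fsumZ _ fQ) -fsumD; first last.
  - exact: (finZ (fun=> _)).
  - apply: finD; last by apply: (finZ (fun=> _)); apply: finD => //;
      apply: (@fin_comp _ _ _ -%R); rewrite ?oppr0.
    apply: finD; first by apply: fin_comp => //; exact: lin0.
    apply: (@fin_comp _ _ _ -%R); rewrite ?oppr0 //.
    by apply: fin_comp => //; exact: lin0.
  apply: eq_zsum => t; have [t0|t0] := lerP t 0.
    rewrite /A /B !an_le0 // !(lin0 (@Sz_lin _ _)) subr0 add0r /P ifF ?sub0r; last by lia.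
    rewrite /Q; case: eqP => [->|t1]; first by rewrite ltr01 add0r scalerN addNr.
    by rewrite ifF ?oppr0 ?scaler0 ?addr0 //; lia.
  rewrite {1}/Q ifF; last by lia.
  rewrite scaler0 addr0 IH; last by lia.
  rewrite (linB _ _ (@an_lin K t)) !an_Sz //.
  have shuf (x y z u : V) : x + y - (z + u) = (x - z) + (y - u).
    by rewrite opprD addrACA.
  rewrite shuf /A /B (_ : j - 1 - t = j - t - 1); last by lia.
  rewrite scalerBr /P t0 ifT; last by lia.
  rewrite (_ : i - 1 - t = i - (t + 1)); last by lia.
  by rewrite (_ : j - (t + 1) = j - t - 1) //; lia.
have -> : fsum (fun t => (Sz b i (A t) - Sz b (i - 1) (B t)) +
        (b%:~R / 2%:R) *: (P t - P (t + 1))) = Sz b i (fsum A) - Sz b (i - 1) (fsum B).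
  have fPs : fin (fun t => P (t + 1)).
    by apply: (@fin_reindex _ _ _ (fun t => t + 1) (fun t => t - 1)) => // t; rewrite addrK.
  have f1 : fin (fun t => Sz b i (A t)) by apply: fin_comp => //; exact: lin0.
  have f2 : fin (fun t => Sz b (i - 1) (B t)) by apply: fin_comp => //; exact: lin0.
  rewrite fsumD.
  - rewrite (fsumB f1 f2) -(lin_fsum lA fA) -(lin_fsum lB fB) fsumZ; last first.
      by apply: finD => //; apply: (@fin_comp _ _ _ -%R); rewrite ?oppr0.
    by rewrite fsumB // (fsum_shift _ fP) subrr scaler0 addr0.
  - by apply: finD => //; apply: (@fin_comp _ _ _ -%R); rewrite ?oppr0.
  - apply: (finZ (fun=> _)); apply: finD => //.
    by apply: (@fin_comp _ _ _ -%R); rewrite ?oppr0.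
rewrite scalerDr scalerBr -!(linZ _ _ (@Sz_lin _ _)) -!Tz_rec !(linZ _ _ (@Sz_lin _ _)).
rewrite scalerBr -addrA; congr (_ + _).
rewrite scalerA mulNr bbK scaleN1r -opprD; congr (- _).
by rewrite rmorphB /= scalerBl scale1r subrK.
Qed.

End Relations.

(** * Fields and vertex operators *)

Section Fields.
Variable K : fieldType.
Hypothesis char0 : forall n : nat, n.+1%:R != 0 :> K.
Local Notation V := (Fock K).
Implicit Types (X Y : int -> V -> V) (w : V).

Definition gbinz (x : K) (a : int) : K := if a is Posz n then gbin x n else 0.

Lemma gbinz_neg x (a : int) : a < 0 -> gbinz x a = 0. Proof. by case: a. Qed.

Lemma gbinz0 x : gbinz x 0 = 1. Proof. exact: gbin0. Qed.

Lemma gbinzS x (a : int) : gbinz (x + 1) a = gbinz x a + gbinz x (a - 1).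
Proof.
case: a => [[|n]|n]; first by rewrite !gbinz0 (@gbinz_neg x) ?addr0.
  by rewrite (_ : n.+1%:Z - 1 = n) ?[gbinz _ _]gbinS //; lia.
by rewrite !gbinz_neg ?addr0 //; lia.
Qed.

(* A field of charge [g]: [X d w] is the part of output weight [d] of [X(1) w];
   the formal variable is recovered from the weights. *)
Definition isfield (g : int) X :=
  (forall d, lin (X d)) /\
  (forall m e d w, homog m e w -> homog (m + g) d (X d w)).

Lemma fld_neg g X (d : int) w : isfield g X -> d < 0 -> X d w = 0.
Proof.
move=> [hl hX] d0; move: w; apply: lin_ext => // [|k].
  by move=> c u v; rewrite scaler0 addr0.
by apply: (@hom_neg _ (k.1 + g) d) => //; apply: hX; exact: homb.
Qed.

Lemma fld_eq g X Y : isfield g X -> isfield g Y ->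
  (forall m e d w, homog m e w -> X d w = Y d w) -> X = Y.
Proof.
move=> [hX _] [hY _] h; apply: funext => d; apply: funext => w; move: w.
by apply: lin_ext => // k; apply: h; exact: homb.
Qed.

Lemma fsum_homlin (I : choiceType) m e (F : V -> I -> V) :
  (forall i c u v, F (c *: u + v) i = c *: F u i + F v i) ->
  (forall w, homog m e w -> fin (F w)) ->
  forall c u v, homog m e u -> homog m e v ->
  fsum (F (c *: u + v)) = c *: fsum (F u) + fsum (F v).
Proof.
move=> hF hf c u v hu hv.
have fu := hf _ hu; have fv := hf _ hv.
rewrite -fsumZ // -fsumD //; last exact: (finZ (fun=> c)).
by apply: eq_fsum => i; rewrite hF.
Qed.

Definition Dt (b m a : int) X (d : int) w (x : int * int) : V :=
  gbinz ((x.1 - x.2)%:~R + (b * m)%:~R / 2%:R) a *: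
    sh b (Sz b x.1 (X (d - x.1) (Tz b x.2 w))).

(* If [X] is the field of [v], then [Df b a X] is the field of [S_a e_(b varpi) v], see [Yf_S]:
   the [a]-th divided derivative falls on the exponential and brings down the binomial. *)
Definition Df (b a : int) X (d : int) : V -> V :=
  lft (fun k => fsum (Dt b k.1 a X d (bv K k))).

Lemma zero_Dt b g X (d : int) m (e : int) w (i j : int) : isfield g X -> homog m e w ->
  [|| i < 0, d < i, j < 0 | e < j] -> Sz b i (X (d - i) (Tz b j w)) = 0.
Proof.
move=> hX hw.
have [i0|_] := boolP (i < 0); first by rewrite Sz_neg.
have [di|_] := boolP (d < i).
  by rewrite (fld_neg _ hX) ?(lin0 (@Sz_lin _ char0 _ _)) //; lia.
move=> /= /orP[j0|ej]; first by rewrite Tz_neg // (lin0 (hX.1 _)) (lin0 (@Sz_lin _ char0 _ _)).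
by rewrite (Tz_big char0 _ hw) // (lin0 (hX.1 _)) (lin0 (@Sz_lin _ char0 _ _)).
Qed.

Lemma fin_Dt b m m' a g X d e w : isfield g X -> homog m e w -> fin (Dt b m' a X d w).
Proof.
move=> hX hw; apply: (@fin_itv2 _ 0 d 0 e) => i j h.
by rewrite /Dt (zero_Dt _ hX hw h) (lin0 (@sh_lin _ _)) scaler0.
Qed.

Lemma Dt_lin b m a g X d x : isfield g X -> lin (fun w => Dt b m a X d w x).
Proof.
move=> hX; apply: linscale; apply: lin_comp; first exact: sh_lin.
apply: lin_comp; first exact: Sz_lin.
by apply: lin_comp; [exact: hX.1 | exact: Tz_lin].
Qed.

Lemma Df_hom b a g X d m e w : isfield g X -> homog m e w ->
  Df b a X d w = fsum (Dt b m a X d w).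
Proof.
move=> hX.
apply: (@fglift_hom _ _ _ _ _ (fun w => fsum (Dt b m a X d w))); last by move=> k <-.
apply: (@fsum_homlin _ m e (Dt b m a X d)) => [x|w' hw']; first exact: Dt_lin hX.
exact: fin_Dt hX hw'.
Qed.

Lemma isfield_Df b a g X : isfield g X -> isfield (g + b) (Df b a X).
Proof.
move=> hX; split=> [d|m e d w hw]; first exact: fglift_lin.
rewrite (Df_hom _ _ _ hX hw); apply: supp_fsum => -[i j]; apply: suppZ.
rewrite addrA; apply: hom_sh; rewrite /= -[d in homog _ d _](subrK i).
by apply: (hom_Sz char0); apply: hX.2; exact: (hom_Tz char0 hw).
Qed.

Lemma Df_neg b (a : int) X d w : a < 0 -> Df b a X d w = 0.
Proof.
move=> a0; rewrite /Df; move: w; apply: lin_ext; first exact: fglift_lin.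
  by move=> c u v; rewrite scaler0 addr0.
by move=> k; rewrite fgliftb fsum_eq0 // => x; rewrite /Dt gbinz_neg // scale0r.
Qed.

Definition wproj (d : int) : V -> V :=
  lft (fun k => if (pwt k.2)%:Z == d then bv K k else 0).

Lemma wproj_hom m e d w : homog m e w -> wproj d w = if e == d then w else 0.
Proof.
apply: (@fglift_hom _ _ _ _ _ (fun w => if e == d then w else 0)) => [c u v _ _|k _ ->] //.
by case: eqP => // _; rewrite scaler0 addr0.
Qed.

Lemma isfield_wproj : isfield 0 wproj.
Proof.
split=> [d|m e d w hw]; first exact: fglift_lin.
rewrite (wproj_hom d hw) addr0; case: eqP => [<- //|_]; exact: supp0.
Qed.

Definition aPt (s : nat) w (q : int) : V := gbin (- q - 1)%:~R s *: an q w.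

(** The part of [d^(s) varpi(z)] that normal ordering puts on the right, at [z = 1]: the zero mode
    with coefficient [binom(-1, s)], and the positive modes. *)
Definition aP (s : nat) : V -> V := lft (fun k =>
  (gbin (-1) s * (k.1%:~R / 2%:R)) *: bv K k + fsum (aPt s (bv K k))).

Lemma fin_aPt s m e w : homog m e w -> fin (aPt s w).
Proof.
move=> hw; apply: (@fin_itv _ 1 e) => q /orP[q1|eq].
  by rewrite /aPt an_le0 ?scaler0 //; lia.
by rewrite /aPt (an_big hw) // scaler0.
Qed.

Lemma aP_hom s m e w : homog m e w ->
  aP s w = (gbin (-1) s * (m%:~R / 2%:R)) *: w + fsum (aPt s w).
Proof.
apply: (@fglift_hom _ _ _ _ _ (fun w => _ *: w + fsum (aPt s w))); last by move=> k <-.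
move=> c u v hu hv; rewrite (@fsum_homlin _ m e) //; first last.
- by move=> w'; exact: fin_aPt.
- by move=> q a x y; rewrite /aPt an_lin scalerDr scaleC.
by rewrite !scalerDr addrACA scaleC.
Qed.

(* The normally ordered product of [d^(s) varpi(z)] with [X]. *)
Definition Pf (s : nat) X (d : int) w : V :=
  fsum (fun t => gbin (t - 1)%:~R s *: cr t (X (d - t) w)) + X d (aP s w).

Lemma fin_Pm s g X (d : int) w : isfield g X ->
  fin (fun t => gbin (t - 1)%:~R s *: cr t (X (d - t) w)).
Proof.
move=> hX; apply: (@fin_itv _ 1 d) => t /orP[t1|dt].
  by rewrite cr_le0 ?scaler0 //; lia.
by rewrite (fld_neg _ hX) ?(lin0 (@cr_lin _ _)) ?scaler0 //; lia.
Qed.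

Lemma aP_lin_hom s (f : V -> V) m e w : lin f -> homog m e w ->
  f (aP s w) = (gbin (-1) s * (m%:~R / 2%:R)) *: f w +
     fsum (fun q => gbin (- q - 1)%:~R s *: f (an q w)).
Proof.
move=> hf hw; rewrite (aP_hom s hw) (linD _ _ hf) (linZ _ _ hf).
rewrite (lin_fsum hf (fin_aPt s hw)); congr (_ + _).
by apply: eq_zsum => q; rewrite /aPt (linZ _ _ hf).
Qed.

Lemma aP_lin s : lin (aP s). Proof. exact: fglift_lin. Qed.

Lemma aP_aP s s' w : aP s (aP s' w) = aP s' (aP s w).
Proof.
move: w; apply: lin_ext; try by apply: lin_comp; exact: aP_lin.
move=> k; have hw : homog k.1 (pwt k.2) (bv K k) by exact: homb.
set w := bv K k in hw *.
have key p p' : aP p (aP p' w) =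
    (gbin (-1) p' * (k.1%:~R / 2%:R) * (gbin (-1) p * (k.1%:~R / 2%:R))) *: w +
    ((gbin (-1) p' * (k.1%:~R / 2%:R)) *: fsum (aPt p w) +
     (gbin (-1) p * (k.1%:~R / 2%:R)) *: fsum (aPt p' w)) +
    fsum (fun x : int * int => (gbin (- x.1 - 1)%:~R p * gbin (- x.2 - 1)%:~R p') *:
       an x.1 (an x.2 w)).
  rewrite (aP_lin_hom p' (@aP_lin p) hw) (aP_hom p hw) scalerDr scalerA -!addrA.
  congr (_ + (_ + _)); have f2 := fin_aPt p' hw.
  have f3 : fin (fun x : int * int => (gbin (- x.1 - 1)%:~R p * gbin (- x.2 - 1)%:~R p') *:
       an x.1 (an x.2 w)).
    apply: (@fin_itv2 _ 1 (pwt k.2) 1 (pwt k.2)) => t u h /=.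
    have [t1|t1] := boolP (t < 1); first by rewrite an_le0 ?scaler0 //; lia.
    have [u1|u1] := boolP (u < 1).
      by rewrite (@an_le0 _ u) ?(lin0 (@an_lin _ _)) ?scaler0 //; lia.
    have [u2|u2] := boolP ((pwt k.2)%:Z < u).
      by rewrite (an_big hw) ?(lin0 (@an_lin _ _)) ?scaler0.
    by rewrite (an_big (hom_an (t := u) hw)) ?scaler0 //; lia.
  rewrite (fsum_pair f3) (fsum_exchange f3) -fsumZ // -fsumD; first last.
  - exact: (fin_pair1 (fin_swap f3)).
  - exact: (finZ (fun=> _)).
  apply: eq_zsum => q; rewrite (aP_hom p (hom_an (t := q) hw)) scalerDr scaleC.
  congr (_ + _); rewrite -fsumZ; last exact: fin_aPt (hom_an hw).
  by apply: eq_zsum => r; rewrite /aPt scalerA mulrC.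
rewrite !key; congr (_ *: _ + _ + _); first exact: mulrC.
  exact: addrC.
pose h (x : int * int) := (x.2, x.1).
rewrite -[RHS](@fsum_reindex _ _ _ h h); try by case.
  by apply: eq_fsum => -[q r] /=; rewrite an_an mulrC.
apply: (@fin_itv2 _ 1 (pwt k.2) 1 (pwt k.2)) => t u hh /=.
have [t1|t1] := boolP (t < 1); first by rewrite an_le0 ?scaler0 //; lia.
have [u1|u1] := boolP (u < 1).
  by rewrite (@an_le0 _ u) ?(lin0 (@an_lin _ _)) ?scaler0 //; lia.
have [u2|u2] := boolP ((pwt k.2)%:Z < u).
  by rewrite (an_big hw) ?(lin0 (@an_lin _ _)) ?scaler0.
by rewrite (an_big (hom_an (t := u) hw)) ?scaler0 //; lia.
Qed.

Lemma isfield_Pf s g X : isfield g X -> isfield g (Pf s X).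
Proof.
move=> hX; split=> [d|m e d w hw].
  apply: linadd; last by apply: lin_comp; [exact: hX.1 | exact: fglift_lin].
  move=> c u v; have fu := fin_Pm s d u hX; have fv := fin_Pm s d v hX.
  rewrite -fsumZ // -fsumD //; last exact: (finZ (fun=> c)).
  by apply: eq_zsum => t; rewrite (hX.1 _) (@cr_lin _ t) scalerDr scaleC.
apply: suppD.
  apply: supp_zsum => t; apply: suppZ.
  have := hom_cr (t := t) (hX.2 _ _ (d - t) _ hw); rewrite subrK; exact.
rewrite (aP_lin_hom _ (hX.1 d) hw); apply: suppD; first by apply: suppZ; exact: hX.2 hw.
by apply: supp_zsum => q; apply: suppZ; apply: hX.2; exact: (hom_an hw).
Qed.

(** Creation modes commute among themselves, and so do the operators [aP]. In the expansion of
    either side the former stand left of [X] and the latter right of it, so the expansion is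
    symmetric in [s] and [s']. *)
Lemma Pf_Pf s s' g X : isfield g X -> Pf s (Pf s' X) = Pf s' (Pf s X).
Proof.
move=> hX; have hP := isfield_Pf; apply: (@fld_eq g) => [||m e d w hw].
- exact/hP/hP.
- exact/hP/hP.
have key (p p' : nat) : Pf p (Pf p' X) d w =
    fsum (fun x : int * int => (gbin (x.1 - 1)%:~R p * gbin (x.2 - 1)%:~R p') *:
       cr x.1 (cr x.2 (X (d - x.1 - x.2) w))) +
    fsum (fun t => gbin (t - 1)%:~R p *: cr t (X (d - t) (aP p' w))) +
    (fsum (fun t => gbin (t - 1)%:~R p' *: cr t (X (d - t) (aP p w))) +
     X d (aP p' (aP p w))).
  rewrite {1}/Pf; congr (_ + _).
  have f1 : fin (fun x : int * int => (gbin (x.1 - 1)%:~R p * gbin (x.2 - 1)%:~R p') *: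
       cr x.1 (cr x.2 (X (d - x.1 - x.2) w))).
    apply: (@fin_itv2 _ 1 d 1 d) => t u h /=.
    have [t1|t1] := boolP (t < 1); first by rewrite cr_le0 ?scaler0 //; lia.
    have [u1|u1] := boolP (u < 1).
      by rewrite (@cr_le0 _ u) ?(lin0 (@cr_lin _ _)) ?scaler0 //; lia.
    by rewrite (fld_neg _ hX) ?(lin0 (@cr_lin _ _)) ?scaler0 //; lia.
  rewrite fsum_pair // -fsumD; first last.
  - exact: (fin_Pm _ _ _ hX).
  - exact: (fin_pair1 f1).
  apply: eq_zsum => t; rewrite /Pf (linD _ _ (@cr_lin _ t)) scalerDr; congr (_ + _).
  rewrite (lin_fsum (@cr_lin _ t) (fin_Pm _ _ _ hX)) -fsumZ; last first.
    by apply: fin_comp; [exact: lin0 (@cr_lin _ t) | exact: (fin_Pm _ _ _ hX)].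
  by apply: eq_zsum => u; rewrite /= (linZ _ _ (@cr_lin _ t)) scalerA.
rewrite !key aP_aP; rewrite -!addrA; congr (_ + _); last exact: addrCA.
have f1 (p p' : nat) : fin (fun x : int * int =>
     (gbin (x.1 - 1)%:~R p * gbin (x.2 - 1)%:~R p') *: cr x.1 (cr x.2 (X (d - x.1 - x.2) w))).
  apply: (@fin_itv2 _ 1 d 1 d) => t u h /=.
  have [t1|t1] := boolP (t < 1); first by rewrite cr_le0 ?scaler0 //; lia.
  have [u1|u1] := boolP (u < 1).
    by rewrite (@cr_le0 _ u) ?(lin0 (@cr_lin _ _)) ?scaler0 //; lia.
  by rewrite (fld_neg _ hX) ?(lin0 (@cr_lin _ _)) ?scaler0 //; lia.
pose h (x : int * int) := (x.2, x.1).
rewrite -[RHS](@fsum_reindex _ _ _ h h) //; try by case.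
by apply: eq_fsum => -[q r] /=; rewrite cr_cr mulrC addrAC.
Qed.

End Fields.

(** * Exponentials dressed around a field *)

Section Dressing.
Variable K : fieldType.
Hypothesis char0 : forall n : nat, n.+1%:R != 0 :> K.
Local Notation V := (Fock K).
Implicit Types (X Y : int -> V -> V) (w : V).

(* The power of [z] carried by the term [S_i T_j] of [e^(b varpi)(z)] on charge [m]. *)
Definition ex (b m : int) (x : int * int) : K := (x.1 - x.2)%:~R + (b * m)%:~R / 2%:R.

Definition Dg (b : int) X (d : int) w (x : int * int) : V :=
  sh b (Sz b x.1 (X (d - x.1) (Tz b x.2 w))).

Definition Du (b : int) X (d : int) w (x : int * (int * int)) : V :=
  cr x.1 (Dg b X (d - x.1) w x.2).

Definition Dw (b : int) X (d : int) w (x : int * (int * int)) : V :=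
  Dg b X d (an x.1 w) x.2.

Lemma Dg0 b g X d m e w (i j : int) : isfield g X -> homog m e w ->
  [|| i < 0, d < i, j < 0 | e < j] -> Dg b X d w (i, j) = 0.
Proof.
move=> hX hw h.
by rewrite /Dg /= (zero_Dt char0 b hX hw h) (lin0 (@sh_lin _ _)).
Qed.

Lemma fin_Dg b g X d m e w (c : int * int -> K) : isfield g X -> homog m e w ->
  fin (fun x => c x *: Dg b X d w x).
Proof.
move=> hX hw; apply: (@fin_itv2 _ 0 d 0 e) => i j h.
by rewrite (Dg0 _ hX hw h) scaler0.
Qed.

Lemma fin_Du b g X d m e w (c : int * (int * int) -> K) : isfield g X -> homog m e w ->
  fin (fun x => c x *: Du b X d w x).
Proof.
move=> hX hw; apply: (@fin_itv3 _ 1 d 0 d 0 e) => t i j h; rewrite /Du /=.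
have [t1|t1] := boolP (t < 1); first by rewrite cr_le0 ?scaler0 //; lia.
rewrite (Dg0 _ hX hw) ?(lin0 (@cr_lin _ t)) ?scaler0 //; lia.
Qed.

Lemma Dg_lin b g X d x : isfield g X -> lin (fun w => Dg b X d w x).
Proof.
move=> hX; apply: lin_comp; first exact: sh_lin.
apply: lin_comp; first exact: Sz_lin.
by apply: lin_comp; [exact: hX.1 | exact: Tz_lin].
Qed.

Lemma fin_Dw b g X d m e w (c : int * (int * int) -> K) : isfield g X -> homog m e w ->
  fin (fun x => c x *: Dw b X d w x).
Proof.
move=> hX hw; apply: (@fin_itv3 _ 1 e 0 d 0 e) => q i j h; rewrite /Dw /=.
have [q1|q1] := boolP (q < 1).
  by rewrite an_le0 ?(lin0 (Dg_lin _ _ _ hX)) ?scaler0 //; lia.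
rewrite (Dg0 _ hX (hom_an (t := q) hw)) ?scaler0 //; lia.
Qed.

Lemma Df_E b a g X d m e w : isfield g X -> homog m e w ->
  Df b a X d w = fsum (fun x => gbinz (ex b m x) a *: Dg b X d w x).
Proof. exact: Df_hom. Qed.

Lemma Pf_Df s b a g X d m e w : isfield g X -> homog m e w ->
  Pf s (Df b a X) d w =
    fsum (fun x => (gbin (x.1 - 1)%:~R s * gbinz (ex b m x.2) a) *: Du b X d w x) +
    ((gbin (-1) s * (m%:~R / 2%:R)) *:
        fsum (fun x => gbinz (ex b m x) a *: Dg b X d w x) +
     fsum (fun x => (gbin (- x.1 - 1)%:~R s * gbinz (ex b m x.2) a) *: Dw b X d w x)).
Proof.
move=> hX hw; rewrite /Pf; congr (_ + _).
  rewrite (fsum_pair (fin_Du _ _ _ hX hw)); apply: eq_zsum => t.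
  rewrite (Df_E _ _ _ hX hw) (lin_fsum (@cr_lin _ t) (fin_Dg _ _ _ hX hw)).
  rewrite -fsumZ; last first.
    apply: fin_comp (fin_Dg _ _ _ hX hw); exact: lin0 (@cr_lin _ t).
  by apply: eq_fsum => x; rewrite (linZ _ _ (@cr_lin _ t)) scalerA.
have lD : lin (Df b a X d) by exact: fglift_lin.
rewrite (aP_lin_hom s lD hw).
congr (_ + _); first by rewrite (Df_E _ _ _ hX hw).
rewrite (fsum_pair (fin_Dw _ _ _ hX hw)); apply: eq_zsum => q.
have hq := hom_an (t := q) hw.
rewrite (Df_E _ _ _ hX hq) -fsumZ; last exact: fin_Dg hX hq.
by apply: eq_fsum => x; rewrite scalerA.
Qed.

Lemma Df_Pf s b a g X d m e w : isfield g X -> homog m e w ->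
  Df b a (Pf s X) d w =
    fsum (fun x => (gbin (x.1 - 1)%:~R s * gbinz (ex b m x.2) a) *: Du b X d w x) +
    ((gbin (-1) s * (m%:~R / 2%:R)) *:
        fsum (fun x => gbinz (ex b m x) a *: Dg b X d w x) +
     fsum (fun x => (gbin (- x.1 - 1)%:~R s * gbinz (ex b m x.2) a) *: Dw b X d w x)).
Proof.
move=> hX hw; rewrite (Df_E _ _ _ (isfield_Pf s hX) hw).
have fU := fin_Du b d (fun x => gbin (x.1 - 1)%:~R s * gbinz (ex b m x.2) a) hX hw.
have fG := fin_Dg b d (fun x => gbinz (ex b m x) a) hX hw.
have fW := fin_Dw b d (fun x => gbin (- x.1 - 1)%:~R s * gbinz (ex b m x.2) a) hX hw.
pose F x := fsum (fun t => (gbin (t - 1)%:~R s * gbinz (ex b m x) a) *: Du b X d w (t, x)).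
pose G x := (gbin (-1) s * (m%:~R / 2%:R)) *: (gbinz (ex b m x) a *: Dg b X d w x).
pose H x := fsum (fun q => (gbin (- q - 1)%:~R s * gbinz (ex b m x) a) *: Dw b X d w (q, x)).
have fF : fin F by exact: fin_pair1 (fin_swap fU).
have fG' : fin G by exact: (finZ (fun=> _)).
have fH : fin H by exact: fin_pair1 (fin_swap fW).
rewrite (fsum_pair fU) (fsum_exchange fU) (fsum_pair fW) (fsum_exchange fW).
rewrite -(fsumZ _ fG) -/(fsum F) -/(fsum G) -/(fsum H).
rewrite -(fsumD fG' fH) -(fsumD fF); last exact: finD.
apply: eq_fsum => -[i j]; rewrite /Dg /Pf /=.
have hT := hom_Tz char0 (b := b) (i := j) hw.
have lS := @Sz_lin _ char0 b i; have lh := @sh_lin K b.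
rewrite (linD _ _ lS) (linD _ _ lh) scalerDr; congr (_ + _).
  have f1 := fin_Pm s (d - i) (Tz b j w) hX.
  rewrite (lin_fsum lS f1) (lin_fsum lh); last exact: fin_comp (lin0 lS) f1.
  rewrite -fsumZ; last first.
    by apply: fin_comp (lin0 lh) _; exact: fin_comp (lin0 lS) f1.
  apply: eq_zsum => t; rewrite (linZ _ _ lS) (linZ _ _ lh) scalerA mulrC.
  by rewrite /Du /Dg /= -cr_Sz // sh_cr (_ : d - i - t = d - t - i) //; lia.
have lX := hX.1 (d - i).
rewrite (aP_lin_hom s lX hT) (linD _ _ lS) (linD _ _ lh) scalerDr; congr (_ + _).
  by rewrite (linZ _ _ lS) (linZ _ _ lh) scaleC /G.
have f2 : fin (fun q => gbin (- q - 1)%:~R s *: X (d - i) (an q (Tz b j w))).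
  apply: (finZ (fun q => gbin (- q - 1)%:~R s)).
  apply: (@fin_itv _ 1 (e - j)) => q /orP[q1|qe].
    by rewrite an_le0 ?(lin0 lX) //; lia.
  by rewrite (an_big hT) ?(lin0 lX).
rewrite (lin_fsum lS f2) (lin_fsum lh); last exact: fin_comp (lin0 lS) f2.
rewrite -fsumZ; last first.
  by apply: fin_comp (lin0 lh) _; exact: fin_comp (lin0 lS) f2.
apply: eq_zsum => q; rewrite (linZ _ _ lS) (linZ _ _ lh) scalerA mulrC.
by rewrite /Dw /Dg /= an_Tz.
Qed.

(** [Pf] puts creation modes on the left and annihilation modes on the right, where they commute
    with the [S] and the [T] of [Df]. The zero mode reads the charge of the argument, which [T]
    preserves. Both composites thus have the same expansion. *)
Lemma Pf_Df_comm s b a g X : isfield g X -> Pf s (Df b a X) = Df b a (Pf s X).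
Proof.
move=> hX; apply: (@fld_eq _ (g + b)).
- by apply: isfield_Pf => //; exact: isfield_Df.
- by apply: isfield_Df => //; exact: isfield_Pf.
by move=> m e d w hw; rewrite (Pf_Df _ _ _ _ hX hw) (Df_Pf _ _ _ _ hX hw).
Qed.

Lemma vandermonde' (x : K) (z : int) a :
  \sum_(k < a.+1) gbin z%:~R k * gbin x (a - k) = gbin (x + z%:~R) a.
Proof.
rewrite -(vandermonde char0) (reindex_inj rev_ord_inj) /=.
by apply: eq_bigr => k _; rewrite subSS subKn -1?ltnS // mulrC.
Qed.

(* The ODE [x H'(x) = (sum_t p_t x^t) H(x)] for both the creation and the annihilation
   part of the exponential, combined with Vandermonde. *)
Lemma Df_rec b n g X d m e w : isfield g X -> homog m e w ->
  n.+1%:R *: Df b n.+1 X d w =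
  b%:~R *: \sum_(s < n.+1) Pf s (Df b (n - s)%N X) d w.
Proof.
move=> hX hw.
(* Vandermonde sums, over [s], the binomial of a mode times the binomial of the exponent: each of
   the three kinds of modes is left with a single binomial. *)
pose cU (x : int * (int * int)) := gbin (ex b m x.2 + (x.1 - 1)%:~R) n : K.
pose cG (x : int * int) := gbin (ex b m x - 1) n : K.
pose cW (x : int * (int * int)) := gbin (ex b m x.2 + (- x.1 - 1)%:~R) n : K.
have fU := fin_Du b d cU hX hw; have fG := fin_Dg b d cG hX hw.
have fW := fin_Dw b d cW hX hw.
transitivity (b%:~R *: (fsum (fun x => cU x *: Du b X d w x) +
   ((m%:~R / 2%:R) *: fsum (fun x => cG x *: Dg b X d w x) +
    fsum (fun x => cW x *: Dw b X d w x)))); last first.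
  congr (_ *: _).
  under eq_bigr => s _ do rewrite (Pf_Df s b (n - s)%N d hX hw).
  rewrite !big_split /=.
  congr (_ + (_ + _)).
  - rewrite -fsum_big; last by move=> s; exact: fin_Du hX hw.
    apply: eq_fsum => x; rewrite -scaler_suml; congr (_ *: _).
    by rewrite /cU -vandermonde'.
  - rewrite -fsumZ // (eq_bigr (fun s : 'I_n.+1 => fsum (fun x =>
       (gbin (-1) s * (m%:~R / 2%:R) * gbinz (ex b m x) (n - s)%N) *: Dg b X d w x))).
      rewrite -fsum_big; last by move=> s; exact: fin_Dg hX hw.
      apply: eq_fsum => x; rewrite -scaler_suml scalerA; congr (_ *: _).
      have -> : cG x = gbin (ex b m x + (-1)%:~R) n by rewrite /cG mulrNz mulr1z.
      rewrite -vandermonde' mulr_sumr.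
      by apply: eq_bigr => s _; rewrite mulrNz mulr1z [LHS]mulrCA [LHS]mulrA.
    move=> s _; rewrite -fsumZ; last exact: fin_Dg hX hw.
    by apply: eq_fsum => x; rewrite scalerA.
  - rewrite -fsum_big; last by move=> s; exact: fin_Dw hX hw.
    apply: eq_fsum => x; rewrite -scaler_suml; congr (_ *: _).
    by rewrite /cW -vandermonde'.
rewrite (Df_E _ _ _ hX hw) -fsumZ; last exact: fin_Dg hX hw.
(* Absorption [(n + 1) binom(y, n + 1) = y binom(y - 1, n)], with the exponent [y] split into the
   contributions of [S], of the charge and of [T]. *)
rewrite (eq_fsum (G := fun x => (x.1%:~R * cG x) *: Dg b X d w x +
   ((b%:~R * (m%:~R / 2%:R) * cG x) *: Dg b X d w x +
    (- x.2%:~R * cG x) *: Dg b X d w x))); last first.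
  move=> x; rewrite scalerA -!scalerDl; congr (_ *: _).
  rewrite [gbinz _ _]/(gbin (ex b m x) n.+1) gbinSl // /cG /ex rmorphB rmorphM /=; ring.
rewrite fsumD; [|exact: fin_Dg hX hw|by apply: finD; exact: fin_Dg hX hw].
rewrite fsumD; [|exact: fin_Dg hX hw|exact: fin_Dg hX hw].
rewrite !scalerDr; congr (_ + (_ + _)).
- pose h (x : int * (int * int)) : int * (int * int) := (x.1, (x.2.1 - x.1, x.2.2)).
  have hK : cancel h (fun x => (x.1, (x.2.1 + x.1, x.2.2))).
    by case=> t [i j]; rewrite /h /= subrK.
  have hK' : cancel (fun x => (x.1, (x.2.1 + x.1, x.2.2))) h.
    by case=> t [i j]; rewrite /h /= addrK.
  rewrite -(fsum_reindex hK hK' fU) (fsum_pair (fin_reindex hK fU)).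
  rewrite (fsum_exchange (fin_reindex hK fU)) -fsumZ; last first.
    exact: fin_pair1 (fin_swap (fin_reindex hK fU)).
  apply: eq_fsum => -[i j].
  have lh := @sh_lin K b.
  rewrite mulrC -scalerA /Dg /= -(linZ _ _ lh) Sz_rec // (linZ _ _ lh) scaleC.
  congr (_ *: _); rewrite (lin_fsum lh (fin_Sz _ _ _)) -fsumZ; last first.
    exact: fin_comp (lin0 lh) (fin_Sz _ _ _).
  apply: eq_zsum => t; rewrite /h /cU /Du /Dg /= sh_cr.
  rewrite (_ : d - t - (i - t) = d - i); last by lia.
  congr (_ *: _); rewrite /cG /ex /=; congr (gbin _ _).
  by rewrite !rmorphB /=; ring.
- rewrite -!fsumZ // ?scalerA; last exact: (finZ (fun=> _)).
  by apply: eq_fsum => x; rewrite !scalerA mulrA.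
- pose h (x : int * (int * int)) : int * (int * int) := (x.1, (x.2.1, x.2.2 - x.1)).
  have hK : cancel h (fun x => (x.1, (x.2.1, x.2.2 + x.1))).
    by case=> t [i j]; rewrite /h /= subrK.
  have hK' : cancel (fun x => (x.1, (x.2.1, x.2.2 + x.1))) h.
    by case=> t [i j]; rewrite /h /= addrK.
  rewrite -(fsum_reindex hK hK' fW) (fsum_pair (fin_reindex hK fW)).
  rewrite (fsum_exchange (fin_reindex hK fW)) -fsumZ; last first.
    exact: fin_pair1 (fin_swap (fin_reindex hK fW)).
  apply: eq_fsum => -[i j]; rewrite /Dg /=.
  pose f w' := sh b (Sz b i (X (d - i) w')).
  have lf : lin f.
    by apply: lin_comp; [exact: sh_lin | apply: lin_comp; [exact: Sz_lin | exact: hX.1]].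
  rewrite -/(f (Tz b j w)) mulrC -scalerA -(linZ _ _ lf) scaleNr Tz_rec // scaleNr opprK.
  rewrite (linZ _ _ lf) scaleC; congr (_ *: _).
  rewrite (lin_fsum lf (fin_Tz _ _ _)) -fsumZ; last first.
    exact: fin_comp (lin0 lf) (fin_Tz _ _ _).
  apply: eq_zsum => t; rewrite /h /cW /Dw /Dg /= an_Tz // /f.
  congr (_ *: _); rewrite /cG /ex /=; congr (gbin _ _).
  by rewrite !rmorphB !rmorphN /=; ring.
Qed.

End Dressing.

Lemma fin_itv4 (M : zmodType) (a b : int) (F : (int * int) * (int * int) -> M) :
  (forall i j k l : int, [|| i < a, b < i, j < a, b < j, k < a, b < k, l < a | b < l] ->
     F ((i, j), (k, l)) = 0) -> fin F.
Proof.
pose q := itv_seq a b.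
move=> h; exists [seq (x, y) | x <- [seq (i, j) | i <- q, j <- q],
   y <- [seq (j, k) | j <- q, k <- q]] => -[[i j] [k l]].
apply: contraNeq => nz; apply: allpairs_f; apply: allpairs_f;
  apply: mem_itv_seq; rewrite leNgt;
  by apply: contraNN nz => lt; rewrite h ?lt ?orbT.
Qed.

(** * Vertex operators of h-monomials *)

Section VertexOperators.
Variable K : fieldType.
Hypothesis char0 : forall n : nat, n.+1%:R != 0 :> K.
Local Notation V := (Fock K).
Implicit Types (X Y : int -> V -> V) (w : V).

(** For [a = 0] all binomials are [1], and normal ordering merges the exponentials: the series [S]
    and [T] of [b + b'] are the convolutions of those of [b] and [b']. *)
Lemma Df_conv b b' g X : isfield g X -> Df b 0 (Df b' 0 X) = Df (b + b') 0 X.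
Proof.
move=> hX; have hD := isfield_Df char0 b' 0 hX.
apply: (@fld_eq _ (g + b' + b)).
- exact: isfield_Df.
- by rewrite -addrA (addrC b'); exact: isfield_Df.
move=> m e d w hw.
pose F (x : (int * int) * (int * int)) : V :=
  sh (b + b') (Sz b x.1.1 (Sz b' x.2.1
     (X (d - x.1.1 - x.2.1) (Tz b' x.2.2 (Tz b x.1.2 w))))).
have lS b1 i := @Sz_lin K char0 b1 i; have lT b1 i := @Tz_lin K char0 b1 i.
have lh b1 := @sh_lin K b1; have lX := hX.1.
have fF : fin F.
  apply: (@fin_itv4 _ 0 (`|d| + `|e|)) => i j k l h; rewrite /F /=.
  have [i0|i0] := boolP (i < 0); first by rewrite Sz_neg // (lin0 (lh _)).
  have [k0|k0] := boolP (k < 0).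
    by rewrite (Sz_neg _ _ k0) // (lin0 (lS _ _)) (lin0 (lh _)).
  have [j0|j0] := boolP (j < 0).
    by rewrite (Tz_neg _ _ j0) (lin0 (lT _ _)) (lin0 (lX _)) !(lin0 (lS _ _)) (lin0 (lh _)).
  have [l0|l0] := boolP (l < 0).
    by rewrite (Tz_neg _ _ l0) (lin0 (lX _)) !(lin0 (lS _ _)) (lin0 (lh _)).
  have [dik|dik] := boolP (d - i - k < 0).
    by rewrite (fld_neg _ hX) // !(lin0 (lS _ _)) (lin0 (lh _)).
  have [ej|ej] := boolP (e < j).
    rewrite (Tz_big char0 _ hw ej) (lin0 (lT _ _)) (lin0 (lX _)) !(lin0 (lS _ _)).
    exact: lin0 (lh _).
  have [el|el] := boolP (e - j < l).
    rewrite (Tz_big char0 _ (hom_Tz char0 (b := b) (i := j) hw) el) (lin0 (lX _)).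
    by rewrite !(lin0 (lS _ _)) (lin0 (lh _)).
  lia.
have sc (b1 m1 : int) (x : int * int) : gbinz (ex K b1 m1 x) 0 = 1 by rewrite gbinz0.
transitivity (fsum F).
  rewrite (Df_E char0 _ _ _ hD hw) (fsum_pair fF); apply: eq_zsum2 => i j.
  rewrite sc scale1r /Dg /=.
  have hT := hom_Tz char0 (b := b) (i := j) hw.
  have f1 := fin_Dg char0 b' (d - i) (fun x => gbinz (ex K b' m x) 0) hX hT.
  rewrite (Df_E char0 _ _ _ hX hT) (lin_fsum (lS _ _) f1) (lin_fsum (lh _)); last first.
    exact: fin_comp (lin0 (lS _ _)) f1.
  apply: eq_zsum2 => k l; rewrite sc scale1r /Dg /F /=.
  by rewrite -sh_Sz // sh_sh.
rewrite (Df_E char0 _ _ _ hX hw).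
pose h (x : (int * int) * (int * int)) : (int * int) * (int * int) :=
  (x.2, (x.1.1 - x.2.1, x.1.2 - x.2.2)).
pose h' (x : (int * int) * (int * int)) : (int * int) * (int * int) :=
  ((x.1.1 + x.2.1, x.1.2 + x.2.2), x.1).
have hK : cancel h h'.
  by case=> [[i j] [k l]]; rewrite /h /h' /= !(addrC k) !(addrC l) !subrK.
have hK' : cancel h' h.
  by case=> [[i j] [k l]]; rewrite /h /h' /= ![_ + k]addrC ![_ + l]addrC !addrK.
rewrite -(fsum_reindex hK hK' fF) (fsum_pair (fin_reindex hK fF)).
apply: eq_zsum2 => i j; rewrite sc scale1r.
have f2 := fin_pairl (fin_reindex hK fF) (i, j).
rewrite (fsum_pair f2) /F /h /Dg /=.
have fT : fin (fun l => Tz b' (j - l) (Tz b l w)).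
  apply: (@fin_itv _ 0 j) => l /orP[l0|lj]; first by rewrite (Tz_neg _ _ l0) (lin0 (lT _ _)).
  by rewrite Tz_neg //; lia.
have eT : Tz (b + b') j w = fsum (fun l => Tz b' (j - l) (Tz b l w)).
  by rewrite Tz_conv //; apply: eq_zsum => l; rewrite Tz_Tz.
have fS (u : V) : fin (fun k => Sz b k (Sz b' (i - k) u)).
  apply: (@fin_itv _ 0 i) => k /orP[k0|ki]; first by rewrite Sz_neg.
  have -> : Sz b' (i - k) u = 0 by apply: Sz_neg; lia.
  exact: (lin0 (lS b k)).
rewrite Sz_conv // (lin_fsum (lh _) (fS _)); apply: eq_zsum => k.
rewrite eT (lin_fsum (lX _) fT).
pose f (u : V) := sh (b + b') (Sz b k (Sz b' (i - k) u)).
have lf : lin f.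
  by apply: lin_comp; [exact: lh | apply: lin_comp; exact: lS].
rewrite -[RHS]/(f _) (lin_fsum lf); last exact: fin_comp (lin0 (lX _)) fT.
by apply: eq_zsum => l; rewrite /f (_ : d - k - (i - k) = d - i) //; lia.
Qed.

Definition fcomb (c : K) X Y (d : int) w := c *: X d w + Y d w.

Lemma isfield_comb c g X Y : isfield g X -> isfield g Y -> isfield g (fcomb c X Y).
Proof.
move=> hX hY; split=> [d|m e d w hw].
  by apply: linadd; [apply: linscale; exact: hX.1 | exact: hY.1].
by apply: suppA; [exact: hX.2 hw | exact: hY.2 hw].
Qed.

Lemma isfield0 g : isfield g (fun _ _ => 0 : V).
Proof.
by split=> [d|m e d w hw]; [move=> c u v; rewrite scaler0 addr0 | exact: supp0].
Qed.

Lemma Df_comb c b a g X Y : isfield g X -> isfield g Y ->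
  Df b a (fcomb c X Y) = fcomb c (Df b a X) (Df b a Y).
Proof.
move=> hX hY; have hC := isfield_comb c hX hY; apply: (@fld_eq _ (g + b)).
- exact: isfield_Df.
- by apply: isfield_comb; exact: isfield_Df.
move=> m e d w hw; rewrite /fcomb.
rewrite (Df_E char0 _ _ _ hC hw) (Df_E char0 _ _ _ hX hw) (Df_E char0 _ _ _ hY hw).
have f1 := fin_Dg char0 b d (fun x => gbinz (ex K b m x) a) hX hw.
have f2 := fin_Dg char0 b d (fun x => gbinz (ex K b m x) a) hY hw.
rewrite -(fsumZ _ f1) -fsumD //; last exact: (finZ (fun=> c)).
apply: eq_fsum => x; rewrite scaleC -scalerDr; congr (_ *: _).
by rewrite /Dg /fcomb (@Sz_lin K) // (@sh_lin K).
Qed.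

Lemma Pf_comb c s g X Y : isfield g X -> isfield g Y ->
  Pf s (fcomb c X Y) = fcomb c (Pf s X) (Pf s Y).
Proof.
move=> hX hY; have hC := isfield_comb c hX hY; apply: (@fld_eq _ g).
- exact: isfield_Pf.
- by apply: isfield_comb; exact: isfield_Pf.
move=> m e d w hw; rewrite /Pf /fcomb scalerDr addrACA; congr (_ + _).
have f1 := fin_Pm s d w hX; have f2 := fin_Pm s d w hY.
rewrite -(fsumZ _ f1) -fsumD //; last exact: (finZ (fun=> c)).
by apply: eq_zsum => t; rewrite scaleC -scalerDr (@cr_lin K).
Qed.

(** The recursion of [Ykey] with untruncated sums, indexed by output degree instead of mode. [wproj]
    is the identity field, sorted by output degree. *)
Definition Ypart (g : int) (ns : seq nat) : int -> V -> V :=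
  foldr (fun n X => Pf n.-1 X) (Df g 0 (@wproj K)) ns.

Definition Yf (v : V) (d : int) w : V := lft (fun k => Ypart k.1 (sval k.2) d w) v.

Lemma isfield_Ypart g ns : isfield g (Ypart g ns).
Proof.
elim: ns => [|n ns IH] /=; last exact: isfield_Pf.
by rewrite -[g in isfield g]add0r; apply: isfield_Df => //; exact: isfield_wproj.
Qed.

Lemma Ypart_perm g ns ns' : perm_eq ns ns' -> Ypart g ns = Ypart g ns'.
Proof.
have mid n s1 s2 : Ypart g (s1 ++ n :: s2) = Ypart g (n :: s1 ++ s2).
  elim: s1 => //= p s1 ->; exact: Pf_Pf (isfield_Ypart g _).
elim: ns ns' => [|n ns IH] ns' h.
  by move: h; rewrite perm_sym => /perm_nilP ->.
have nin : n \in ns' by rewrite -(perm_mem h) mem_head.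
case/splitPr: nin h => s1 s2 h; rewrite mid /= (IH (s1 ++ s2)) //.
by rewrite -(perm_cons n); apply: (perm_trans h); rewrite -cat1s perm_catCA.
Qed.

Lemma Yf_b k : Yf (bv K k) = Ypart k.1 (sval k.2).
Proof. by apply: funext => d; apply: funext => w; rewrite /Yf fgliftb. Qed.

Lemma Yf_comb c u v : Yf (c *: u + v) = fcomb c (Yf u) (Yf v).
Proof. by apply: funext => d; apply: funext => w; rewrite /Yf fglift_lin. Qed.

Lemma Yf0 : Yf 0 = fun _ _ => 0.
Proof.
by apply: funext => d; apply: funext => w; exact: lin0 (@fglift_lin _ _ _).
Qed.

Lemma Yf_lin d w : lin (fun v => Yf v d w).
Proof. exact: fglift_lin. Qed.

Lemma isfield_Yf g a v : homog g a v -> isfield g (Yf v).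
Proof.
move: v; apply: (@homog_ind _ g a (fun v => isfield g (Yf v))) => [|c k w kg ka hw IH].
  by rewrite Yf0; exact: isfield0.
rewrite Yf_comb; apply: isfield_comb => //.
by rewrite Yf_b -kg; exact: isfield_Ypart.
Qed.

Lemma Yf_cr n g a v : homog g a v -> Yf (cr n.+1 v) = Pf n (Yf v).
Proof.
move: v; apply: (@homog_ind _ g a (fun v => Yf (cr n.+1 v) = Pf n (Yf v))) => [|c k w kg ka hw IH].
  rewrite (lin0 (@cr_lin _ _)) Yf0; apply: funext => d; apply: funext => w.
  rewrite /Pf addr0 zsum_eq0 // => t.
  by rewrite (lin0 (@cr_lin _ _)) scaler0.
rewrite (@cr_lin K n.+1) !Yf_comb IH.
have hb : homog g a (bv K k) by rewrite -kg -ka; exact: homb.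
rewrite (Pf_comb c n (isfield_Yf hb) (isfield_Yf hw)).
congr fcomb; case: k kg ka hb => i l _ _ _.
rewrite (@crb K n) !Yf_b /=.
by rewrite (Ypart_perm _ (perm_pins l (ltn0Sn n))).
Qed.

Lemma Yf_sh b g a v : homog g a v -> Yf (sh b v) = Df b 0 (Yf v).
Proof.
move: v; apply: (@homog_ind _ g a (fun v => Yf (sh b v) = Df b 0 (Yf v))) => [|c k w kg ka hw IH].
  rewrite (lin0 (@sh_lin _ _)) Yf0; apply: (@fld_eq _ (0 + b)).
  - exact: isfield0.
  - by apply: isfield_Df => //; exact: isfield0.
  move=> m e d w hw; rewrite (Df_E char0 _ _ _ (isfield0 0) hw) fsum_eq0 // => x.
  by rewrite /Dg (lin0 (@Sz_lin _ char0 _ _)) (lin0 (@sh_lin _ _)) scaler0.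
rewrite (@sh_lin K b) !Yf_comb IH.
have hb : homog g a (bv K k) by rewrite -kg -ka; exact: homb.
rewrite (Df_comb c b 0 (isfield_Yf hb) (isfield_Yf hw)).
congr fcomb; case: k kg ka hb => i l _ _ _.
rewrite (@shb K) !Yf_b /=; elim: (sval l) => [|n ns IHn] /=.
  by rewrite (Df_conv _ _ (isfield_wproj K)) addrC.
by rewrite IHn (Pf_Df_comm _ _ _ _ (isfield_Ypart i ns)).
Qed.

Lemma Sz_recn b n w :
  n.+1%:R *: Sz b n.+1 w = b%:~R *: \sum_(s < n.+1) cr s.+1 (Sz b (n - s)%N w).
Proof.
have := Sz_rec char0 b n.+1 w; rewrite -pmulrn => ->; congr (_ *: _).
rewrite -(fsum_shift 1 (fin_Sz _ _ _)) (@fsum_ord _ n.+1).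
  apply: eq_bigr => s _; have sn := ltn_ord s; rewrite (_ : s%:Z + 1 = s.+1); last by lia.
  by rewrite (_ : n.+1%:Z - s.+1%:Z = (n - s)%N) //; lia.
move=> t /orP[t0|tn]; first by rewrite cr_le0 //; lia.
by rewrite Sz_neg ?(lin0 (@cr_lin _ _)) //; lia.
Qed.

(** Both sides satisfy the same recursion in [i]: [Sz_recn] on the left, [Df_rec] on the right, with
    [cr s.+1] turned into [Pf s] by [Yf_cr]. *)
Lemma Yf_S b i g a v : homog g a v -> Yf (Sz b i (sh b v)) = Df b i (Yf v).
Proof.
move=> hv; elim/zind: i => [i i0|i i0 IH].
  rewrite Sz_neg // Yf0; apply: funext => d; apply: funext => w.
  by rewrite Df_neg.
have hF := isfield_Yf hv; have hs := hom_sh (b := b) hv.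
case: i i0 IH => [[|n]|//] _ IH; first by rewrite Sz0 (Yf_sh b hv).
have hS := hom_Sz char0 (b := b) (i := n.+1) hs.
apply: (@fld_eq _ (g + b)); [exact: isfield_Yf hS | exact: isfield_Df |].
move=> m e d w hw; apply: (scalerI (char0 n)).
rewrite (Df_rec char0 b n d hF hw).
rewrite -(linZ _ _ (Yf_lin d w)) Sz_recn (linZ _ _ (Yf_lin d w)); congr (_ *: _).
rewrite (lin_sum _ _ _ (Yf_lin d w)); apply: eq_bigr => s _.
have hs' := hom_Sz char0 (b := b) (i := (n - s)%N) hs.
by rewrite (Yf_cr _ hs') IH // ltz_nat ltnS leq_subr.
Qed.

Definition vacv : V := bv K (0, part0).
(* [h_(c_1) ... h_(c_r) e^(r varpi)], where [sum_i h_i z^i = exp (sum_(t > 0) varpi(-t) z^t / t)]. *)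
Definition Hv (c : seq nat) : V := foldr (fun (a : nat) x => Sz 1 a%:Z (sh 1 x)) vacv c.
Definition YH (c : seq nat) : int -> V -> V := foldr (fun (a : nat) X => Df 1 a%:Z X) (@wproj K) c.

Lemma HvS a c : Hv (a :: c) = Sz 1 a%:Z (sh 1 (Hv c)). Proof. by []. Qed.

Lemma hom_Hv c : homog (size c) (sumn c) (Hv c).
Proof.
elim: c => [|a c IH]; first exact: homb.
have := hom_Sz char0 (b := 1) (i := a) (hom_sh (b := 1) IH).
by rewrite /= -!PoszD addn1 addnC.
Qed.

Arguments hom_Hv : clear implicits.

Lemma Yf_vac : Yf vacv = @wproj K.
Proof.
rewrite /vacv Yf_b /=; apply: (@fld_eq _ 0).
- by rewrite -[0]addr0; apply: isfield_Df => //; exact: isfield_wproj.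
- exact: isfield_wproj.
move=> m e d w hw; rewrite (Df_E char0 _ _ _ (isfield_wproj K) hw).
rewrite (@fsum_eq1 _ _ (0, 0)) => [|[i j] ij].
  by rewrite gbinz0 scale1r /Dg /= subr0 sh0.
rewrite /Dg /= sh0; have lS := @Sz_lin _ char0 0 i.
have [i0|i0] := eqVneq i 0; last first.
  rewrite (_ : Sz 0 i _ = 0) ?scaler0 //.
  by apply: expz_beta0 => //; [exact: cr_lin | exact: cr_le0].
have j0 : j != 0 by apply: contraNN ij => /eqP ->; rewrite i0.
have -> : Tz 0 j w = 0.
  rewrite /Tz mulr0z oppr0.
  by apply: expz_beta0 => //; [exact: an_lin | exact: an_le0].
by rewrite (lin0 ((isfield_wproj K).1 _)) (lin0 lS) scaler0.
Qed.

Lemma Yf_Hv c : Yf (Hv c) = YH c.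
Proof.
elim: c => [|a c IH]; first exact: Yf_vac.
by rewrite HvS (Yf_S _ _ (hom_Hv c)) IH.
Qed.

Lemma isfield_YH c : isfield (size c) (YH c).
Proof. by rewrite -Yf_Hv; exact: isfield_Yf (hom_Hv c). Qed.

End VertexOperators.

(** * Commutation with [e^alpha] *)

Section Locality.
Variable K : fieldType.
Hypothesis char0 : forall n : nat, n.+1%:R != 0 :> K.
Local Notation V := (Fock K).
Implicit Types (X Y : int -> V -> V) (w : V).

Let lS b i := @Sz_lin K char0 b i.
Let lT b i := @Tz_lin K char0 b i.
Let lh b := @sh_lin K b.

Definition Et (r : int) w (j : int) : V := sh 2 (Sz 2 (r + j) (Tz 2 j w)).
(* [Er r] raises the weight by [r]: on charge [m] it is [e^alpha(- r - 1 - m)], see [vmode_evec]. *)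
Definition Er (r : int) : V -> V := lft (fun k => fsum (Et r (bv K k))).

Lemma Er_lin r : lin (Er r). Proof. exact: fglift_lin. Qed.

Lemma fin_Et r m e w : homog m e w -> fin (Et r w).
Proof.
move=> hw; apply: (@fin_itv _ 0 e) => j /orP[j0|ej]; rewrite /Et.
  by rewrite Tz_neg // (lin0 (lS _ _)) (lin0 (lh _)).
by rewrite (Tz_big char0 _ hw ej) (lin0 (lS _ _)) (lin0 (lh _)).
Qed.

Lemma Et_lin r j : lin (fun w => Et r w j).
Proof.
by apply: lin_comp; [exact: lh | apply: lin_comp; [exact: lS | exact: lT]].
Qed.

Lemma Er_hom r m e w : homog m e w -> Er r w = fsum (Et r w).
Proof.
apply: (@fglift_hom _ _ _ _ _ (fun w => fsum (Et r w))) => //.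
apply: (@fsum_homlin _ _ m e (Et r)) => [j|w']; first exact: Et_lin.
exact: fin_Et.
Qed.

Lemma hom_Er r m e w : homog m e w -> homog (m + 2) (e + r) (Er r w).
Proof.
move=> hw; rewrite (Er_hom r hw); apply: supp_zsum => j.
have := hom_sh (b := 2) (hom_Sz char0 (b := 2) (i := r + j) (hom_Tz char0 (b := 2) (i := j) hw)).
by rewrite (_ : e - j + (r + j) = e + r) //; lia.
Qed.

Lemma Er_small r m e w : homog m e w -> e + r < 0 -> Er r w = 0.
Proof. by move=> hw; apply: hom_neg; exact: (hom_Er (r := r) hw). Qed.

Lemma sh_Er b r w : sh b (Er r w) = Er r (sh b w).
Proof.
move: w; apply: lin_ext; try by apply: lin_comp; [exact: lh | exact: Er_lin].
  by apply: lin_comp; [exact: Er_lin | exact: lh].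
move=> k; have hk := @homb K k.
have {hk} hk : homog k.1 (pwt k.2) (bv K k) by exact: homb.
rewrite (Er_hom r hk) (Er_hom r (hom_sh (b := b) hk)) (lin_fsum (lh b) (fin_Et r hk)).
by apply: eq_zsum => j; rewrite /Et !sh_sh addrC -sh_sh sh_Sz // sh_Tz.
Qed.

(** The contraction [1 - x] of [Tz_Sz], here between the annihilation part of [e^alpha(z)] and
    [Sz 1]; [Tz_Er] is its mirror image, with the creation part of [e^alpha(z)] and [Tz 1]. *)
Lemma Er_Sz r i m e w : homog m e w ->
  Er r (Sz 1 i w) = Sz 1 i (Er r w) - Sz 1 (i - 1) (Er (r + 1) w).
Proof.
move=> hw; have hS := hom_Sz char0 (b := 1) (i := i) hw.
rewrite (Er_hom r hS) (Er_hom r hw) (Er_hom (r + 1) hw).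
have f1 := fin_Et r hw; have f2 := fin_Et (r + 1) hw.
rewrite -(fsum_shift (-1) f2) (lin_fsum (lS _ _) f1) (lin_fsum (lS 1 (i - 1))); last first.
  by apply: (@fin_reindex _ _ _ (fun j => j - 1) (fun j => j + 1)) => // j; rewrite subrK.
rewrite -fsumB; first last.
- apply: fin_comp; first exact: lin0 (lS _ _).
  by apply: (@fin_reindex _ _ _ (fun j => j - 1) (fun j => j + 1)) => // j; rewrite subrK.
- exact: fin_comp (lin0 (lS _ _)) f1.
apply: eq_zsum => j; rewrite /Et Tz_Sz // (linB _ _ (lS _ _)) (linB _ _ (lh _)).
rewrite (Sz_Sz char0 2 _ 1) (Sz_Sz char0 2 _ 1) !sh_Sz // !sh_Tz //.
by rewrite (_ : r + 1 + (j - 1) = r + j) //; lia.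
Qed.

Lemma Tz_Er j r m e w : homog m e w ->
  Tz 1 j (Er r w) = Er r (Tz 1 j w) - Er (r - 1) (Tz 1 (j - 1) w).
Proof.
move=> hw; have hT := hom_Tz char0 (b := 1) (i := j) hw.
have hT' := hom_Tz char0 (b := 1) (i := j - 1) hw.
rewrite (Er_hom r hw) (Er_hom r hT) (Er_hom (r - 1) hT').
have f1 := fin_Et r hw; have f2 := fin_Et r hT; have f3 := fin_Et (r - 1) hT'.
rewrite (lin_fsum (lT _ _) f1) -(fsumB f2 f3); apply: eq_zsum => k.
rewrite /Et -sh_Tz // Tz_Sz // (linB _ _ (lh _)).
by rewrite !(Tz_Tz char0 2 k) (_ : r + k - 1 = r - 1 + k) //; lia.
Qed.

Lemma exS b m (i j : int) : ex K b m (i + 1, j) = ex K b m (i, j) + 1.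
Proof. by rewrite /ex /= addrAC rmorphD /= addrAC. Qed.

Lemma ex_down b m (i j : int) : ex K b m (i, j - 1) = ex K b m (i + 1, j).
Proof. by rewrite /ex /= opprB addrA. Qed.

Lemma ex_shift m (i j : int) : ex K 1 (m + 2) (i, j) = ex K 1 m (i + 1, j).
Proof.
rewrite exS /ex /= !mul1r [(m + 2)%:~R]rmorphD /= mulrDl addrA; congr (_ + _).
by rewrite divff ?(char0 1).
Qed.

(** The shift by [g] makes both sides use one and the same mode of [e^alpha]: [Er r] on charge
    [m + g] and [Er (r + g)] on charge [m] both have mode index [- r - g - 1 - m]. *)
Definition Ecomm (g : int) X (eps : K) := forall m e d r w, homog m e w ->
  Er r (X d w) = eps *: X (d + r) (Er (r + g) w).

Lemma Ecomm_wproj : Ecomm 0 (@wproj K) 1.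
Proof.
move=> m e d r w hw; rewrite scale1r addr0 (wproj_hom d hw).
rewrite (wproj_hom _ (hom_Er (r := r) hw)) (inj_eq (addIr r)).
by case: eqP => // _; exact: lin0 (@Er_lin _).
Qed.

Lemma Ecomm_Df g X eps a : isfield g X -> Ecomm g X eps ->
  Ecomm (g + 1) (Df 1 a X) (- eps).
Proof.
move=> hX hE m e d r w hw; have lX := hX.1.
have hEw := hom_Er (r := r + (g + 1)) hw.
rewrite (Df_E char0 _ _ _ hX hw) (Df_E char0 _ _ _ hX hEw).
pose A (x : int * int) := gbinz (ex K 1 m x) a *:
  sh 1 (Sz 1 x.1 (X (d + r - x.1) (Er (r + g) (Tz 1 x.2 w)))).
pose B (x : int * int) := gbinz (ex K 1 m x) a *:
  sh 1 (Sz 1 (x.1 - 1) (X (d + r - (x.1 - 1)) (Er (r + g + 1) (Tz 1 x.2 w)))).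
have fA : fin A.
  apply: (@fin_itv2 _ 0 (d + r) 0 e) => i j h; rewrite /A /=.
  have [i0|i0] := boolP (i < 0); first by rewrite Sz_neg // (lin0 (lh _)) scaler0.
  have [j0|j0] := boolP (j < 0).
    rewrite Tz_neg // (lin0 (@Er_lin _)) (lin0 (lX _)) (lin0 (lS _ _)) (lin0 (lh _)).
    exact: scaler0.
  have [ej|ej] := boolP (e < j).
    rewrite (Tz_big char0 _ hw) // (lin0 (@Er_lin _)) (lin0 (lX _)) (lin0 (lS _ _)).
    by rewrite (lin0 (lh _)) scaler0.
  have -> : X (d + r - i) (Er (r + g) (Tz 1 j w)) = 0 by apply: fld_neg hX _; lia.
  by rewrite (lin0 (lS _ _)) (lin0 (lh _)) scaler0.
have fB : fin B.
  apply: (@fin_itv2 _ 1 (d + r + 1) 0 e) => i j h; rewrite /B /=.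
  have [i0|i0] := boolP (i < 1).
    by rewrite Sz_neg ?(lin0 (lh _)) ?scaler0 //; lia.
  have [j0|j0] := boolP (j < 0).
    rewrite Tz_neg // (lin0 (@Er_lin _)) (lin0 (lX _)) (lin0 (lS _ _)) (lin0 (lh _)).
    exact: scaler0.
  have [ej|ej] := boolP (e < j).
    rewrite (Tz_big char0 _ hw) // (lin0 (@Er_lin _)) (lin0 (lX _)) (lin0 (lS _ _)).
    by rewrite (lin0 (lh _)) scaler0.
  have -> : X (d + r - (i - 1)) (Er (r + g + 1) (Tz 1 j w)) = 0.
    by apply: fld_neg hX _; lia.
  by rewrite (lin0 (lS _ _)) (lin0 (lh _)) scaler0.
transitivity (eps *: (fsum A - fsum B)).
  rewrite -(fsumB fA fB) -fsumZ; last first.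
    by apply: finD => //; apply: (@fin_comp _ _ _ -%R); rewrite ?oppr0.
  rewrite (lin_fsum (@Er_lin _)); last exact: fin_Dg hX hw.
  apply: eq_zsum2 => i j; rewrite (linZ _ _ (@Er_lin _)) /Dg /= -sh_Er.
  have hT := hom_Tz char0 (b := 1) (i := j) hw.
  rewrite (Er_Sz _ _ (hX.2 _ _ (d - i) _ hT)) !(hE _ _ _ _ _ hT).
  rewrite !(linZ _ _ (lS _ _)) -scalerBr (linZ _ _ (lh _)) scaleC; congr (_ *: _).
  rewrite /A /B /= (linB _ _ (lh _)) scalerBr.
  rewrite (_ : d - i + r = d + r - i); last by lia.
  rewrite (_ : d - i + (r + 1) = d + r - (i - 1)); last by lia.
  by rewrite (_ : r + 1 + g = r + g + 1) //; lia.
rewrite scaleNr -scalerN -[fsum A - _]opprB; congr (_ *: - _).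
(* On the left the correction term came from the contraction with [S], on the right it comes from
   [T]. Raising the charge by [2] changes the exponent exactly as raising [i] or lowering [j] by
   one, so after these shifts [A] and [B] exchange roles: hence the new sign. *)
pose hA (x : int * int) := (x.1, x.2 - 1); pose hB (x : int * int) := (x.1 + 1, x.2).
have hAK : cancel hA (fun x => (x.1, x.2 + 1)) by case=> i j; rewrite /hA /= subrK.
have hAK' : cancel (fun x => (x.1, x.2 + 1)) hA by case=> i j; rewrite /hA /= addrK.
have hBK : cancel hB (fun x => (x.1 - 1, x.2)) by case=> i j; rewrite /hB /= addrK.
have hBK' : cancel (fun x => (x.1 - 1, x.2)) hB by case=> i j; rewrite /hB /= subrK.
rewrite -(fsum_reindex hAK hAK' fA) -(fsum_reindex hBK hBK' fB).
rewrite -(fsumB (fin_reindex hBK fB) (fin_reindex hAK fA)).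
apply: eq_zsum2 => i j; rewrite /hA /hB /A /B /Dg /= addrK.
rewrite (_ : r + (g + 1) = r + g + 1); last by rewrite addrA.
rewrite (Tz_Er _ _ hw) (_ : r + g + 1 - 1 = r + g); last by rewrite addrK.
rewrite (linB _ _ (lX _)) (linB _ _ (lS _ _)) (linB _ _ (lh _)) scalerBr.
by rewrite ex_shift ex_down.
Qed.

End Locality.

(** * Linear spans *)

Section Span.
Variables (K : fieldType) (M : lmodType K).
Implicit Types (P : M -> Prop) (u v : M).

Inductive spn P : M -> Prop :=
| spn0 : spn P 0
| spnA c u v : P u -> spn P v -> spn P (c *: u + v).

Definition subsp (Z : M -> Prop) := Z 0 /\ forall c u v, Z u -> Z v -> Z (c *: u + v).

Lemma subspZ Z c u : subsp Z -> Z u -> Z (c *: u).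
Proof. by move=> [Z0 ZA] zu; rewrite -[_ *: _]addr0; exact: ZA. Qed.

Lemma subspD Z u v : subsp Z -> Z u -> Z v -> Z (u + v).
Proof. by move=> [Z0 ZA] zu; rewrite -[u]scale1r; exact: ZA. Qed.

Lemma subspN Z u : subsp Z -> Z u -> Z (- u).
Proof. by rewrite -scaleN1r; exact: subspZ. Qed.

Lemma subspB Z u v : subsp Z -> Z u -> Z v -> Z (u - v).
Proof. by move=> hZ zu zv; apply: subspD => //; exact: subspN. Qed.

Lemma subsp_fsum (I : choiceType) Z (F : I -> M) : subsp Z -> (forall i, Z (F i)) -> Z (fsum F).
Proof. by move=> hZ hF; apply: (@fsum_closed _ _ Z) => //; [exact: hZ.1 | move=> x y; exact: subspD]. Qed.

Lemma subsp_sum (I : Type) (r : seq I) Z (F : I -> M) :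
  subsp Z -> (forall i, Z (F i)) -> Z (\sum_(i <- r) F i).
Proof. by move=> hZ hF; apply: (big_ind Z) => //; [exact: hZ.1 | move=> x y; exact: subspD]. Qed.

Lemma spn_min P Z : subsp Z -> (forall u, P u -> Z u) -> forall u, spn P u -> Z u.
Proof. by move=> [Z0 ZA] h u; elim=> // c x y px _; apply: ZA; exact: h. Qed.

Lemma spn_id P u : P u -> spn P u.
Proof. by move=> pu; rewrite -[u]addr0 -[u]scale1r; apply: spnA => //; exact: spn0. Qed.

Lemma spnD P u v : spn P u -> spn P v -> spn P (u + v).
Proof.
move=> hu hv; elim: hu => [|c x y px _ IH]; first by rewrite add0r.
by rewrite -addrA; exact: spnA.
Qed.

Lemma spnZ P c u : spn P u -> spn P (c *: u).
Proof.
elim=> [|a x y px _ IH]; first by rewrite scaler0; exact: spn0.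
by rewrite scalerDr scalerA; exact: spnA.
Qed.

Lemma subsp_spn P : subsp (spn P).
Proof. by split=> [|c u v hu hv]; [exact: spn0 | apply: spnD => //; exact: spnZ]. Qed.

End Span.

Lemma spn_lin (K : fieldType) (M N : lmodType K) (f : M -> N) (P : M -> Prop) (Q : N -> Prop) :
  lin f -> (forall u, P u -> spn Q (f u)) -> forall u, spn P u -> spn Q (f u).
Proof.
move=> hf h; apply: spn_min h; split=> [|c u v hu hv].
  by rewrite (lin0 hf); exact: spn0.
by rewrite hf; apply: (subsp_spn Q).2.
Qed.

(** * Products with the modes of [e^alpha] *)

Section Commutation.
Variable K : fieldType.
Hypothesis char0 : forall n : nat, n.+1%:R != 0 :> K.
Local Notation V := (Fock K).
Local Notation Hv := (Hv K).
Local Notation YH := (YH (K := K)).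
Implicit Types (X Y : int -> V -> V) (w : V).

Let lS b i := @Sz_lin K char0 b i.
Let lh b := @sh_lin K b.

Lemma Ecomm_YH c : Ecomm (size c) (YH c) ((-1) ^+ size c).
Proof.
elim: c => [|a c IH]; first exact: Ecomm_wproj.
rewrite /= exprS mulN1r -addn1 PoszD.
by apply: (Ecomm_Df char0) => //; exact: isfield_YH.
Qed.

(** For small [k] the vector [E_k w] has negative degree. For large [k] the commutation relation
    moves [E_k] to the left, where the output degree of [X] becomes negative. *)
Lemma fin_LE g X (n : nat) d m e w (c : int -> K) : isfield g X -> Ecomm g X ((-1) ^+ n) ->
  homog m e w -> fin (fun k => c k *: X d (Er k w)).
Proof.
move=> hX hE hw; apply: (@fin_itv _ (- e) (d + g)) => k /orP[ke|dk].
  by rewrite (Er_small char0 hw) ?(lin0 (hX.1 d)) ?scaler0 //; lia.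
have := hE m e (d - k + g) (k - g) w hw.
rewrite (_ : d - k + g + (k - g) = d); last by lia.
rewrite subrK (fld_neg _ hX) ?(lin0 (@Er_lin _ _)); last by lia.
move/esym/eqP; rewrite scaler_eq0 signr_eq0 /= => /eqP ->; exact: scaler0.
Qed.

Definition LE (a : int) X d m w (k : int) : V := gbinz (k + m)%:~R a *: X d (Er k w).

Lemma Er_vac r : Er r (vacv K) = Sz 2 r (sh 2 (vacv K)).
Proof.
have hv : homog 0 0 (vacv K) by exact: (@hom_Hv _ char0 [::]).
rewrite (Er_hom char0 r hv) (@zsum_eq1 _ 0) => [|j j0].
  by rewrite /Et Tz0 addr0 sh_Sz.
rewrite /Et; have [jn|jp] := ltrP j 0.
  by rewrite Tz_neg // (lin0 (lS _ _)) (lin0 (lh _)).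
by rewrite (Tz_big char0 _ hv) ?(lin0 (lS _ _)) ?(lin0 (lh _)) //; lia.
Qed.

Lemma ex2 m (i j : int) : ex K 2 m (i, j) = (i - j + m)%:~R.
Proof.
by rewrite /ex /= [RHS]rmorphD rmorphM /= mulrAC divff ?mul1r // (char0 1).
Qed.

(* The field of [e^alpha(n) v] is again a combination of products [X_d E_k] with [X] the
   field of [v]: this is what lets commutation with [e^alpha] propagate to all of [W]. *)
Lemma Yf_Er c rho m e d w : homog m e w ->
  Yf (Er rho (Hv c)) d w =
  (-1) ^+ size c *: fsum (LE (rho + size c) (YH c) d m w).
Proof.
elim: c rho m e d w => [|a c IH] rho m e d w hw.
  (* On the vacuum, [Er rho] gives [S_rho e^alpha], whose field is a divided derivative of
     [e^alpha(z)]; on the right [wproj] keeps only [k = d - e]. *)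
  have hv : homog 0 0 (vacv K) by exact: (@hom_Hv _ char0 [::]).
  rewrite (_ : YH [::] = @wproj K) // scale1r addr0 [Hv _]/(vacv K) Er_vac (Yf_S char0 _ _ hv) Yf_vac //.
  have hp := isfield_wproj K.
  rewrite (Df_E char0 _ _ _ hp hw).
  have fD := fin_Dg char0 2 d (fun x => gbinz (ex K 2 m x) rho) hp hw.
  rewrite (fsum_pair fD) (fsum_exchange fD) (@zsum_eq1 _ (d - e) (LE _ _ _ _ _)); last first.
    move=> k ke; rewrite /LE.
    rewrite (wproj_hom d (hom_Er char0 (r := k) hw)) ifF ?scaler0 //; lia.
  rewrite /LE (wproj_hom d (hom_Er char0 (r := d - e) hw)).
  rewrite addrCA subrr addr0 eqxx (Er_hom char0 (d - e) hw) -fsumZ; last exact: fin_Et hw.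
  apply: eq_zsum => j; have hT := hom_Tz char0 (b := 2) (i := j) hw.
  rewrite (@zsum_eq1 _ (d - e + j)) => [|i ne].
    rewrite ex2 /Dg /= (wproj_hom _ hT) ifT; last by lia.
    by rewrite (_ : d - e + j - j + m = d - e + m) //; lia.
  rewrite /Dg /= (wproj_hom _ hT) ifF; last by lia.
  by rewrite (lin0 (lS _ _)) (lin0 (lh _)) scaler0.
pose G : int := rho + (size c).+1.
have hc := @hom_Hv _ char0 c; have hX := @isfield_YH _ char0 c.
have hE := @Ecomm_YH c; set X := YH c in hX hE IH *.
have hsc := hom_sh (b := 1) hc.
rewrite (@HvS K) (Er_Sz char0 _ _ hsc) -!sh_Er //.
rewrite (linB _ _ (@Yf_lin K d w)).
have hE1 := hom_Er char0 (r := rho) hc; have hE2 := hom_Er char0 (r := rho + 1) hc.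
rewrite (Yf_S char0 _ _ hE1) (Yf_S char0 _ _ hE2).
pose Z (x : int * (int * int)) : V :=
  sh 1 (Sz 1 x.2.1 (X (d - x.2.1) (Er x.1 (Tz 1 x.2.2 w)))).
have fZ (cf : int * (int * int) -> K) : fin (fun x => cf x *: Z x).
  apply: (@fin_itv3 _ (- e) (d + size c) 0 d 0 e) => k i j h; rewrite /Z /=.
  have [i0|i0] := boolP (i < 0); first by rewrite Sz_neg // (lin0 (lh _)) scaler0.
  have lX := hX.1.
  have [j0|j0] := boolP (j < 0).
    rewrite Tz_neg // (lin0 (@Er_lin _ _)) (lin0 (lX _)) (lin0 (lS _ _)) (lin0 (lh _)).
    exact: scaler0.
  have [ej|ej] := boolP (e < j).
    rewrite (Tz_big char0 _ hw) // (lin0 (@Er_lin _ _)) (lin0 (lX _)) (lin0 (lS _ _)).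
    by rewrite (lin0 (lh _)) scaler0.
  have hT := hom_Tz char0 (b := 1) (i := j) hw.
  have [kl|kl] := boolP (k < - (e - j)).
    rewrite (Er_small char0 hT) ?(lin0 (lX _)) ?(lin0 (lS _ _)) ?(lin0 (lh _)) ?scaler0 //.
    lia.
  suff -> : X (d - i) (Er k (Tz 1 j w)) = 0.
    by rewrite (lin0 (lS _ _)) (lin0 (lh _)) scaler0.
  have [di|di] := boolP (d < i); first by rewrite (fld_neg _ hX) //; lia.
  have := hE m (e - j) (d - i - k + (size c)%:Z) (k - (size c)%:Z) _ hT.
  rewrite (_ : d - i - k + (size c)%:Z + (k - (size c)%:Z) = d - i); last by lia.
  rewrite subrK (fld_neg _ hX) ?(lin0 (@Er_lin _ _)); last by lia.
  by move/esym/eqP; rewrite scaler_eq0 signr_eq0 /= => /eqP.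
have expand (b : int) (r : int) : Df 1 b (Yf (Er r (Hv c))) d w = (-1) ^+ size c *:
    fsum (fun x => (gbinz (ex K 1 m x.2) b * gbinz (x.1 + m)%:~R (r + size c)) *: Z x).
  have hf := isfield_Yf char0 (hom_Er char0 (r := r) hc).
  have fc := fZ (fun x => gbinz (ex K 1 m x.2) b * gbinz (x.1 + m)%:~R (r + size c)).
  rewrite (Df_E char0 _ _ _ hf hw) (fsum_pair fc) (fsum_exchange fc) -fsumZ; last first.
    exact: fin_pair1 (fin_swap fc).
  apply: eq_zsum2 => i j; rewrite /Dg /=.
  have hT := hom_Tz char0 (b := 1) (i := j) hw.
  rewrite (IH _ _ _ _ _ hT) (linZ _ _ (lS _ _)) (linZ _ _ (lh _)) scaleC.
  congr (_ *: _).
  have fL := fin_LE (d - i) (fun k => gbinz (k + m)%:~R (r + size c)) hX hE hT.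
  rewrite (lin_fsum (lS _ _) fL) (lin_fsum (lh _)); last exact: fin_comp (lin0 (lS _ _)) fL.
  rewrite -fsumZ; last first.
    by apply: fin_comp (lin0 (lh _)) _; exact: fin_comp (lin0 (lS _ _)) fL.
  by apply: eq_zsum => k; rewrite /LE (linZ _ _ (lS _ _)) (linZ _ _ (lh _)) scalerA.
rewrite !expand -scalerBr -(fsumB (fZ _) (fZ _)) /= exprS mulN1r scaleNr -scalerN.
congr (_ *: _).
(* [c1] and [Z2] belong to the two terms of [Tz_Er]. After the shift [h] both sides are combinations
   of the same [Z x], and their coefficients agree by Pascal's rule for the binomial of the mode and
   for that of the exponent. *)
pose c1 (x : int * (int * int)) : K := gbinz (x.1 + m)%:~R G * gbinz (ex K 1 m x.2 + 1) a.
pose c2 (x : int * (int * int)) : K := gbinz (x.1 + m)%:~R G * gbinz (ex K 1 (m + 2) x.2) a.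
pose h (x : int * (int * int)) : int * (int * int) := (x.1 - 1, (x.2.1, x.2.2 - 1)).
pose h' (x : int * (int * int)) : int * (int * int) := (x.1 + 1, (x.2.1, x.2.2 + 1)).
have hK : cancel h h' by case=> k [i j]; rewrite /h /h' /= !subrK.
have hK' : cancel h' h by case=> k [i j]; rewrite /h /h' /= !addrK.
pose Z2 x := (gbinz (x.1 + 1 + m)%:~R G * gbinz (ex K 1 m x.2) a) *: Z x.
have fZ2 : fin Z2 by exact: fZ.
have -> : fsum (LE G (Df 1 a X) d m w) =
    fsum (fun x => c1 x *: Z x) - fsum Z2.
  rewrite -(fsum_reindex hK hK' fZ2) -(fsumB (fZ _) (fin_reindex hK fZ2)).
  have fB : fin (fun x => c1 x *: Z x - Z2 (h x)).
    apply: finD => //; apply: (@fin_comp _ _ _ -%R); rewrite ?oppr0 //.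
    exact: fin_reindex hK fZ2.
  rewrite (fsum_pair fB); apply: eq_zsum => k; rewrite /LE.
  have hEk := hom_Er char0 (r := k) hw.
  rewrite (Df_E char0 _ _ _ hX hEk) -fsumZ; last exact: fin_Dg hX hEk.
  apply: eq_zsum2 => i j; rewrite /Dg /= (Tz_Er char0 _ _ hw).
  rewrite (linB _ _ (hX.1 _)) (linB _ _ (lS _ _)) (linB _ _ (lh _)) !scalerBr !scalerA.
  rewrite /Z2 /c1 /Z /h /= subrK ex_down (ex_shift char0) !exS //.
rewrite -(fsumB (fZ _) fZ2) -fsumN; last first.
  by apply: finD => //; apply: (@fin_comp _ _ _ -%R); rewrite ?oppr0.
apply: eq_fsum => x; rewrite /Z2 /c1 -!scalerBl -scaleNr; congr (_ *: _).
rewrite (_ : x.1 + 1 + m = x.1 + m + 1); last by rewrite addrAC.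
rewrite [(x.1 + m + 1)%:~R]rmorphD /= !(gbinzS char0).
rewrite /G /= -addn1 PoszD (_ : rho + ((size c)%:Z + 1) - 1 = rho + size c); last by lia.
rewrite (_ : rho + ((size c)%:Z + 1) = rho + 1 + size c); last by lia.
have -> : gbin (ex K 1 m x.2 + 1) a = gbin (ex K 1 m x.2) a + gbinz (ex K 1 m x.2) (a%:Z - 1).
  exact: (gbinzS char0 _ a).
ring.
Qed.

End Commutation.

(** * Spans of h-monomials with a given number of factors *)

Section HSpan.
Variable K : fieldType.
Hypothesis char0 : forall n : nat, n.+1%:R != 0 :> K.
Local Notation V := (Fock K).
Local Notation Hv := (Hv K).
Local Notation YH := (YH (K := K)).
Implicit Types (X Y : int -> V -> V) (w : V).

Let lS b i := @Sz_lin K char0 b i.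
Let lh b := @sh_lin K b.

Definition Hspan (g : nat) : V -> Prop := spn (fun x => exists2 c, size c = g & x = Hv c).

Lemma Hspan_ind g (Z : V -> Prop) : subsp Z -> (forall c, size c = g -> Z (Hv c)) ->
  forall v, Hspan g v -> Z v.
Proof. by move=> hZ h; apply: spn_min => // _ [c hc ->]; exact: h. Qed.

Lemma subsp_lin (M N : lmodType K) (f : M -> N) Z : lin f -> subsp Z ->
  subsp (fun v => Z (f v)).
Proof.
by move=> hf [Z0 ZA]; split=> [|c u v hu hv]; rewrite ?(lin0 hf) ?hf //; exact: ZA.
Qed.

Lemma subsp_Hspan g : subsp (Hspan g). Proof. exact: subsp_spn. Qed.

Lemma Hspan_Hv c : Hspan (size c) (Hv c).
Proof. by apply: spn_id; exists c. Qed.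

Lemma Hspan_S1 g (a : int) v : Hspan g v -> Hspan g.+1 (Sz 1 a (sh 1 v)).
Proof.
apply: (@Hspan_ind _ (fun v => Hspan g.+1 (Sz 1 a (sh 1 v)))).
  by apply: (subsp_lin (lin_comp (lS 1 a) (lh 1))); exact: subsp_Hspan.
move=> c <-; case: a => a; first exact: (Hspan_Hv (a :: c)).
by rewrite Sz_neg //; exact: spn0.
Qed.

(** As [alpha = 2 varpi], the series [Sz 2] is the square of [Sz 1] and contributes two factors
    [h]. *)
Lemma Hspan_S2 g (a : int) v : Hspan g v -> Hspan g.+2 (Sz 2 a (sh 2 v)).
Proof.
move=> hv; rewrite (Sz_conv char0 1 1); apply: subsp_fsum; first exact: subsp_Hspan.
move=> k; rewrite -(sh_sh 1 1) -sh_Sz //.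
by do 2!apply: Hspan_S1.
Qed.

Lemma an_vac q : an q (vacv K) = 0.
Proof.
have [q0|q0] := lerP q 0; first exact: an_le0.
by apply: (@an_big _ 0 0) => //; exact: (@hom_Hv _ char0 [::]).
Qed.

(** By [an_Sz] an annihilation mode lowers the index of one factor at a time, up to a scalar, and so
    preserves the number of factors. *)
Lemma Hspan_an g q v : Hspan g v -> Hspan g (an q v).
Proof.
apply: (@Hspan_ind _ (fun v => Hspan g (an q v))).
  by apply: (subsp_lin (@an_lin _ _)); exact: subsp_Hspan.
move=> c <- {g}; elim: c => [|a c IH]; first by rewrite an_vac; exact: spn0.
have [q0|q0] := lerP q 0; first by rewrite an_le0 //; exact: spn0.
rewrite HvS (an_Sz char0) // -sh_an; apply: spnD; first exact: Hspan_S1.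
by apply: spnZ; apply: Hspan_S1; exact: Hspan_Hv.
Qed.

Lemma Hspan_T g b j v : Hspan g v -> Hspan g (Tz b j v).
Proof.
apply: (@expz_closed _ char0) => //.
- exact: an_lin.
- exact: an_le0.
- exact: spn0.
- by move=> a x y; exact: (subsp_Hspan g).2.
- by move=> t w; exact: Hspan_an.
Qed.

Lemma Hspan_Er g r v : Hspan g v -> Hspan g.+2 (Er r v).
Proof.
apply: (@Hspan_ind _ (fun v => Hspan g.+2 (Er r v))).
  by apply: (subsp_lin (@Er_lin _ _)); exact: subsp_Hspan.
move=> c sc; rewrite (Er_hom char0 r (@hom_Hv _ char0 c)).
apply: subsp_fsum => [|j]; first exact: subsp_Hspan.
rewrite /Et sh_Sz //; apply: Hspan_S2; apply: Hspan_T; rewrite -sc; exact: Hspan_Hv.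
Qed.

(** The sign in [Yf_Er] depends only on the length and is [1] for even length, so the formula
    extends linearly. Finiteness is carried along because [fsum] is additive on finite families. *)
Lemma Yf_Er_Hspan r u : Hspan r.*2 u -> forall (rho m e d : int) w, homog m e w ->
  fin (LE (rho + (r.*2)%:Z) (Yf u) d m w) /\
  Yf (Er rho u) d w = fsum (LE (rho + (r.*2)%:Z) (Yf u) d m w).
Proof.
move=> hu rho m e d w hw; move: u hu; apply: Hspan_ind.
  split=> [|c u v [fu eu] [fv evec]].
    have z k : LE (rho + (r.*2)%:Z) (Yf 0) d m w k = 0 by rewrite /LE Yf0 scaler0.
    split; first by exists [::].
    by rewrite (lin0 (@Er_lin _ _)) (zsum_eq0 z) Yf0.
  have e1 k : c *: LE (rho + (r.*2)%:Z) (Yf u) d m w k + LE (rho + (r.*2)%:Z) (Yf v) d m w k =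
     LE (rho + (r.*2)%:Z) (Yf (c *: u + v)) d m w k.
    by rewrite /LE scaleC -scalerDr Yf_comb.
  split; first by apply: fin_eq e1 _; apply: finD => //; exact: (finZ (fun=> c)).
  rewrite Er_lin [LHS](@Yf_lin K d w) eu evec -fsumZ // -fsumD //; last exact: (finZ (fun=> c)).
  exact: eq_fsum.
move=> c sc; have hE := @Ecomm_YH _ char0 c; have hX := @isfield_YH _ char0 c.
rewrite Yf_Hv // -sc; split; first exact: fin_LE hX hE hw.
by rewrite (Yf_Er char0 _ _ _ hw) sc -signr_odd odd_double expr0 scale1r.
Qed.

(* Commutation of modes, written in terms of weights: for charge [2 r] the mode index of
   [U] is recovered from the weight and the charge of its argument. *)
Definition comm2 (r : nat) (U : int -> V -> V) := forall c, ~~ odd (size c) ->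
  forall m e d d' w, homog m e w ->
  U d (YH c d' w) = YH c d (U (d - d' + e + (r * size c)%N) w).

Lemma comm2_vac : comm2 0 (Yf (vacv K)).
Proof.
move=> c _ m e d d' w hw; rewrite Yf_vac // mul0n addr0.
have hX := @isfield_YH _ char0 c.
rewrite (wproj_hom _ (hX.2 _ _ d' _ hw)) (wproj_hom _ hw).
rewrite (_ : (e == d - d' + e) = (d' == d)); last by apply/idP/idP; lia.
by case: eqP => [->|_] //; rewrite (lin0 (hX.1 _)).
Qed.

Lemma comm2_Er r rho u : Hspan r.*2 u -> comm2 r (Yf u) -> comm2 r.+1 (Yf (Er rho u)).
Proof.
move=> hu hc c oc m e d d' w hw; pose g := size c.
have hX := @isfield_YH _ char0 c; have hE := @Ecomm_YH _ char0 c.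
have [_ ->] := Yf_Er_Hspan hu rho d (hX.2 _ _ d' _ hw).
set D := d - d' + e + _; have [fD ->] := Yf_Er_Hspan hu rho D hw.
have fX := fin_comp (lin0 (hX.1 d)) fD.
(* Passing the field of charge [g] turns [E_k] into [E_(k+g)]. After a shift of the sum by [g] the
   binomials agree, because [k + (m + g) = (k + g) + m]. *)
rewrite (lin_fsum (hX.1 d) fD) -(fsum_shift g%:Z fX).
apply: eq_zsum => k; rewrite /LE (linZ _ _ (hX.1 d)).
rewrite (_ : k + (m + size c) = k + g + m); last by rewrite /g; lia.
congr (_ *: _); rewrite (hE _ _ _ _ _ hw) -signr_odd (negPf oc) expr0 scale1r.
rewrite (hc c oc _ _ _ _ _ (hom_Er char0 (r := k + g) hw)).
congr (YH c d (Yf u _ _)); rewrite /D /g; lia.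
Qed.

End HSpan.

(** * Comparison with [Ymode] *)

Section Modes.
Variable K : fieldType.
Hypothesis char0 : forall n : nat, n.+1%:R != 0 :> K.
Local Notation V := (Fock K).
Implicit Types (X Y : int -> V -> V) (w : V).

Let lS b i := @Sz_lin K char0 b i.
Let lT b i := @Tz_lin K char0 b i.
Let lh b := @sh_lin K b.

Definition Ebt (b r : int) w (j : int) : V := sh b (Sz b (r + j) (Tz b j w)).

Lemma zero_Ebt b r m e w (j : int) : homog m e w -> (j < 0) || (e < j) -> Ebt b r w j = 0.
Proof.
move=> hw /orP[j0|ej]; rewrite /Ebt.
  by rewrite Tz_neg // (lin0 (lS _ _)) (lin0 (lh _)).
by rewrite (Tz_big char0 _ hw ej) (lin0 (lS _ _)) (lin0 (lh _)).
Qed.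

Lemma fin_Ebt b r m e w : homog m e w -> fin (Ebt b r w).
Proof. by move=> hw; apply: (@fin_itv _ 0 e) => j; exact: zero_Ebt hw. Qed.

Lemma Ebt_lin b r j : lin (fun w => Ebt b r w j).
Proof.
by apply: lin_comp; [exact: lh | apply: lin_comp; [exact: lS | exact: lT]].
Qed.

Definition expmode (b P : int) w : V := emode b P w.

(** Removes the truncation in [ekey]: [T_j] vanishes beyond the degree of [w], and for each [j] only
    [i = r + j] meets the condition on the power of [z]; it lies in the given range unless it is
    negative. *)
Lemma expmode_hom (b P r m e : int) w : homog m e w -> - P - 2 - b * m = 2 * r ->
  expmode b P w = fsum (Ebt b r w).
Proof.
move=> hw hP; move: w hw; apply: fglift_hom.
  apply: (@fsum_homlin _ _ m e (Ebt b r)) => [j|w']; first exact: Ebt_lin.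
  exact: fin_Ebt.
move=> -[k l] /= -> le; rewrite /ekey /= (_ : - P - 2%:Z - b * m = 2 * r) //.
have hk : homog m e (bv K (m, l)) by rewrite -le; exact: homb.
rewrite (@fsum_ord _ (pwt l).+1); last first.
  move=> j /orP[j0|jl]; apply: (zero_Ebt _ _ hk); first by rewrite j0.
  by apply/orP; right; lia.
apply: eq_bigr => j _; rewrite /Ebt sh_Sz // sh_Tz // shb.
pose F (i : nat) : V := if i%:Z == r + j%:Z then Sz b i (Tz b j (bv K (m + b, l))) else 0.
rewrite (eq_bigr (fun i : 'I__ => F i)) => [|i _]; last first.
  rewrite /F SopE TopE (_ : ((2 * i)%N%:Z == (2 * j)%N%:Z + 2 * r) = (i%:Z == r + j%:Z)) //.
  by apply/idP/idP; lia.
have [rj|rj] := ltrP (r + j%:Z) 0.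
  rewrite Sz_neg // big1 // => i _; rewrite /F ifF //; lia.
have e0 : (absz (r + j%:Z))%:Z = r + j%:Z by rewrite gez0_abs.
have rjn : (absz (r + j%:Z)%R < (pwt l + absz (2 * r)%R).+1)%N by have := ltn_ord j; lia.
rewrite (bigD1 (Ordinal rjn)) //= big1 => [|i ne].
  by rewrite addr0 /F e0 eqxx.
rewrite /F ifF //; apply/negbTE; apply: contraNN ne => /eqP e1.
by apply/eqP/val_inj => /=; lia.
Qed.

Lemma Df0_wproj b m e d w : homog m e w -> Df b 0 (@wproj K) d w = fsum (Ebt b (d - e) w).
Proof.
move=> hw; have hp := isfield_wproj K.
have fD := fin_Dg char0 b d (fun x => gbinz (ex K b m x) 0) hp hw.
rewrite (Df_E char0 _ _ _ hp hw) (fsum_pair fD) (fsum_exchange fD).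
apply: eq_zsum => j; have hT := hom_Tz char0 (b := b) (i := j) hw.
rewrite (@zsum_eq1 _ (d - e + j)) => [|i ne].
  rewrite gbinz0 scale1r /Dg /= (wproj_hom _ hT) ifT //; lia.
rewrite /Dg /= (wproj_hom _ hT) ifF; last by lia.
by rewrite (lin0 (lS _ _)) (lin0 (lh _)) scaler0.
Qed.

Lemma hmode0 m e w : homog m e w -> hmode 0 w = (m%:~R / 2%:R) *: w :> V.
Proof.
move: w; apply: (@fglift_hom K _ m e (@hop K 0) (fun w => (m%:~R / 2%:R) *: w)).
  by move=> c u v _ _; rewrite scalerDr scaleC.
by move=> k km _; rewrite -monoE -km.
Qed.

(* The anonymous fixpoint of [Ykey], named so that one can induct on [ns]. *)
Definition Yloop (E wt : nat) (g N : int) := fix F (ns : seq nat) (s : int) (x : Defs.V K) : Defs.V K :=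
    match ns with
    | [::] => emode g (2%:Z * N - 2%:Z * s) x
    | n :: ns' =>
        \sum_(q < wt.+1)
           (zbin K (- q%:Z - 1) n.-1 *: F ns' (s + q%:Z + n%:Z) (hmode q%:Z x))
      + \sum_(t < E + n)
           (zbin K (t%:Z) n.-1 *:
              hmode (Negz t) (F ns' (s + Negz t + n%:Z) x))
    end.

Definition Yloopv E wt g N ns s (x : V) : V := Yloop E wt g N ns s x.

Lemma Yloopv_cons E wt g N n ns s x : Yloopv E wt g N (n :: ns) s x =
  \sum_(q < wt.+1) (zbin K (- q%:Z - 1) n.-1 *: Yloopv E wt g N ns (s + q%:Z + n%:Z) (hmode q%:Z x))
  + \sum_(t < E + n) (zbin K (t%:Z) n.-1 *: cr t.+1 (Yloopv E wt g N ns (s + Negz t + n%:Z) x)).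
Proof. by []. Qed.

(** [mu] is the power of [z] supplied by the charges, and the quantity bounded by [E] is the degree
    of the output. The bound keeps all contributing creation modes within the truncated range; [wt]
    does so for the annihilation modes. *)
Lemma Yloopv_E E wt g N mu ns s m (e : int) x : homog m e x -> g * m = 2 * mu -> e <= wt%:Z ->
  all (fun n => 0 < n)%N ns -> e - N + s - 1 - mu + (sumn ns)%:Z <= E%:Z ->
  Yloopv E wt g N ns s x = Ypart g ns (e - N + s - 1 - mu + (sumn ns)%:Z) x.
Proof.
move=> hx gm; elim: ns s e x hx => [|n ns IH] s e x hx ewt.
  move=> _ _; rewrite /= addr0 (Df0_wproj _ _ hx).
  rewrite [LHS](@expmode_hom g _ (- N + s - 1 - mu) m e x hx); last first.
    by rewrite gm; ring.
  by congr (fsum (Ebt _ _ _)); ring.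
move=> /andP[n0 pos] dE; rewrite Yloopv_cons.
set d := e - N + s - 1 - mu + _ in dE *.
have hY := isfield_Ypart char0 g ns.
rewrite [RHS]/(Pf n.-1 (Ypart g ns) d x) /Pf [LHS]addrC; congr (_ + _); last first.
  rewrite (aP_lin_hom _ (hY.1 d) hx) big_ord_recl; congr (_ + _).
    have hx2 : homog m e ((m%:~R / 2%:R) *: x) by exact: suppZ.
    rewrite zbinE // (hmode0 hx) (IH _ _ _ hx2) //; last first.
      move: dE; rewrite /d /=; lia.
    rewrite (linZ _ _ (hY.1 _)) scalerA rmorphB /= oppr0 sub0r.
    by congr (_ *: Ypart g ns _ x); rewrite /d /=; lia.
  have fq : fin (fun q => gbin (- q - 1)%:~R n.-1 *: Ypart g ns d (an q x)).
    apply: (finZ (fun q => gbin (- q - 1)%:~R n.-1)); apply: (@fin_itv _ 1 e).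
    move=> q /orP[q1|qe]; first by rewrite an_le0 ?(lin0 (hY.1 d)) //; lia.
    by rewrite (an_big hx) ?(lin0 (hY.1 d)).
  rewrite -(fsum_shift 1 fq) (@fsum_ord _ wt).
    apply: eq_bigr => q _; rewrite zbinE // !lift0.
    rewrite (_ : q%:Z + 1 = q.+1); last by lia.
    congr (_ *: _); have ha := hom_an (t := q.+1) hx.
    rewrite -[hmode _ x]/(an q.+1 x) (IH _ _ _ ha) //; first last.
    - move: dE; rewrite /d /=; lia.
    - lia.
    by congr (Ypart g ns _ _); rewrite /d /=; lia.
  move=> q /orP[q0|qw]; first by rewrite an_le0 ?(lin0 (hY.1 d)) ?scaler0 //; lia.
  by rewrite (an_big hx) ?(lin0 (hY.1 d)) ?scaler0 //; lia.
have fP := fin_Pm n.-1 d x hY.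
rewrite -(fsum_shift 1 fP) (@fsum_ord _ (E + n)).
  apply: eq_bigr => t _; rewrite zbinE // addrK; congr (_ *: _).
  rewrite (_ : t%:Z + 1 = t.+1); last by lia.
  congr (cr _ _); rewrite (IH _ _ _ hx) //; last first.
    move: dE; rewrite /d /= NegzE; lia.
  by congr (Ypart g ns _ _); rewrite /d /= NegzE; lia.
move=> t /orP[t0|tE]; first by rewrite cr_le0 ?scaler0 //; lia.
rewrite (fld_neg _ hY) ?(lin0 (@cr_lin _ _)) ?scaler0 //; lia.
Qed.

Definition vmode (v : V) (N : int) (x : V) : V := Ymode v N x.

Lemma vmode_linl N x : lin (fun v => vmode v N x). Proof. exact: fglift_lin. Qed.

Lemma vmode_lin v N : lin (vmode v N).
Proof.
move=> c x y; move: v; apply: lin_ext; first exact: vmode_linl.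
  by apply: linadd; [apply: linscale; exact: vmode_linl | exact: vmode_linl].
move=> k; have e z : vmode (bv K k) N z = lft (Ykey K k N) z by exact: (@fgliftb K V).
by rewrite !e fglift_lin.
Qed.

(** [v(N)] changes the conformal weight by the weight of [v] minus [N + 1]. Since weight is degree
    plus a quarter of the squared charge, the cross term [g m / 2 = mu] has to be subtracted. *)
Lemma vmode_hom v g a m e w (N mu : int) : homog g a v -> homog m e w -> g * m = 2 * mu ->
  vmode v N w = Yf v (e + a - N - 1 - mu) w.
Proof.
move=> hv hw gm; set d := e + a - _ - _ - _; move: v hv.
apply: (@hom_ext K V g a (fun v => vmode v N w) (fun v => Yf v d w)).
- by move=> c u v _ _; exact: vmode_linl.
- by move=> c u v _ _; exact: Yf_lin.
move=> [gk lk] /= gE aE.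
have hY := isfield_Ypart char0 gk (sval lk); rewrite Yf_b /=.
rewrite [LHS](@fgliftb K V); move: w hw.
apply: (@fglift_hom K V m e (Ykey K (gk, lk) N) (Ypart gk (sval lk) d)).
  by move=> c x y _ _; exact: hY.1.
move=> [mk rk] /= mE eE.
have hk : homog m e (bv K (mk, rk)) by rewrite -mE -eE; exact: homb.
pose E := (`|N| + absz (gk * mk)%R + (size (sval lk)).+1 * pwt rk + sumn (sval lk))%N.
transitivity (Yloopv E (pwt rk) gk N (sval lk) 0 (bv K (mk, rk))); first by [].
rewrite (Yloopv_E (mu := mu) hk) ?gE //.
- by congr (Ypart _ _ _ _); rewrite /d -aE addr0 /pwt; lia.
- by rewrite -eE.
- by apply/allP => p; exact: part_pos.
- rewrite /E -eE addr0 /pwt; move: gm; rewrite -gE -mE; nia.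
Qed.

End Modes.

(** * The kernel of [e^alpha(n)], [n >= 0] *)

Section Kernel.
Variable K : fieldType.
Hypothesis char0 : forall n : nat, n.+1%:R != 0 :> K.
Local Notation V := (Fock K).
Local Notation Hv := (Hv K).
Local Notation vacv := (vacv K).
Implicit Types (X Y : int -> V -> V) (w : V).

Let lS b i := @Sz_lin K char0 b i.
Let lh b := @sh_lin K b.

Lemma hom_vac : homog 0 0 vacv. Proof. exact: (@hom_Hv _ char0 [::]). Qed.

Lemma foldr_cr m s : all (fun n => 0 < n)%N s ->
  foldr (fun (n : nat) x => cr n%:Z x) (bv K (m, part0)) s = bv K (m, mkpart s).
Proof.
elim: s => [|[//|n] s IH] //= pos.
rewrite -[hmode _ _]/(cr n.+1 _) IH // (@crb K); congr (bv K (m, _)).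
apply: part_eq; apply: (perm_trans (perm_pins _ _)) => //.
rewrite perm_sym; apply: (perm_trans (perm_mkpart _)) => //.
by rewrite perm_cons perm_sym; exact: perm_mkpart.
Qed.

(** The creation property. On the vacuum only creation modes survive, and [binom(t - 1, n - 1)]
    vanishes for [0 < t < n], so [varpi(-n)] is the first mode of its factor to appear. *)
Lemma Ypart_vac g ns : all (fun n => 0 < n)%N ns ->
  (forall d : int, d < (sumn ns)%:Z -> Ypart g ns d vacv = 0) /\
  Ypart g ns (sumn ns) vacv = foldr (fun (n : nat) x => cr n%:Z x) (bv K (g, part0)) ns.
Proof.
have hv := hom_vac.
elim: ns => [|n ns IH] => [_|/andP[n0 pos]].
  have e d : Ypart g [::] d vacv = sh g (Sz g d vacv).
    rewrite [LHS](Df0_wproj char0 g d hv) subr0.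
    rewrite (@zsum_eq1 _ 0) => [|j j0]; first by rewrite /Ebt Tz0 addr0.
    by apply: (zero_Ebt char0 _ _ hv); lia.
  split=> [d d0|]; first by rewrite e Sz_neg // (lin0 (lh _)).
  by rewrite e Sz0 /= /vacv shb add0r.
have [IH1 IH2] := IH pos.
have hY := isfield_Ypart char0 g ns.
have e d : Ypart g (n :: ns) d vacv =
   fsum (fun t => gbin (t - 1)%:~R n.-1 *: cr t (Ypart g ns (d - t) vacv)).
  rewrite [LHS]/(Pf n.-1 (Ypart g ns) d vacv) /Pf (aP_hom _ hv) mul0r mulr0 scale0r add0r.
  rewrite zsum_eq0 ?(lin0 (hY.1 d)) ?addr0 // => q.
  by rewrite /aPt an_vac // scaler0.
have small t (d : int) : t < n%:Z -> gbin (t - 1)%:~R n.-1 *: cr t (Ypart g ns d vacv) = 0.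
  move=> tn; have [t0|t0] := lerP t 0; first by rewrite cr_le0 // scaler0.
  have -> : t - 1 = (absz (t - 1))%:Z by rewrite gez0_abs //; lia.
  by rewrite -pmulrn gbin_nat // bin_small ?scale0r //; lia.
split=> [d dn|].
  rewrite e zsum_eq0 // => t; have [tn|tn] := ltrP t n%:Z; first exact: small.
  rewrite IH1 ?(lin0 (@cr_lin _ _)) ?scaler0 //; move: dn => /=; lia.
rewrite e (@zsum_eq1 _ n%:Z) => [|t tn].
  have -> : (sumn (n :: ns))%:Z - n%:Z = (sumn ns)%:Z by rewrite /=; lia.
  rewrite IH2 /=; case: n n0 {e small} => // n _.
  rewrite (_ : n.+1%:Z - 1 = n) /=; last by lia.
  by rewrite -pmulrn gbin_nat // binn scale1r.
have [tn'|tn'] := ltrP t n%:Z; first exact: small.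
rewrite IH1 ?(lin0 (@cr_lin _ _)) ?scaler0 //=; lia.
Qed.

Lemma vmode_vac v : vmode v (-1) vacv = v.
Proof.
move: v; apply: (@lin_ext _ _ _ id) => // [|[g l]]; first exact: vmode_linl.
have hk : homog g (pwt l) (bv K (g, l)) by exact: (@homb K (g, l)).
rewrite (vmode_hom char0 (-1) hk hom_vac (mu := 0)) ?mulr0 // Yf_b /=.
rewrite (_ : 0 + (pwt l)%:Z - -1 - 1 - 0 = sumn (sval l)); last by rewrite /pwt; lia.
have pos : all (fun n => 0 < n)%N (sval l) by apply/allP => p; exact: part_pos.
by rewrite (Ypart_vac g pos).2 foldr_cr // mkpartK.
Qed.

Lemma vmode_vac0 v (N : int) : 0 <= N -> vmode v N vacv = 0.
Proof.
move=> N0; move: v; apply: (@lin_ext _ _ _ (fun=> 0)) => [||[g l]].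
- exact: vmode_linl.
- by move=> c u v; rewrite scaler0 addr0.
have hk : homog g (pwt l) (bv K (g, l)) by exact: (@homb K (g, l)).
rewrite (vmode_hom char0 N hk hom_vac (mu := 0)) ?mulr0 // Yf_b /=.
have pos : all (fun n => 0 < n)%N (sval l) by apply/allP => p; exact: part_pos.
by apply: (Ypart_vac g pos).1; rewrite /pwt; lia.
Qed.

(** Unlike in [Hv], the charge is independent of the number of factors. Since [h_0 = 1], zeros can
    be appended to reach a prescribed length. *)
Definition Hm (m : int) (s : seq nat) : V :=
  foldr (fun (a : nat) x => Sz 1 a%:Z x) (bv K (m, part0)) s.

Lemma HmS m a s : Hm m (a :: s) = Sz 1 a%:Z (Hm m s). Proof. by []. Qed.

Lemma sh_Hm b m s : sh b (Hm m s) = Hm (m + b) s.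
Proof.
by elim: s => [|a s IH]; [rewrite /Hm /= shb | rewrite !HmS sh_Sz // IH].
Qed.

Lemma Hv_Hm c : Hv c = Hm (size c) c.
Proof.
by elim: c => [|a c IH] //; rewrite HvS IH sh_Hm HmS -PoszD addn1.
Qed.

Lemma Hm_cat m s k : Hm m (s ++ nseq k 0%N) = Hm m s.
Proof.
by elim: s => [|a s IH]; [elim: k => //= k IH; rewrite HmS | rewrite cat_cons !HmS IH].
Qed.

Lemma Hm_perm m s s' : perm_eq s s' -> Hm m s = Hm m s'.
Proof.
have mid n s1 s2 : Hm m (s1 ++ n :: s2) = Hm m (n :: s1 ++ s2).
  by elim: s1 => // p s1 IH; rewrite cat_cons HmS IH !HmS Sz_Sz.
elim: s s' => [|n s IH] s' h.
  by move: h; rewrite perm_sym => /perm_nilP ->.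
have nin : n \in s' by rewrite -(perm_mem h) mem_head.
case/splitPr: nin h => s1 s2 h; rewrite mid !HmS (IH (s1 ++ s2)) //.
by rewrite -(perm_cons n); apply: (perm_trans h); rewrite -cat1s perm_catCA.
Qed.

Lemma perm_pos_nseq (s : seq nat) :
  perm_eq s ([seq n <- s | 0 < n]%N ++ nseq (size s - size [seq n <- s | 0 < n]%N) 0%N).
Proof.
rewrite perm_sym; apply: perm_trans (permEl (perm_filterC (fun n => 0 < n)%N s)).
rewrite perm_cat2l.
have -> : [seq n <- s | predC (fun n => 0 < n)%N n] =
    nseq (size s - size [seq n <- s | 0 < n]%N) 0%N; last exact: perm_refl.
rewrite !size_filter -(count_predC (fun n => 0 < n)%N s) addKn.
rewrite -size_filter; apply/all_pred1P/allP => n.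
by rewrite mem_filter /= lt0n negbK => /andP[].
Qed.

Lemma Hm_mkpart m s : Hm m (sval (mkpart s)) = Hm m s.
Proof.
rewrite [RHS](Hm_perm m (perm_pos_nseq s)) Hm_cat; apply: Hm_perm.
by rewrite /= perm_sort.
Qed.

(** Substitutes [h_n] for [varpi(-n)]. The [varpi(-n)] are the power sums belonging to the complete
    symmetric functions [h_n], so [Phi] is invertible; its inverse [Psi] expands a vector in the
    basis of h-monomials. *)
Definition Phi : V -> V := lft (fun k => Hm k.1 (sval k.2)).

Lemma Phi_lin : lin Phi. Proof. exact: fglift_lin. Qed.

Lemma Phi_mkpart m s : Phi (bv K (m, mkpart s)) = Hm m s.
Proof. by rewrite /Phi fgliftb Hm_mkpart. Qed.

(* Newton's identities: [Ph n] is the power sum [p_n] written as a polynomial in the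
   complete symmetric functions, the variable [h_k] being encoded as [cr k]. *)
Definition cx (n : nat) : V -> V := if n is n'.+1 then cr n else id.

Fixpoint Phaux (fuel n : nat) (w : V) : V :=
  if fuel is f.+1 then
    n%:R *: cx n w - \sum_(k < n.-1) Phaux f k.+1 (cx (n - k.+1) w)
  else 0.

Definition Ph (n : nat) : V -> V := Phaux n n.

Lemma Phaux_fuel f n w : (n <= f)%N -> (0 < n)%N -> Phaux f n w = Ph n w.
Proof.
move: n w; elim/ltn_ind: f => -[|f] IH [|n] w //= nf _.
rewrite /Ph /=; congr (_ - _); apply: eq_bigr => k _.
have kn := ltn_ord k.
by rewrite !IH //; lia.
Qed.

Lemma Ph_rec n w : n.+1%:R *: cx n.+1 w = \sum_(k < n.+1) Ph k.+1 (cx (n - k) w).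
Proof.
rewrite big_ord_recr /= subnn /Ph [Phaux n.+1 n.+1 _]/= -[LHS](subrK 
  (\sum_(k < n) Phaux n k.+1 (cx (n.+1 - k.+1) w))) addrC; congr (_ + _).
by apply: eq_bigr => k _; rewrite subSS Phaux_fuel.
Qed.

Lemma cx_lin n : lin (cx n).
Proof. by case: n => [|n] //; exact: cr_lin. Qed.

Lemma cx_cx n n' w : cx n (cx n' w) = cx n' (cx n w).
Proof. case: n n' => [|n] [|n'] //; exact: cr_cr. Qed.

Lemma lin_big (n : nat) (F : 'I_n -> V -> V) :
  (forall i, lin (F i)) -> lin (fun w => \sum_(i < n) F i w).
Proof.
move=> h c u v; rewrite scaler_sumr -big_split /=.
by apply: eq_bigr => i _; rewrite h.
Qed.

Lemma Phaux_lin f n : lin (Phaux f n).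
Proof.
elim: f n => [|f IH] n /=; first by move=> c u v; rewrite scaler0 addr0.
apply: linadd; first by apply: linscale; exact: cx_lin.
move=> c u v; rewrite (@lin_big _ (fun k w => Phaux f k.+1 (cx (n - k.+1) w))).
  by rewrite opprD scalerN.
by move=> k; apply: lin_comp; [exact: IH | exact: cx_lin].
Qed.

Lemma Ph_comm (f : V -> V) : lin f -> (forall n w, f (cx n w) = cx n (f w)) ->
  forall n w, f (Ph n w) = Ph n (f w).
Proof.
move=> lf hf n; rewrite /Ph; move: {1 3}n => fuel.
elim: fuel n => [|fuel IH] n w /=; first exact: lin0.
rewrite (linB _ _ lf) (linZ _ _ lf) hf (lin_sum _ _ _ lf); congr (_ - _).
by apply: eq_bigr => k _; rewrite IH hf.
Qed.

Lemma Ph_cx n n' w : cx n' (Ph n w) = Ph n (cx n' w).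
Proof. by apply: Ph_comm; [exact: cx_lin | move=> p u; exact: cx_cx]. Qed.

Lemma Ph_Ph n n' w : Ph n' (Ph n w) = Ph n (Ph n' w).
Proof. by apply: Ph_comm; [exact: Phaux_lin | move=> p u; rewrite Ph_cx]. Qed.

Definition Pmono (m : int) (s : seq nat) : V := foldr Ph (bv K (m, part0)) s.

Lemma Pm_perm m s s' : perm_eq s s' -> Pmono m s = Pmono m s'.
Proof.
have mid n s1 s2 : Pmono m (s1 ++ n :: s2) = Pmono m (n :: s1 ++ s2).
  by elim: s1 => //= p s1 ->; rewrite Ph_Ph.
elim: s s' => [|n s IH] s' h.
  by move: h; rewrite perm_sym => /perm_nilP ->.
have nin : n \in s' by rewrite -(perm_mem h) mem_head.
case/splitPr: nin h => s1 s2 h; rewrite mid /= (IH (s1 ++ s2)) //.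
by rewrite -(perm_cons n); apply: (perm_trans h); rewrite -cat1s perm_catCA.
Qed.

Definition Psi : V -> V := lft (fun k => Pmono k.1 (sval k.2)).

Lemma Psi_lin : lin Psi. Proof. exact: fglift_lin. Qed.

Lemma Psi_cr n w : Psi (cr n.+1 w) = Ph n.+1 (Psi w).
Proof.
move: w; apply: lin_ext.
- by apply: lin_comp; [exact: Psi_lin | exact: cr_lin].
- by apply: lin_comp; [exact: Phaux_lin | exact: Psi_lin].
case=> m l; rewrite (@crb K) /Psi !fgliftb /=.
by rewrite (Pm_perm m (perm_pins l (ltn0Sn n))).
Qed.

(** [Sz_recn] and [Ph_rec] are the same Newton identity, [n h_n] as the sum of the [p_k h_(n-k)], so
    the two sides agree by induction. *)
Lemma Psi_Sz (n : nat) w : Psi (Sz 1 n%:Z w) = cx n (Psi w).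
Proof.
elim/ltn_ind: n => -[|n] IH //.
apply: (scalerI (char0 n)).
rewrite -(linZ _ _ Psi_lin) Sz_recn // scale1r (lin_sum _ _ _ Psi_lin) Ph_rec.
by apply: eq_bigr => k _; rewrite Psi_cr IH // ltnS leq_subr.
Qed.

Lemma Psi_Hm m s : Psi (Hm m s) = foldr cx (bv K (m, part0)) s.
Proof.
elim: s => [|a s IH]; first by rewrite /Hm /Psi fgliftb.
by rewrite HmS Psi_Sz IH.
Qed.

Lemma foldr_cx m s : foldr cx (bv K (m, part0)) s = bv K (m, mkpart s).
Proof.
have -> : mkpart s = mkpart [seq n <- s | 0 < n]%N.
  by apply: part_eq; rewrite /= filter_id perm_refl.
rewrite -foldr_cr; last by rewrite all_filter; apply/allP => n _ /=; case: ltnP.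
by elim: s => [|[|a] s IH] //=; rewrite IH.
Qed.

Lemma PsiK y : Psi (Phi y) = y.
Proof.
move: y; apply: (@lin_ext _ _ _ id) => //.
  by apply: lin_comp; [exact: Psi_lin | exact: Phi_lin].
by case=> m l; rewrite /Phi fgliftb Psi_Hm foldr_cx mkpartK.
Qed.

Lemma Phi_cx n y : Phi (cx n y) = Sz 1 n%:Z (Phi y).
Proof.
case: n => [|n] //; move: y; apply: lin_ext.
- by apply: lin_comp; [exact: Phi_lin | exact: cx_lin].
- by apply: lin_comp; [exact: lS | exact: Phi_lin].
case=> m l; rewrite (_ : cx n.+1 _ = bv K (m, pins n.+1 l)); last exact: crb.
rewrite /Phi !fgliftb /=.
by rewrite (Hm_perm m (perm_pins l (ltn0Sn n))) HmS.
Qed.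

(** Newton's identity determines [p_n] from the [h_k] and the earlier [p_k]; once these are known to
    match, only the last terms of the two sums remain to be compared. *)
Lemma Phi_Ph n y : (0 < n)%N -> Phi (Ph n y) = cr n%:Z (Phi y).
Proof.
elim/ltn_ind: n y => -[|n] IH // y _.
have e1 := f_equal Phi (Ph_rec n y).
have e2 := Sz_recn char0 1 n (Phi y).
rewrite (linZ _ _ Phi_lin) Phi_cx e2 scale1r (lin_sum _ _ _ Phi_lin) in e1.
rewrite !big_ord_recr /= subnn /= in e1.
rewrite [X in X + _](eq_bigr (fun k : 'I_n => Phi (Ph k.+1 (cx (n - k) y)))) in e1.
  by move/addrI: e1 => <-.
by move=> k _; rewrite IH ?ltnS ?ltn_ord // Phi_cx.
Qed.

Lemma PhiK v : Phi (Psi v) = v.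
Proof.
move: v; apply: (@lin_ext _ _ _ id) => //.
  by apply: lin_comp; [exact: Phi_lin | exact: Psi_lin].
case=> m l; rewrite /Psi fgliftb /=.
have pos : all (fun n => 0 < n)%N (sval l) by apply/allP => p; exact: part_pos.
rewrite -[in RHS](mkpartK l) -foldr_cr //; elim: (sval l) pos => [|n s IH] /=.
  by move=> _; rewrite /Phi fgliftb.
by case/andP=> n0 pos; rewrite Phi_Ph // IH.
Qed.

End Kernel.

Arguments Sz : simpl never.
Arguments Tz : simpl never.
Arguments expz : simpl never.
Arguments cr : simpl never.
Arguments an : simpl never.

(** * From the kernel of [e^alpha(n)] to the h-degree *)

Section KernelTheorem.
Variable K : fieldType.
Hypothesis char0 : forall n : nat, n.+1%:R != 0 :> K.
Local Notation V := (Fock K).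
Local Notation Hv := (Hv K).
Local Notation Hm := (@Hm K).
Local Notation vacv := (vacv K).
Implicit Types (w : V).

Let lS b i := @Sz_lin K char0 b i.
Let lT b i := @Tz_lin K char0 b i.
Let lh b := @sh_lin K b.

(** Moving the generating series of [T] past [h_a] replaces it by [h_a - x h_(a-1)], and [T_j] with
    [j > 0] kills [e^(m varpi)]. So [T_D] lowers [D] different factors, which must be all of them
    when there are at most [D]. *)
Lemma Tz2_Hm m s (D : nat) : all (fun n => 0 < n)%N s -> (size s <= D)%N ->
  Tz 2 D (Hm m s) = if size s == D then (-1) ^+ D *: Hm m (map predn s) else 0.
Proof.
elim: s D => [|a s IH] [|D] // pos.
- by rewrite Tz0 /= expr0 scale1r.
- move=> _; rewrite /= (@Tz_big _ char0 2 m 0) //.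
  exact: (@homb K (m, part0)).
- move: pos => /andP[a0 pos] sD; rewrite /= in a0 sD; rewrite HmS Tz_Sz // IH //; last exact: leqW.
  rewrite ifF; last by apply/eqP; lia.
  rewrite (lin0 (lS _ _)) sub0r (_ : D.+1%:Z - 1 = D); last by lia.
  rewrite IH // [size (a :: s)]/= eqSS; case: eqP => _; last by rewrite (lin0 (lS _ _)) oppr0.
  rewrite (linZ _ _ (lS _ _)) exprS mulN1r scaleNr; congr (- (_ *: _)).
  by rewrite (_ : a%:Z - 1 = a.-1) //; lia.
Qed.

Definition kproj (p : pred key) : V -> V := lft (fun k => if p k then bv K k else 0).

Lemma cf_kproj p k w : cf k (kproj p w) = if p k then cf k w else 0.
Proof.
pose f (w : V) : K^o := cf k (kproj p w).
pose g (w : V) : K^o := if p k then cf k w else 0.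
have lf : lin f by move=> c u v; rewrite /f /kproj fglift_lin cf_lin.
have lg : lin g.
  by move=> c u v; rewrite /g; case: (p k); [rewrite cf_lin | rewrite scaler0 addr0].
apply: (lin_ext lf lg) => k'; rewrite /f /g /kproj fgliftb.
have [<-|ne] := eqVneq k' k; first by case: (p k') => //; rewrite cf0.
by rewrite cf_bv (negPf ne); case: (p k'); rewrite ?cf_bv ?(negPf ne) ?cf0; case: (p k).
Qed.

(** Lowering all parts loses those equal to [1], but the original number [D] of parts tells how many
    to put back. This inverts the action of [T_D] in top degree. *)
Lemma mkpart_succ_pred l (D : nat) : size (sval l) = D ->
  let s := sval (mkpart (map predn (sval l))) in
  mkpart (map succn s ++ nseq (D - size s) 1%N) = l.
Proof.
move=> sl s; apply: part_eq.
apply: (perm_trans (perm_mkpart _)).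
  rewrite all_cat; apply/andP; split; first by apply/allP => n /mapP[? _ ->].
  by apply/allP => n /nseqP[-> _].
have e : map succn (map predn (sval l)) = sval l.
  rewrite -map_comp -[RHS]map_id; apply/eq_in_map => n nl /=.
  by rewrite prednK // (part_pos nl).
rewrite -[X in perm_eq _ X]e perm_sym.
apply: (perm_trans (perm_map succn (perm_pos_nseq (map predn (sval l))))).
rewrite map_cat map_nseq size_map sl.
have hs : perm_eq s [seq n <- map predn (sval l) | 0 < n]%N by rewrite /s /= perm_sort.
rewrite (perm_size hs) perm_cat2r perm_sym; exact: perm_map.
Qed.

(* [T_D] of [e^alpha] maps an [h]-monomial of degree [D] to the monomial with all indices
   lowered by one, up to sign, so it is injective on the part of top degree. *)
Lemma top_vanish (D : nat) (y : V) : supp (fun k => (size (sval k.2) <= D)%N) y ->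
  Tz 2 D (Phi y) = 0 -> supp (fun k => (size (sval k.2) < D)%N) y.
Proof.
move=> hy hT.
pose tau : V -> V := lft (fun k => if size (sval k.2) == D
   then bv K (k.1, mkpart (map predn (sval k.2))) else 0).
pose sigma : V -> V := lft (fun k =>
   bv K (k.1, mkpart (map succn (sval k.2) ++ nseq (D - size (sval k.2)) 1%N))).
have lt : lin tau by exact: fglift_lin.
have ls : lin sigma by exact: fglift_lin.
have e1 : Tz 2 D (Phi y) = (-1) ^+ D *: Phi (tau y).
  rewrite [in LHS](vec_sum y) [in RHS](vec_sum y) (lin_sum _ _ _ lt).
  rewrite !(lin_sum _ _ _ (@Phi_lin K)) (lin_sum _ _ _ (lT _ _)) scaler_sumr.
  rewrite [LHS]big_seq [RHS]big_seq.
  apply: eq_bigr => k; rewrite mem_dom => /hy sk.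
  rewrite (linZ _ _ lt) !(linZ _ _ (@Phi_lin K)) (linZ _ _ (lT _ _)) scaleC; congr (_ *: _).
  rewrite /tau {1}/Phi !fgliftb Tz2_Hm //; last by apply/allP => n; exact: part_pos.
  case: eqP => _; last by rewrite (lin0 (@Phi_lin K)) scaler0.
  by rewrite Phi_mkpart.
have e2 : tau y = 0.
  rewrite -[tau y](PsiK char0); move: hT; rewrite e1 => /eqP.
  by rewrite scaler_eq0 signr_eq0 /= => /eqP ->; exact: lin0 (@Psi_lin K).
have e3 : sigma (tau y) = kproj (fun k => size (sval k.2) == D) y.
  move: y {hy hT e1 e2}; apply: lin_ext => [||k]; first exact: lin_comp.
    exact: fglift_lin.
  rewrite /tau /kproj !fgliftb; case: eqP => [sk|_]; last exact: lin0.
  by rewrite /sigma fgliftb /= (mkpart_succ_pred sk); case: (k).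
move: e3; rewrite e2 (lin0 ls) => e3 k nz; have := hy k nz.
rewrite leq_eqVlt => /orP[sk|//]; case/eqP: nz.
by have := f_equal (cf k) e3; rewrite cf0 cf_kproj sk.
Qed.

Lemma supp_charge_Psi m e w : homog m e w -> supp (fun k => k.1 = m) (Psi w).
Proof.
move=> hw; apply: (@supp_op _ (fun k => k.1 = m) (fun k => k.1 = m)) (@Psi_lin K) _ _.
  have hcx n (u : V) : supp (fun k => k.1 = m) u -> supp (fun k => k.1 = m) (cx n u).
    case: n => // n; apply: supp_op; first exact: cr_lin.
    by move=> [m' l] e1; rewrite /cx crb; exact: suppb.
  have hP f n (u : V) : supp (fun k => k.1 = m) u -> supp (fun k => k.1 = m) (Phaux f n u).
    elim: f n u => [|f IH] n u hu /=; first exact: supp0.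
    apply: suppD; first by apply: suppZ; exact: hcx.
    rewrite -scaleN1r; apply: suppZ; apply: supp_sum => i _.
    by apply: IH; exact: hcx.
  case=> m' l /= e1; rewrite /Psi fgliftb /=; elim: (sval l) => [|n s IH] /=.
    exact: suppb.
  exact: hP.
by move=> k /hw [].
Qed.

Lemma Hspan_Hm (m : nat) (s : seq nat) : size s = m -> Hspan m (Hm m s).
Proof. by move=> <-; rewrite -(Hv_Hm char0); exact: Hspan_Hv. Qed.

(** The expansion [Psi v] is a finite sum, so its h-degree is bounded, and [top_vanish] lowers the
    bound step by step to [m]. Shorter monomials are padded with [h_0 = 1]. *)
Lemma kernel_Hspan (m : nat) e (v : V) : homog m e v ->
  (forall j : int, m%:Z < j -> Tz 2 j v = 0) -> Hspan m v.
Proof.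
move=> hv hT; pose y := Psi v; have evec : v = Phi y by rewrite PhiK.
have hc := supp_charge_Psi hv; rewrite -/y in hc.
have hs : supp (fun k => (size (sval k.2) <= m)%N) y.
  have [B hB] : exists B, supp (fun k => (size (sval k.2) <= m + B)%N) y.
    exists (\max_(k <- dom (y : Defs.V K)) size (sval k.2))%N => k nz.
    by rewrite -(mem_dom y) in nz; apply: leq_trans (leq_addl _ _); exact: leq_bigmax_seq.
  elim: B hB => [|B IH] hB; first by move=> k /hB; rewrite addn0.
  apply: IH => k nz; rewrite -ltnS -addnS; apply: (top_vanish hB _ nz).
  by rewrite -evec; apply: hT; lia.
rewrite evec (vec_sum y) (lin_sum _ _ _ (@Phi_lin K)) big_seq.
apply: (big_ind (Hspan m)) => [|u w|k]; [exact: spn0 | exact: spnD |].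
rewrite mem_dom => nz; rewrite (linZ _ _ (@Phi_lin K)); apply: spnZ.
have sk := hs k nz; have ck := hc k nz; case: k sk ck {nz} => m' l /= sk ->.
rewrite /Phi fgliftb /= -(@Hm_cat K m _ (m - size (sval l))).
have ss : size (sval l ++ nseq (m - size (sval l)) 0%N) = m.
  by rewrite size_cat size_nseq subnKC.
exact: (Hspan_Hm ss).
Qed.

(** Downward induction on [j], starting above the degree of [v]. Up to the shift of charge,
    [E_(-j) v] is the sum over [i] of [S_(i-j) T_i v]: the terms with [i < j] are zero, those with
    [i > j] vanish by induction, and [T_j v] remains. The mode is [n = j - 1 - m], so [n >= 0] means
    [j > m]. *)
Lemma Er_kernel (m e : int) (v : V) : homog m e v -> (forall n : int, 0 <= n -> Er (- n - 1 - m) v = 0) ->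
  forall j : int, m < j -> Tz 2 j v = 0.
Proof.
move=> hv hE.
suff h (p : nat) : forall j : int, m < j -> e - p%:Z < j -> Tz 2 j v = 0.
  by move=> j mj; apply: (h (absz (e - j)).+1) => //; lia.
elim: p => [|p IH] j mj ej; first by apply: (Tz_big char0 _ hv); lia.
have := hE (j - 1 - m); rewrite (_ : - (j - 1 - m) - 1 - m = - j); last by ring.
rewrite (Er_hom char0 (- j) hv) (@zsum_eq1 _ j) => [|i ij].
  rewrite /Et addNr Sz0 => h; have {}h := h ltac:(lia).
  by rewrite -[Tz 2 j v]sh0 -(addNr 2) -sh_sh h (lin0 (lh _)).
rewrite /Et; have [lt|gt] := ltrP i j.
  by rewrite Sz_neg ?(lin0 (lh _)) //; lia.
by rewrite IH ?(lin0 (lS _ _)) ?(lin0 (lh _)) //; lia.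
Qed.

Definition Heven : V -> Prop := spn (fun x => exists2 c, ~~ odd (size c) & x = Hv c).

Lemma Heven_Hspan g (v : V) : ~~ odd g -> Hspan g v -> Heven v.
Proof.
move=> og; apply: Hspan_ind; first exact: subsp_spn.
by move=> c sc; apply: spn_id; exists c => //; rewrite sc.
Qed.

Definition evec : V := bv K (2, part0).

Lemma vmode_evec n m e w : homog m e w -> vmode evec n w = Er (- n - 1 - m) w.
Proof.
move=> hw; have he : homog 2 0 evec by exact: (@homb K (2, part0)).
rewrite (vmode_hom char0 n he hw (mu := m)) // /evec Yf_b /=.
rewrite [LHS](Df0_wproj char0 2 _ hw) (Er_hom char0 _ hw).
by rewrite (_ : e + 0 - n - 1 - m - e = - n - 1 - m) //; ring.
Qed.

(** [e^alpha(n)] sends components of distinct charge and degree to components of distinct charge and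
    degree, so it kills each component of [v] separately. *)
Lemma ker_Heven (v : V) : supp (fun k => ~~ odd `|k.1|) v -> (forall n : int, 0 <= n -> vmode evec n v = 0) ->
  Heven v.
Proof.
move=> hv hE.
pose hp (x : int * int) : V -> V := kproj (fun k => (k.1, (pwt k.2)%:Z) == x).
have lp x : lin (hp x) by exact: fglift_lin.
have hh x : homog x.1 x.2 (hp x v).
  by move=> k; rewrite cf_kproj; case: ifP => [/eqP <- //|_]; rewrite eqxx.
pose S := undup [seq (k.1, (pwt k.2)%:Z) | k <- dom (v : Defs.V K)].
have -> : v = \sum_(x <- S) hp x v.
  apply: cf_eq => k.
  pose f (w : V) : K^o := cf k w.
  have lf : lin f by move=> c x y; rewrite /f cf_lin.
  rewrite -[RHS]/(f _) (lin_sum _ _ _ lf) /f.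
  under eq_bigr => x _ do rewrite cf_kproj.
  have [nz|nz] := eqVneq (cf k v) 0.
    by rewrite big1 // => x _; rewrite nz; case: ifP.
  have kS : (k.1, (pwt k.2)%:Z) \in S.
    by rewrite mem_undup; apply/mapP; exists k; rewrite ?(mem_dom v).
  rewrite (bigD1_seq _ kS (undup_uniq _)) /= eqxx big1 ?addr0 // => x ne.
  by rewrite eq_sym (negPf ne).
apply: (big_ind Heven) => [|u w|[m e] _]; [exact: spn0 | exact: spnD |].
have hx := hh (m, e); rewrite /= in hx; set x := hp (m, e) v in hx *.
have [z|nz] := eqVneq x 0; first by rewrite z; exact: spn0.
have om : ~~ odd `|m|%N.
  have [k] : exists k, cf k x != 0.
    apply: contrapT => h; case/eqP: nz; apply: cf_eq => k; rewrite cf0.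
    by apply/eqP/negPn/negP => nz; apply: h; exists k.
  by rewrite /x cf_kproj; case: ifP => [/eqP[<- _] /hv //|_]; rewrite eqxx.
have kill (n : int) : 0 <= n -> Er (- n - 1 - m) x = 0.
  move=> n0; rewrite -(vmode_evec n hx).
  suff -> : vmode evec n x = hp (m + 2, e + (- n - 1 - m)) (vmode evec n v).
    by rewrite hE // (lin0 (lp _)).
  rewrite /x; move: (v); apply: lin_ext.
  - by apply: lin_comp; [exact: vmode_lin | exact: lp].
  - by apply: lin_comp; [exact: lp | exact: vmode_lin].
  move=> k; have hk : homog k.1 (pwt k.2) (bv K k) by exact: homb.
  have hk2 := hom_Er char0 (r := - n - 1 - k.1) hk; rewrite -(vmode_evec n hk) in hk2.
  rewrite {1}/hp /kproj fgliftb; set z := vmode evec n _ in hk2 *.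
  apply: cf_eq => k'; rewrite cf_kproj; case: eqP => [[km ke]|kne].
    have [e1|nz'] := eqVneq (cf k' z) 0; first by rewrite -/z e1; case: ifP.
    have [k1 k2] := hk2 _ nz'.
    by rewrite k1 k2 km ke eqxx.
  rewrite (lin0 (@vmode_lin K evec n)) cf0.
  have [e1|nz'] := eqVneq (cf k' z) 0; first by rewrite e1; case: ifP.
  have [k1 k2] := hk2 _ nz'; rewrite k1 k2; case: eqP => // -[h1 h2].
  by case: kne; congr (_, _); [move/addIr: h1 | move/addIr: h1 h2 => -> /addIr].
have hT := Er_kernel hx kill.
clearbody x; case: m om hx hT {kill} => m om hx hT.
  by apply: (@Heven_Hspan m) => //; exact: kernel_Hspan hx hT.
(* In negative charge the index [0] is among the vanishing coefficients, and [T_0] is the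
   identity. *)
by case/eqP: nz; have := hT 0; rewrite Tz0 => ->.
Qed.

End KernelTheorem.

(** * The commutant *)

Section Commutant.
Variable K : fieldType.
Hypothesis char0 : forall n : nat, n.+1%:R != 0 :> K.
Local Notation V := (Fock K).
Local Notation Hv := (Hv K).
Local Notation YH := (YH (K := K)).
Local Notation vacv := (vacv K).
Local Notation evec := (evec K).
Implicit Types (w : V).

Definition mon (l : seq (V * int)) : V := foldr (fun an x => vmode an.1 an.2 x) vacv l.

Definition mons (S : V -> Prop) (strong : bool) (x : V) : Prop :=
  exists2 l : seq (V * int),
    forall a, a \in l -> S a.1 /\ (strong -> a.2 <= -1) & x = mon l.

Lemma gen_spanP (S : V -> Prop) strong (v : V) :
  @gen_span K S strong v <-> spn (mons S strong) v.
Proof.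
split=> [[l [hl ->]]|].
  elim: l hl => [|[c t] l IH] hl; first by rewrite big_nil; exact: spn0.
  rewrite big_cons; apply: spnA; last by apply: IH => x xl; apply: hl; rewrite inE xl orbT.
  by exists t => // a; apply: (hl (c, t)); rewrite mem_head.
elim=> [|c x y [t ht ->] _ [l [hl ->]]].
  by exists [::]; split=> //; rewrite big_nil.
exists ((c, t) :: l); split; last by rewrite big_cons.
by move=> z; rewrite inE => /orP[/eqP -> //|]; exact: hl.
Qed.

(** The properties that pass from [u] to [e^alpha(n) u]; homogeneity is what translates [comm2] into
    a statement about modes. *)
Definition Wgood (u : V) := exists r : nat, exists A : int,
  [/\ homog (r.*2)%:Z A u, Hspan r.*2 u & comm2 r (Yf u)].

Lemma Wgood_mon l : (forall a, a \in l -> a.1 = evec) -> Wgood (mon l).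
Proof.
elim: l => [|[v n] l IH] hl.
  exists 0%N, 0; split; first exact: (@homb K (0, part0)).
    exact: (@Hspan_Hv K [::]).
  exact: comm2_vac.
have [r [A [h1 h2 h3]]] := IH (fun a al => hl a (mem_behead (s := _ :: _) al)).
have ve : v = evec := hl _ (mem_head _ _).
have -> : mon ((v, n) :: l) = vmode evec n (mon l) by rewrite -ve.
rewrite (vmode_evec char0 n h1); set rho := - n - 1 - _.
exists r.+1, (A + rho); split.
- rewrite (_ : (r.+1.*2)%:Z = (r.*2)%:Z + 2); last by lia.
  exact: hom_Er.
- exact: Hspan_Er.
- exact: comm2_Er.
Qed.

(** Both charges are even, so half the product of either charge with any [m] is an integer and
    [vmode_hom] applies to all four modes; the resulting degrees are those of [comm2]. *)
Lemma Hv_comm u c (n k : int) (w : V) : Wgood u -> ~~ odd (size c) ->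
  vmode u n (vmode (Hv c) k w) = vmode (Hv c) k (vmode u n w).
Proof.
move=> [r [A [h1 h2 h3]]] oc; pose t := (size c)./2.
have sc : (size c)%:Z = 2 * t by rewrite /t; have := even_halfK oc; lia.
have hr : (r.*2)%:Z = 2 * r by lia.
have hX := @isfield_YH _ char0 c; have hH := @hom_Hv _ char0 c.
have hU := isfield_Yf char0 h1.
move: w; apply: lin_ext.
- by apply: lin_comp; exact: vmode_lin.
- by apply: lin_comp; exact: vmode_lin.
move=> [m l]; set e := pwt l; have hw : homog m e (bv K (m, l)) by exact: (@homb K (m, l)).
move: (bv K (m, l)) hw => w hw.
rewrite (vmode_hom char0 k hH hw (mu := t%:Z * m)); last by rewrite sc; ring.
rewrite (vmode_hom char0 n h1 hw (mu := r%:Z * m)); last by rewrite hr; ring.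
rewrite (Yf_Hv char0).
have hw1 := hX.2 _ _ (e%:Z + (sumn c)%:Z - k - 1 - t%:Z * m) _ hw.
have hw2 := hU.2 _ _ (e%:Z + A - n - 1 - r%:Z * m) _ hw.
rewrite (vmode_hom char0 n h1 hw1 (mu := r%:Z * (m + 2 * t))); last by rewrite hr sc; ring.
rewrite (vmode_hom char0 k hH hw2 (mu := t%:Z * (m + 2 * r))); last by rewrite hr sc; ring.
rewrite (Yf_Hv char0) (h3 c oc _ _ _ _ _ hw).
have e0 : (r * size c)%N%:Z = 2 * (r%:Z * t%:Z) by rewrite PoszM sc; ring.
by congr (YH c _ (Yf u _ _)); rewrite ?e0; ring.
Qed.

Lemma Heven_comm u v (n k : int) (w : V) : spn (mons (fun u => u = evec) false) u -> Heven v ->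
  vmode u n (vmode v k w) = vmode v k (vmode u n w).
Proof.
move=> hu hv.
have lin1 (v1 : V) : lin (fun u => vmode u n (vmode v1 k w)) by exact: vmode_linl.
have lin2 (v1 : V) : lin (fun u => vmode v1 k (vmode u n w)).
  by apply: lin_comp; [exact: vmode_lin | exact: vmode_linl].
have lin3 (v1 : V) : lin (fun v => vmode v1 n (vmode v k w)).
  by apply: lin_comp; [exact: vmode_lin | exact: vmode_linl].
have lin4 (v1 : V) : lin (fun v => vmode v k (vmode v1 n w)) by exact: vmode_linl.
move: u hu; apply: spn_min.
  split=> [|c x y hx hy]; first by rewrite (lin0 (lin1 v)) (lin0 (lin2 v)).
  by rewrite (lin1 v) (lin2 v) hx hy.
move=> _ [l hl ->]; have hW := Wgood_mon (fun a al => (hl a al).1).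
move: v hv; apply: spn_min.
  split=> [|c x y hx hy]; first by rewrite (lin0 (lin3 _)) (lin0 (lin4 _)).
  by rewrite (lin3 _) (lin4 _) hx hy.
by move=> _ [c oc ->]; exact: Hv_comm.
Qed.

Lemma Heven_even (v : V) : Heven v -> supp (fun k => ~~ odd `|k.1|) v.
Proof.
move: v; apply: spn_min; first by split=> [|c x y hx hy]; [exact: supp0 | exact: suppA].
by move=> _ [c oc ->] k /(hom_Hv char0) [-> _].
Qed.

(** As [v = v(-1) 1] and [e^alpha(n) 1 = 0] for [n >= 0], commutation tested on the vacuum already
    puts [v] in the kernel. *)
Lemma comm_Heven (v : V) : supp (fun k => ~~ odd `|k.1|) v ->
  (forall n m : int, vmode evec n (vmode v m vacv) = vmode v m (vmode evec n vacv)) -> Heven v.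
Proof.
move=> hv h; apply: (ker_Heven char0) => // n n0.
by rewrite -{1}(vmode_vac char0 v) h (vmode_vac0 char0 _ n0) (lin0 (@vmode_lin _ _ _)).
Qed.

End Commutant.

(** * Strong generation *)

Section Quadratic.
Variable K : fieldType.
Hypothesis char0 : forall n : nat, n.+1%:R != 0 :> K.
Local Notation V := (Fock K).
Local Notation Hv := (Hv K).
Local Notation vacv := (vacv K).
Implicit Types (w : V).

Let lS b i := @Sz_lin K char0 b i.
Let lT b i := @Tz_lin K char0 b i.
Let lh b := @sh_lin K b.
Let lp d : lin (@wproj K d) := (isfield_wproj K).1 d.

Definition Hz (a b : int) : V := Sz 1 a (sh 1 (Sz 1 b (sh 1 vacv))).

Lemma Hz_nat (a b : nat) : Hz a b = Hv [:: a; b]. Proof. by []. Qed.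

Lemma Hz_negl (a b : int) : a < 0 -> Hz a b = 0.
Proof. by move=> a0; rewrite /Hz Sz_neg. Qed.

Lemma Hz_sym (a b : int) : Hz a b = Hz b a.
Proof. by rewrite /Hz !sh_Sz // Sz_Sz. Qed.

Lemma Hz_negr (a b : int) : b < 0 -> Hz a b = 0.
Proof. by rewrite Hz_sym; exact: Hz_negl. Qed.

Lemma hom_Hz (a b : int) : homog 2 (a + b) (Hz a b).
Proof.
have h0 := hom_sh (b := 1) (hom_vac char0).
have := hom_Sz char0 (b := 1) (i := a) (hom_sh (b := 1) (hom_Sz char0 (b := 1) (i := b) h0)).
by rewrite (_ : 0 + b + a = a + b) //; lia.
Qed.

Definition Z2 (d : int) w (z : (int * int) * (int * int)) : V :=
  sh 1 (Sz 1 z.1.1 (sh 1 (Sz 1 z.2.1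
    (wproj (d - z.1.1 - z.2.1) (Tz 1 z.2.2 (Tz 1 z.1.2 w)))))).

Lemma Z2_wt m e d w (i j k l : int) : homog m e w -> e - j - l != d - i - k ->
  Z2 d w ((i, j), (k, l)) = 0.
Proof.
move=> hw ne; rewrite /Z2 /=.
have hT := hom_Tz char0 (b := 1) (i := l) (hom_Tz char0 (b := 1) (i := j) hw).
by rewrite (wproj_hom _ hT) (negPf ne) (lin0 (lS _ _)) (lin0 (lh _)) (lin0 (lS _ _)) (lin0 (lh _)).
Qed.

Lemma Z2_zero m e d w (i j k l : int) : homog m e w ->
  [|| i < 0, j < 0, k < 0, l < 0 | e < j + l] -> Z2 d w ((i, j), (k, l)) = 0.
Proof.
move=> hw h; rewrite /Z2 /=.
have [i0|i0] := boolP (i < 0); first by rewrite Sz_neg // (lin0 (lh _)).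
have [k0|k0] := boolP (k < 0).
  by rewrite (Sz_neg _ _ k0) // (lin0 (lh _)) (lin0 (lS _ _)) (lin0 (lh _)).
suff -> : Tz 1 l (Tz 1 j w) = 0.
  by rewrite (lin0 (lp _)) (lin0 (lS _ _)) (lin0 (lh _)) (lin0 (lS _ _)) (lin0 (lh _)).
have [l0|l0] := boolP (l < 0); first by rewrite Tz_neg.
have [j0|j0] := boolP (j < 0); first by rewrite (Tz_neg _ _ j0) (lin0 (lT _ _)).
by apply: (Tz_big char0 _ (hom_Tz char0 (b := 1) (i := j) hw)); lia.
Qed.

Lemma fin_Z2 m e d w (c : (int * int) * (int * int) -> K) : homog m e w ->
  fin (fun z => c z *: Z2 d w z).
Proof.
move=> hw; apply: (@fin_itv4 _ 0 (`|d| + `|e|)) => i j k l h.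
have [ne|eq] := boolP (e - j - l != d - i - k); first by rewrite (Z2_wt hw ne) scaler0.
by rewrite (Z2_zero _ hw) ?scaler0 //; lia.
Qed.

Lemma Y2_E (a b : int) m e d w : homog m e w ->
  Yf (Hz a b) d w =
  fsum (fun z => (gbinz (ex K 1 m z.1) a * gbinz (ex K 1 m z.2) b) *: Z2 d w z).
Proof.
move=> hw; have h0 := hom_vac char0.
rewrite (Yf_S char0 1 a (hom_Sz char0 (b := 1) (i := b) (hom_sh (b := 1) h0))).
rewrite (Yf_S char0 1 b h0) (Yf_vac char0).
have hp := isfield_wproj K; have hD := isfield_Df char0 1 b hp.
pose C (z : (int * int) * (int * int)) := gbinz (ex K 1 m z.1) a * gbinz (ex K 1 m z.2) b.
have fF := fin_Z2 d C hw.
rewrite (Df_E char0 _ _ _ hD hw) (fsum_pair fF); apply: eq_zsum2 => i j.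
have hT := hom_Tz char0 (b := 1) (i := j) hw.
have f1 := fin_Dg char0 1 (d - i) (fun x => gbinz (ex K 1 m x) b) hp hT.
rewrite /Dg /= (Df_E char0 _ _ _ hp hT) (lin_fsum (lS _ _) f1) (lin_fsum (lh _)); last first.
  exact: fin_comp (lin0 (lS _ _)) f1.
rewrite -fsumZ; last first.
  by apply: fin_comp (lin0 (lh _)) _; exact: fin_comp (lin0 (lS _ _)) f1.
apply: eq_zsum2 => k l; rewrite (linZ _ _ (lS _ _)) (linZ _ _ (lh _)) scalerA.
by rewrite /C /Z2 /Dg.
Qed.

Lemma gbinzSr (x : K) (a : int) : (a + 1)%:~R * gbinz x (a + 1) = (x - a%:~R) * gbinz x a.
Proof.
case: a => [a|[|a]].
- by rewrite (_ : a%:Z + 1 = a.+1) -?pmulrn; [exact: gbinSr | lia].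
- by rewrite mul0r mulr0.
- by rewrite (_ : Negz a.+1 + 1 = Negz a) ?mulr0 //; lia.
Qed.

(* The image of [Hz a b] under the translation operator [L_(-1)]. *)
Definition dh (a b : int) : V := (a + 1)%:~R *: Hz (a + 1) b + (b + 1)%:~R *: Hz a (b + 1).

Lemma hom_dh (a b : int) : homog 2 (a + b + 1) (dh a b).
Proof.
apply: suppD; apply: suppZ.
  by have := @hom_Hz (a + 1) b; rewrite addrAC.
by have := @hom_Hz a (b + 1); rewrite addrA.
Qed.

Lemma ex1D m (i j k l : int) : ex K 1 m (i, j) + ex K 1 m (k, l) = (i + k - j - l + m)%:~R.
Proof.
have two : (2%:R : K) != 0 := char0 1.
rewrite /ex /= !mul1r !rmorphD /= !rmorphN /=; move: (m%:~R : K) => mm; field.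
exact: two.
Qed.

(** By [gbinzSr] the two summands add up to the factor [(x - a) + (y - b)], where [x] and [y] are
    the exponents of the two exponentials; on nonzero terms the degrees determine [x + y]. *)
Lemma Yf_dh (a b : int) m e d w : homog m e w ->
  Yf (dh a b) d w = (d - e + m - a - b)%:~R *: Yf (Hz a b) d w.
Proof.
move=> hw; rewrite /dh (linD _ _ (@Yf_lin K d w)) !(linZ _ _ (@Yf_lin K d w)).
rewrite !(Y2_E _ _ _ hw) -!fsumZ; try exact: (fin_Z2 d _ hw).
pose C (z : (int * int) * (int * int)) : K := (a + 1)%:~R * (gbinz (ex K 1 m z.1) (a + 1) * gbinz (ex K 1 m z.2) b).
pose D (z : (int * int) * (int * int)) : K := (b + 1)%:~R * (gbinz (ex K 1 m z.1) a * gbinz (ex K 1 m z.2) (b + 1)).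
rewrite (eq_fsum (G := fun z => C z *: Z2 d w z)) => [|z]; last exact: scalerA.
rewrite [X in _ + X](eq_fsum (G := fun z => D z *: Z2 d w z)) => [|z]; last exact: scalerA.
rewrite -fsumD; try exact: (fin_Z2 d _ hw).
apply: eq_fsum => -[[i j] [k l]].
rewrite -scalerDl /C /D /=.
have [ne|/negPn/eqP eq] := boolP (e - j - l != d - i - k).
  by rewrite (Z2_wt hw ne) !scaler0.
rewrite scalerA; congr (_ *: _).
rewrite mulrA gbinzSr mulrCA gbinzSr.
have -> : d - e + m - a - b = (i + k - j - l + m) - a - b by lia.
rewrite !rmorphB /= -ex1D; move: (ex _ _ _ _) (ex _ _ _ _) => x y; ring.
Qed.

Lemma vmode_dh (a b N : int) w : vmode (dh a b) N w = - N%:~R *: vmode (Hz a b) (N - 1) w.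
Proof.
move: w; apply: lin_ext; first exact: vmode_lin.
  by apply: linscale; exact: vmode_lin.
move=> [m l]; have hw : homog m (pwt l) (bv K (m, l)) by exact: (@homb K (m, l)).
rewrite (vmode_hom char0 N (@hom_dh a b) hw (mu := m)) //.
rewrite (vmode_hom char0 (N - 1) (@hom_Hz a b) hw (mu := m)) //.
rewrite (Yf_dh _ _ _ hw) -rmorphN; congr (_%:~R *: Yf _ _ _); lia.
Qed.

(** The coefficients of [(1 - x)^(1/2)]. *)
Definition sqrtcoef (j : int) : K := if j is Posz n then (-1) ^+ n * gbin 2%:R^-1 n else 0.

Arguments sqrtcoef : simpl never.

(** Coefficient form of [x f' = - (1/2) (x / (1 - x)) f] for [f = (1 - x)^(1/2)], the recursion that
    [Tz_rec] produces in [Tz1_Sz1]. *)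
Lemma sqrtcoef_sum (n : nat) : \sum_(i < n) sqrtcoef i = - (2%:R * n%:R * sqrtcoef n).
Proof.
have two : (2%:R : K) != 0 := char0 1.
elim: n => [|n IH]; first by rewrite big_ord0 mulr0 mul0r oppr0.
rewrite big_ord_recr /= IH /sqrtcoef exprS.
have e : n.+1%:R * gbin (2%:R^-1 : K) n.+1 = (2%:R^-1 - n%:R) * gbin 2%:R^-1 n by exact: gbinSr.
have -> : 2%:R * n.+1%:R * (-1 * (-1) ^+ n * gbin 2%:R^-1 n.+1) =
  2%:R * (-1 * (-1) ^+ n) * (n.+1%:R * gbin (2%:R^-1 : K) n.+1) by ring.
by rewrite e; move: (n%:R : K) (gbin _ _) (_ ^+ _) => x y z; field.
Qed.

(* The contraction of [e^varpi(z)] with [e^varpi(w)] is [(z - w)^(1/2)]. *)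
Lemma Tz1_Sz1 w (n j : int) : (forall q : int, an q w = 0) ->
  Tz 1 j (Sz 1 n w) = sqrtcoef j *: Sz 1 (n - j) w.
Proof.
move=> hw; elim/zind: j => [j j0|j j0 IH]; first by rewrite Tz_neg // /sqrtcoef; case: j j0 => // j _; rewrite scale0r.
case: j j0 IH => // -[|j] _ IH; first by rewrite Tz0 subr0 /sqrtcoef expr0 gbin0 mul1r scale1r.
apply: (scalerI (intK_neq0 char0 (i := j.+1) isT)); rewrite (Tz_rec char0).
have fT := @fin_Tz K 1 j.+1 (Sz 1 n w).
rewrite -(fsum_shift 1 fT) (@fsum_ord _ j.+1); last first.
  move=> t /orP[t0|tj]; first by rewrite an_le0 //; lia.
  by rewrite Tz_neg ?(lin0 (@an_lin _ _)) //; lia.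
have two : (2%:R : K) != 0 := char0 1.
rewrite (eq_bigr (fun t : 'I_j.+1 => (2%:R^-1 * sqrtcoef (j - t)%N%:Z) *: Sz 1 (n - j.+1%:Z) w)).
  rewrite -scaler_suml -mulr_sumr (reindex_inj rev_ord_inj) /=.
  rewrite (eq_bigr (fun t : 'I_j.+1 => sqrtcoef t%:Z)) => [|t _]; last first.
    by have := ltn_ord t; move=> tj; congr (sqrtcoef _); lia.
  rewrite sqrtcoef_sum !scalerA; congr (_ *: _); rewrite -pmulrn.
  by move: (sqrtcoef _) (j.+1%:R : K) => x y; field.
move=> t _; have tj := ltn_ord t.
have e1 : j.+1%:Z - (t%:Z + 1) = (j - t)%N by lia.
rewrite e1 IH; last by lia.
rewrite (linZ _ _ (@an_lin _ _)) (an_Sz char0); last by lia.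
rewrite hw (lin0 (lS _ _)) add0r mul1r scalerA.
rewrite mulrC; congr (_ *: Sz 1 _ w); lia.
Qed.

(** The mode indices [- n - 1] on charge [0] and [- n - 3/2] on charge [1] both raise the degree by
    [n]; the contraction then spreads the indices to [n + j] and [n - j]. *)
Lemma expmode_expmode n : expmode 1 (- (2 * n + 3)%N%:Z) (expmode 1 (- (2 * n + 2)%N%:Z) vacv) =
  \sum_(j < n.+1) sqrtcoef j *: Hz (n + j)%N (n - j)%N.
Proof.
have h0 := hom_vac char0.
have e1 : expmode 1 (- (2 * n + 2)%N%:Z) vacv = Sz 1 n (sh 1 vacv).
  rewrite (expmode_hom char0 h0 (r := n)); last by lia.
  rewrite (@zsum_eq1 _ 0) => [|j j0]; first by rewrite /Ebt Tz0 addr0 sh_Sz.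
  by apply: (zero_Ebt char0 _ _ h0); lia.
have h1 := hom_Sz char0 (b := 1) (i := n) (hom_sh (b := 1) h0).
rewrite e1 (expmode_hom char0 h1 (r := n)); last by lia.
have an0 q : an q (sh 1 vacv) = 0 by rewrite -sh_an (an_vac char0) (lin0 (lh _)).
rewrite (@fsum_ord _ n.+1) => [|j jn].
  apply: eq_bigr => j _; rewrite /Ebt (Tz1_Sz1 _ _ an0).
  have jn := ltn_ord j.
  rewrite (linZ _ _ (lS _ _)) (linZ _ _ (lh _)) /Hz sh_Sz //; congr (_ *: Sz 1 _ (sh 1 (Sz 1 _ _))); lia.
by apply: (zero_Ebt char0 _ _ h1); lia.
Qed.

End Quadratic.

Arguments gbinz : simpl never.

(** * Strong generation by the vectors [phi_n] *)

Section StrongGeneration.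
Variable K : fieldType.
Hypothesis char0 : forall n : nat, n.+1%:R != 0 :> K.
Local Notation V := (Fock K).
Local Notation Hv := (Hv K).
Local Notation Hz := (Hz K).
Local Notation dh := (dh K).
Local Notation sqrtcoef := (sqrtcoef K).
Local Notation vacv := (vacv K).
Implicit Types (w : V).

Let lS b i := @Sz_lin K char0 b i.
Let lh b := @sh_lin K b.
Let lp d : lin (@wproj K d) := (isfield_wproj K).1 d.

Definition phiH (n : nat) : V := \sum_(j < n.+1) sqrtcoef j *: Hz (n + j)%N (n - j)%N.

(** What is left in front of [h_0 h_(2n)] when each term of [phiH n] is reduced modulo derivatives
    by [Hz_red]. *)
Definition phicoef (n : nat) : K :=
  \sum_(j < n.+1) sqrtcoef j * ((-1) ^+ (n + j) * 'C(2 * n, n + j)%:R).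

(** The signs of the two factors combine to [(-1)^n], and [binom(2 n, n + j) = binom(2 n, n - j)]
    makes the sum a Vandermonde convolution. *)
Lemma kapE n : phicoef n = (-1) ^+ n * gbin (2%:R^-1 + (2 * n)%:R) n.
Proof.
rewrite (pmulrn 1 (2 * n)) -(vandermonde char0) mulr_sumr; apply: eq_bigr => j _; have jn := ltn_ord j.
rewrite /sqrtcoef -pmulrn gbin_nat // exprD -[in LHS]bin_sub; last by lia.
rewrite (_ : (2 * n - (n + j) = n - j)%N); last by lia.
have s1 : (-1) ^+ j * (-1) ^+ j = 1 :> K by rewrite -expr2 sqrr_sign.
have aux (x y z s : K) : s * s = 1 -> s * x * (z * s * y) = z * (x * y).
  move=> ss; have -> : s * x * (z * s * y) = (s * s) * (z * (x * y)) by ring.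
  by rewrite ss mul1r.
exact: aux.
Qed.

(** The factors [2 n + 1/2 - i] of the binomial are half-odd integers, hence nonzero. *)
Lemma phicoef_neq0 n : phicoef n != 0.
Proof.
have two : (2%:R : K) != 0 := char0 1.
rewrite kapE mulf_neq0 ?signr_eq0 // /gbin mulf_neq0 //; last first.
  by rewrite invr_eq0 natK_neq0 // fact_gt0.
apply/prodf_neq0 => i _; have iN := ltn_ord i.
have -> : 2%:R^-1 + (2 * n)%:R - i%:R = (4 * n - 2 * i).+1%:R / 2%:R :> K.
  rewrite -[(4 * n - 2 * i).+1%:R]natr1 natrB ?natrM; last by lia.
  by field.
by rewrite mulf_neq0 ?invr_eq0 // char0.
Qed.

(** Modulo [dh a b], [(a + 1) h_(a+1) h_b] equals [- (b + 1) h_a h_(b+1)]; moving weight to the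
    first index one step at a time builds up the signed binomial. *)
Lemma Hz_red (Z : V -> Prop) (M a : nat) : subsp Z ->
  (forall a b : nat, (a + b).+1 = M -> Z (dh a b)) -> (a <= M)%N ->
  Z (Hz a (M - a)%N - ((-1) ^+ a * 'C(M, a)%:R) *: Hz 0 M).
Proof.
move=> hZ hd; elim: a => [|a IH] aM.
  by rewrite subn0 expr0 bin0 mul1r scale1r subrr; exact: hZ.1.
have {}IH := IH (ltnW aM).
have ha : a.+1%:R != 0 :> K by exact: char0.
have e1 : ((M - a.+1)%N + 1)%:Z = (M - a)%N by lia.
have e2 : a%:Z + 1 = a.+1 by lia.
have e3 : (M - a.+1)%N%:Z + 1 = (M - a)%N by lia.
have eb : a.+1%:R * 'C(M, a.+1)%:R = (M - a)%:R * 'C(M, a)%:R :> K.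
  by rewrite -!natrM -mul_bin_left.
have -> : Hz a.+1 (M - a.+1)%N - ((-1) ^+ a.+1 * 'C(M, a.+1)%:R) *: Hz 0 M =
  a.+1%:R^-1 *: (dh a (M - a.+1)%N -
     (M - a)%:R *: (Hz a (M - a)%N - ((-1) ^+ a * 'C(M, a)%:R) *: Hz 0 M)).
  apply: (scalerI ha); rewrite [RHS]scalerA divff // scale1r /dh e2 e3 -!pmulrn.
  rewrite !scalerBr opprB -[RHS]addrA; congr (_ + _).
  rewrite [RHS]addrCA subrr addr0 !scalerA exprS -scaleNr; congr (_ *: _).
  rewrite mulrCA [in RHS]mulrCA -eb; ring.
apply: subspZ => //; apply: subspB => //; last exact: subspZ.
by apply: hd; lia.
Qed.

Lemma phiH_red (Z : V -> Prop) n : subsp Z ->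
  (forall a b : nat, (a + b).+1 = (2 * n)%N -> Z (dh a b)) ->
  Z (phiH n - phicoef n *: Hz 0 (2 * n)%N).
Proof.
move=> hZ hd; rewrite /phiH /phicoef scaler_suml -sumrB; apply: subsp_sum => // j.
have jn := ltn_ord j.
rewrite -scalerA -scalerBr; apply: subspZ => //.
have := @Hz_red Z (2 * n) (n + j) hZ hd; rewrite (_ : (2 * n - (n + j) = n - j)%N); last by lia.
by apply; lia.
Qed.

(** In degree [M], derivatives leave only the class of [h_0 h_M]. For odd [M] symmetry makes this
    class its own negative; for even [M] the class of [phiH] is a nonzero multiple of it. *)
Lemma Hz_gen (Q : V -> Prop) : subsp Q -> (forall n, Q (phiH n)) ->
  (forall a b : nat, Q (Hz a b) -> Q (dh a b)) -> forall a b : nat, Q (Hz a b).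
Proof.
move=> hQ hf hd.
suff h M : forall a b : nat, (a + b)%N = M -> Q (Hz a b) by move=> a b; exact: (h (a + b)%N).
elim/ltn_ind: M => M IH.
have dM (a b : nat) : (a + b).+1 = M -> Q (dh a b).
  by move=> e; apply: hd; apply: (IH (a + b)%N) => //; lia.
suff h0 : Q (Hz 0 M).
  move=> a b e; have := @Hz_red Q M a hQ dM; rewrite (_ : (M - a)%N = b); last by lia.
  move=> /(_ ltac:(lia)) h1.
  by rewrite -[Hz a b](subrK (((-1) ^+ a * 'C(M, a)%:R) *: Hz 0 M)); apply: subspD => //; exact: subspZ.
have [oM|eM] := boolP (odd M).
  have := Hz_red hQ dM (leqnn M).
  rewrite subnn binn mulr1 -signr_odd oM expr1 scaleN1r opprK Hz_sym // -mulr2n -scaler_nat.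
  move=> /(subspZ (2%:R^-1) hQ); rewrite scalerA mulVf ?scale1r //.
have e : M = (2 * M./2)%N by rewrite mul2n even_halfK.
have dM' (a b : nat) : (a + b).+1 = (2 * M./2)%N -> Q (dh a b) by rewrite -e; exact: dM.
have h1 := phiH_red hQ dM'; rewrite -e in h1.
have : Q (phicoef M./2 *: Hz 0 M).
  rewrite -[_ *: _](subKr (phiH M./2)); exact: subspB.
move=> /(subspZ (phicoef M./2)^-1 hQ); rewrite scalerA mulVf ?scale1r //.
exact: phicoef_neq0.
Qed.

Definition Hgr (g : nat) (q : int) : V -> Prop :=
  spn (fun x => exists c, [/\ size c = g, (sumn c)%:Z = q & x = Hv c]).

Lemma Hgr_wproj g q (v : V) : Hspan g v -> Hgr g q (wproj q v).
Proof.
move: v; apply: Hspan_ind.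
  by apply: (subsp_lin (lp q)); exact: subsp_spn.
move=> c sc; rewrite (wproj_hom q (@hom_Hv _ char0 c)).
by case: eqP => [e|_]; [apply: spn_id; exists c | exact: spn0].
Qed.

(** The error terms of [strong_step]: the first two indices are free, while the tail has smaller
    degree, on which the inner induction of [phispan_Hv] descends. *)
Definition low (t : nat) (e : nat) : V -> Prop :=
  spn (fun x => exists i, exists k, exists c,
    [/\ size c = t, (sumn c < e)%N & x = Hv [:: i, k & c]]).

Lemma low_SS t (e : nat) (q i k : int) (v : V) : q < e -> Hgr t q v ->
  low t e (sh 1 (Sz 1 i (sh 1 (Sz 1 k v)))).
Proof.
move=> qe; pose f (v : V) := sh 1 (Sz 1 i (sh 1 (Sz 1 k v))).
have lf : lin f.
  apply: lin_comp (lh 1) _; apply: lin_comp (lS 1 i) _.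
  exact: lin_comp (lh 1) (lS 1 k).
move: v; apply: (spn_lin lf) => _ [c [sc hc ->]]; rewrite /f.
rewrite !sh_Sz //.
have [i0|i0] := ltrP i 0; first by rewrite Sz_neg //; exact: spn0.
have [k0|k0] := ltrP k 0; first by rewrite (Sz_neg _ _ k0) // (lin0 (lS _ _)); exact: spn0.
clear lf f; case: i i0 => // i _; case: k k0 => // k _.
by apply: spn_id; exists i, k, c; split=> //; [lia | rewrite !HvS !sh_Sz].
Qed.

(* The coefficient of [S_x S_y] with no annihilation operator is
   [binom(x + t, i + t) binom(y + t, k + t)] with [x + y = i + k], so only [(i, k)] survives. *)
Lemma strong_step (t i k : nat) c : size c = t.*2 ->
  low t.*2 (sumn c) (vmode (Hz (i + t)%N (k + t)%N) (-1) (Hv c) - Hv [:: i, k & c]).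
Proof.
move=> sc; set e := sumn c.
have hc : homog t.*2 e (Hv c) by rewrite -sc; exact: hom_Hv.
have two : (2%:R : K) != 0 := char0 1.
rewrite (vmode_hom char0 (-1) (@hom_Hz _ char0 _ _) hc (mu := t.*2)) //.
rewrite (_ : e%:Z + ((i + t)%N%:Z + (k + t)%N%:Z) - -1 - 1 - (t.*2)%:Z = e%:Z + i + k); last by lia.
rewrite (Y2_E char0 _ _ _ hc).
set F := fun z => _; pose z0 : (int * int) * (int * int) := ((i%:Z, 0), (k%:Z, 0)).
have fF : fin F by exact: fin_Z2 hc.
pose G z : V := if z == z0 then F z0 else 0.
have fG : fin G by exists [:: z0] => z; rewrite inE /G => /negPf ->.
have hE (x : int) : ex K 1 (t.*2)%:Z (x, 0) = (x + t)%:~R.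
  rewrite /ex /= subr0 rmorphD mul1r (_ : (t.*2)%:Z = t%:Z * 2) ?rmorphM /=; last by lia.
  by congr (_ + _); rewrite -[2%:~R]/(2%:R : K) mulfK.
(* Charge [2 t] adds [t] to each exponent, which the shift by [t] in the indices of [Hz] matches:
   [binom(x + t, a + t)] is [1] at [x = a] and [0] for smaller [x >= 0]. *)
have hb (x : int) (a : nat) : x <= a%:Z -> 0 <= x ->
    gbinz (ex K 1 (t.*2)%:Z (x, 0)) (a + t)%N = (x == a%:Z)%:R.
  case: x => // x xa _; rewrite hE -PoszD -pmulrn /gbinz gbin_nat //.
  case: eqP => [[->]|ne]; first by rewrite binn.
  by rewrite bin_small //; lia.
have eG : fsum G = Hv [:: i, k & c].
  rewrite (fsum_eq1 (i0 := z0)) => [|z /negPf zz]; last by rewrite /G zz.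
  rewrite /G eqxx /F /= !hb // !eqxx mulr1 scale1r /Z2 /= !Tz0.
  rewrite (wproj_hom _ hc) ifT; last by lia.
  by rewrite !sh_Sz.
rewrite -eG -fsumB //; apply: subsp_fsum; first exact: subsp_spn.
move=> [[x j] [y l]]; rewrite /G; case: eqP => [->|ne]; first by rewrite subrr; exact: spn0.
rewrite subr0 /F /=.
have [h|h] := boolP ([|| x < 0, j < 0, y < 0, l < 0 | e%:Z < j + l]).
  by rewrite (Z2_zero char0 _ hc h) scaler0; exact: spn0.
have [h1|h1] := boolP (e%:Z - j - l != e%:Z + i + k - x - y).
  by rewrite (Z2_wt char0 hc h1) scaler0; exact: spn0.
(* A positive [j] or [l] lowers the degree of the tail, so such a term lies in [low]. *)
have [/andP[/eqP j0 /eqP l0]|jl] := boolP ((j == 0) && (l == 0)); last first.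
  apply: spnZ; apply: (@low_SS _ _ (e%:Z + i + k - x - y)); first by lia.
  apply: Hgr_wproj; apply: Hspan_T => //; apply: Hspan_T => //.
  by rewrite -sc; exact: Hspan_Hv.
subst j l; have [xi|xi] := ltrP x i.
  rewrite (hb x i) ?ifF; try lia.
  by rewrite (_ : (x == i) = false) ?mul0r ?scale0r; [exact: spn0 | lia].
have [yk|yk] := ltrP y k.
  rewrite (hb y k); try lia.
  by rewrite (_ : (y == k) = false) ?mulr0 ?scale0r; [exact: spn0 | lia].
by case: ne; rewrite /z0; congr ((_, _), (_, _)); lia.
Qed.

Definition phispan : V -> Prop := spn (mons (fun x => exists n, x = phiH n) true).

Lemma phispan_phiH n (N : int) w : N <= -1 -> phispan w -> phispan (vmode (phiH n) N w).
Proof.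
move=> N1; move: w; apply: (spn_lin (@vmode_lin K _ N)) => _ [l hl ->].
apply: spn_id; exists ((phiH n, N) :: l) => // a; rewrite inE => /orP[/eqP ->|/hl //].
by split=> //; exists n.
Qed.

(** Passing to a derivative replaces the mode [N] by [N - 1], which is still at most [-1]; thus
    negative modes of the [phi_n] alone also account for the derivatives. *)
Lemma phispan_Hz (a b : nat) (N : int) w : N <= -1 -> phispan w -> phispan (vmode (Hz a b) N w).
Proof.
pose Q v := forall (N : int) w, N <= -1 -> phispan w -> phispan (vmode v N w).
have hQ : subsp Q.
  split=> [M x _ _|c u v hu hv M x M1 hx]; first by rewrite (lin0 (@vmode_linl _ _ _)); exact: spn0.
  by rewrite vmode_linl; apply: spnD; [apply: spnZ; exact: hu | exact: hv].
move: a b N w; apply: (Hz_gen hQ) => [n N w|a b h N w N1 hw]; first exact: phispan_phiH.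
by rewrite (vmode_dh char0); apply: spnZ; apply: h => //; lia.
Qed.

(** Outer induction on the length; inner induction on the degree of the tail behind the first two
    indices, which [strong_step] decreases. *)
Lemma phispan_Hv c : ~~ odd (size c) -> phispan (Hv c).
Proof.
move=> oc; have := even_halfK oc; move: (size c)./2 => t; clear oc.
elim: t c => [|t IHt] c sc.
  case: c sc => // _; apply: spn_id; exists [::] => //.
suff h (n : nat) : forall i k c, size c = t.*2 -> (sumn c < n)%N -> phispan (Hv [:: i, k & c]).
  case: c sc => [|i [|k c]] //= [sc]; exact: (h (sumn c).+1).
elim: n => [//|n IHn] i k {}c {}sc hn.
rewrite -[Hv _](subKr (vmode (Hz (i + t)%N (k + t)%N) (-1) (Hv c))).
apply: subspB; first exact: subsp_spn.
  by apply: phispan_Hz => //; exact: IHt.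
apply: spn_min (strong_step i k sc); first exact: subsp_spn.
by move=> _ [i' [k' [c' [sc' hs ->]]]]; apply: IHn => //; lia.
Qed.

Lemma phispan_Heven v : Heven v -> phispan v.
Proof. by move: v; apply: spn_min; [exact: subsp_spn | move=> _ [c oc ->]; exact: phispan_Hv]. Qed.

End StrongGeneration.

(** * Minimality *)

Section Minimality.
Variable K : fieldType.
Hypothesis char0 : forall n : nat, n.+1%:R != 0 :> K.
Local Notation V := (Fock K).
Local Notation Hv := (Hv K).
Local Notation Hz := (Hz K).
Local Notation dh := (dh K).
Local Notation phiH := (phiH K).
Local Notation vacv := (vacv K).
Implicit Types (w : V).

Lemma Hspan2_ind (Z : V -> Prop) : subsp Z -> (forall a b : nat, Z (Hz a b)) ->
  forall v, Hspan 2 v -> Z v.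
Proof.
by move=> hZ h; apply: Hspan_ind => // -[|a [|b [|? ?]]] // _; exact: h.
Qed.

Lemma Hspan_Hz (a b : int) : Hspan 2 (Hz a b).
Proof.
have [a0|a0] := ltrP a 0; first by rewrite Hz_negl //; exact: spn0.
have [b0|b0] := ltrP b 0; first by rewrite Hz_negr //; exact: spn0.
by case: a a0 => // a _; case: b b0 => // b _; exact: (@Hspan_Hv K [:: a; b]).
Qed.

Lemma Hspan_dh (a b : int) : Hspan 2 (dh a b).
Proof. by apply: spnD; apply: spnZ; exact: Hspan_Hz. Qed.

Lemma Hspan_phiH n : Hspan 2 (phiH n).
Proof. by apply: subsp_sum => [|j]; [exact: subsp_Hspan | apply: spnZ; exact: Hspan_Hz]. Qed.

Lemma hom_phiH n : homog 2 (2 * n)%N (phiH n).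
Proof.
apply: supp_sum => j _; apply: suppZ; have jn := ltn_ord j.
have := @hom_Hz K char0 (n + j)%N (n - j)%N.
by rewrite (_ : (n + j)%N%:Z + (n - j)%N%:Z = (2 * n)%N) //; lia.
Qed.

Lemma Hspan_S1' g (a : int) (v : V) : Hspan g v -> Hspan g.+1 (sh 1 (Sz 1 a v)).
Proof. by rewrite sh_Sz //; exact: Hspan_S1. Qed.

(** In each term of [Y2_E] the two operators [S] add two factors [h], while [T] and [wproj] preserve
    [Hspan g]. This is what keeps monomials in the [phi_n] inside [C]. *)
Lemma Hspan_vmode g N (u v : V) : Hspan 2 u -> Hspan g v -> Hspan g.+2 (vmode u N v).
Proof.
move=> hu hv; move: u hu; apply: Hspan2_ind => [|a b].
  by apply: (subsp_lin (@vmode_linl K N v)); exact: subsp_Hspan.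
move: v hv; apply: Hspan_ind => [|c <-].
  by apply: (subsp_lin (@vmode_lin K _ N)); exact: subsp_Hspan.
have hc := @hom_Hv _ char0 c.
rewrite (vmode_hom char0 N (@hom_Hz _ char0 a b) hc (mu := size c)) //.
rewrite (Y2_E char0 _ _ _ hc); apply: subsp_fsum => [|[[i j] [k l]]]; first exact: subsp_Hspan.
apply: spnZ; rewrite /Z2; do 2!apply: Hspan_S1'.
apply: spn_min (Hgr_wproj char0 (g := size c) _ _) => [|_ [c' [sc _ ->]]|].
- exact: subsp_Hspan.
- by rewrite -sc; exact: Hspan_Hv.
- by do 2!apply: Hspan_T => //; exact: Hspan_Hv.
Qed.

Lemma Heven_vmode (u v : V) N : Hspan 2 u -> Heven v -> Heven (vmode u N v).
Proof.
move=> hu; move: v; apply: spn_min.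
  by apply: (subsp_lin (@vmode_lin K u N)); exact: subsp_spn.
move=> _ [c oc ->]; apply: (@Heven_Hspan _ (size c).+2); first by rewrite /= negbK.
by apply: Hspan_vmode => //; exact: Hspan_Hv.
Qed.

Lemma Heven_phiH n : Heven (phiH n).
Proof. exact: Heven_Hspan (Hspan_phiH n). Qed.

Lemma Heven_mon b v : spn (mons (fun x => exists n, x = phiH n) b) v -> Heven v.
Proof.
move: v; apply: spn_min; first exact: subsp_spn.
move=> _ [l hl ->]; elim: l hl => [|[u N] l IH] hl.
  by apply: spn_id; exists [::].
apply: Heven_vmode; last by apply: IH => a al; apply: hl; rewrite inE al orbT.
by have [[n] /= -> _] := hl _ (mem_head _ _); exact: Hspan_phiH.
Qed.

(** On the h-monomials [h_a h_b] with [a + b = 2 n], [head] picks the larger index, or [0] when both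
    are [0]. By [altbinC] either index gives the same value. *)
Definition altbin (n : nat) (k : key) : K :=
  let a := head 0%N (sval k.2) in
  if (k.1 == 2) && (pwt k.2 == 2 * n)%N then (-1) ^+ a * 'C(2 * n, a)%:R else 0.

(* Read in the basis of [h]-monomials, hence the detour through [Psi]. *)
Definition ell (n : nat) (v : V) : K^o := lft (altbin n : key -> K^o) (Psi v).

Lemma ell_lin n : lin (ell n).
Proof. by apply: lin_comp; [exact: fglift_lin | exact: Psi_lin]. Qed.

Lemma altbinC n a b : (a + b)%N = (2 * n)%N ->
  (-1) ^+ a * 'C(2 * n, a)%:R = (-1) ^+ b * 'C(2 * n, b)%:R :> K.
Proof.
move=> e; have -> : 'C(2 * n, a) = 'C(2 * n, b).
  by rewrite -bin_sub; [congr 'C(_, _) | ]; lia.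
by congr (_ * _); rewrite -signr_odd -[RHS]signr_odd; congr (_ ^+ nat_of_bool _); lia.
Qed.

Lemma ell_Hz n (a b : nat) :
  ell n (Hz a b) = if (a + b == 2 * n)%N then (-1) ^+ a * 'C(2 * n, a)%:R else 0.
Proof.
rewrite /ell Hz_nat (Hv_Hm char0) (Psi_Hm char0) foldr_cx fgliftb /altbin [_.1]/= [_.2]/=.
rewrite eqxx /=.
have hw : pwt (mkpart [:: a; b]) = (a + b)%N.
  rewrite /pwt /= ; case: a => [|a]; case: b => [|b]; rewrite /= ?addn0 //.
  rewrite /sort /=; case: ifP => _ /=; lia.
rewrite -/(mkpart [:: a; b]) hw; case: eqP => // e.
have [hh|hh] : head 0%N (sval (mkpart [:: a; b])) = a \/ head 0%N (sval (mkpart [:: a; b])) = b.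
- case: a {hw e} => [|a]; case: b => [|b]; rewrite /=; auto.
  rewrite /sort /=; case: ifP => _ /=; auto.
- by rewrite hh.
- by rewrite hh -(altbinC e).
Qed.

Lemma ell_dh n (a b : nat) : ell n (dh a b) = 0.
Proof.
rewrite /dh (linD _ _ (ell_lin n)) !(linZ _ _ (ell_lin n)).
rewrite (_ : a%:Z + 1 = a.+1); last by lia.
rewrite (_ : b%:Z + 1 = b.+1); last by lia.
rewrite !ell_Hz addnS addSn; case: eqP => e; last by rewrite !scaler0 addr0.
rewrite -!pmulrn.
transitivity (a.+1%:R * ((-1) ^+ a.+1 * 'C(2 * n, a.+1)%:R) +
  b.+1%:R * ((-1) ^+ a * 'C(2 * n, a)%:R) : K); first by [].
have eb : a.+1%:R * 'C(2 * n, a.+1)%:R = b.+1%:R * 'C(2 * n, a)%:R :> K.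
  by rewrite -!natrM mul_bin_left; congr (_ * _)%:R; lia.
rewrite mulrCA eb exprS mulN1r mulNr [X in _ + X]mulrCA; exact: addNr.
Qed.

Lemma ell_phiH n : ell n (phiH n) = phicoef K n.
Proof.
rewrite /phiH /phicoef (lin_sum _ _ _ (ell_lin n)); apply: eq_bigr => j _.
have jn := ltn_ord j.
by rewrite (linZ _ _ (ell_lin n)) ell_Hz ifT //; lia.
Qed.

Lemma ell_fi0 n k : k != n -> ell n (phiH k) = 0.
Proof.
move=> ne; rewrite /phiH (lin_sum _ _ _ (ell_lin n)) big1 // => j _.
have jn := ltn_ord j.
by rewrite (linZ _ _ (ell_lin n)) ell_Hz ifF ?scaler0 //; lia.
Qed.

Lemma ell_charge n m e (v : V) : m != 2 -> homog m e v -> ell n v = 0.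
Proof.
move=> m2 hv; have := supp_charge_Psi hv; rewrite /ell; set y := Psi v => hy.
rewrite (vec_sum y) (lin_sum _ _ _ (fglift_lin (altbin n : key -> K^o))).
rewrite big_seq big1 // => k; rewrite mem_dom => /hy km.
rewrite (linZ _ _ (fglift_lin _)) fgliftb /altbin km (negPf m2); exact: scaler0.
Qed.

(** By [vmode_dh] each derivative lowers the mode by one at the cost of a nonzero factor, so
    [v(- p - 2) 1] is, up to a nonzero scalar, an iterated derivative of [v]; the induction ends at
    [dh a b], which [ell] kills. *)
Lemma ell_deriv n (p : nat) (v : V) : Hspan 2 v -> ell n (vmode v (- p.+2%:Z) vacv) = 0.
Proof.
have lV q : lin (fun v => ell n (vmode v q vacv)).
  by apply: lin_comp; [exact: ell_lin | exact: vmode_linl].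
have ind q : (forall a b : nat, ell n (vmode (Hz a b) q vacv) = 0) ->
    forall v, Hspan 2 v -> ell n (vmode v q vacv) = 0.
  apply: (@Hspan2_ind (fun v => ell n (vmode v q vacv) = 0)).
  by split=> [|c x y hx hy]; [exact: (lin0 (lV q)) | rewrite lV hx hy scaler0 addr0].
have step (q : nat) : (forall a b : nat, ell n (vmode (dh a b) (- q.+1%:Z) vacv) = 0) ->
    forall v, Hspan 2 v -> ell n (vmode v (- q.+2%:Z) vacv) = 0.
  move=> h; apply: ind => a b; have := h a b.
  rewrite (vmode_dh char0) (linZ _ _ (ell_lin n)) (_ : - q.+1%:Z - 1 = - q.+2%:Z); last by lia.
  by move/eqP; rewrite scaler_eq0 rmorphN opprK /= -pmulrn (negPf (char0 q)) => /eqP.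
elim: p v => [|p IH]; apply: step => a b; last exact: IH (Hspan_dh a b).
by rewrite (vmode_vac char0) ell_dh.
Qed.

Lemma mon_hom l : (forall a, a \in l -> exists n, a.1 = phiH n) ->
  exists e, homog (2 * size l)%N e (mon l).
Proof.
elim: l => [|[u N] l IH] hl; first by exists 0; exact: (@homb K (0, part0)).
have [e he] := IH (fun a al => hl a (mem_behead (s := _ :: _) al)).
have [n /= un] := hl _ (mem_head _ _).
rewrite /mon /= -/(mon l) un.
rewrite (vmode_hom char0 N (@hom_phiH n) he (mu := (2 * size l)%N)) //.
set d := _ - _; exists d.
have := (isfield_Yf char0 (@hom_phiH n)).2 _ _ d _ he.
by rewrite (_ : (2 * size l)%N%:Z + 2 = (2 * (size l).+1)%N) //; lia.
Qed.

(** Each factor adds [2] to the charge, so only monomials of length one reach charge [2], whatever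
    modes are allowed. For these, [phi_k(N) 1] is zero if [N >= 0], [phi_k] itself if [N = -1], and
    a derivative otherwise; [ell n] kills all of them. *)
Lemma phiH_not_generated (T : V -> Prop) n b : (forall x, T x -> exists2 k, k != n & x = phiH k) ->
  ~ spn (mons T b) (phiH n).
Proof.
move=> hT h; have := phicoef_neq0 char0 n; rewrite -ell_phiH.
suff : forall v, spn (mons T b) v -> ell n v = 0 by move=> /(_ _ h) ->; rewrite eqxx.
apply: spn_min.
  by split=> [|c x y hx hy]; [exact: (lin0 (ell_lin n)) | rewrite ell_lin hx hy scaler0 addr0].
move=> _ [l hl ->].
have [s1|s1] := eqVneq (size l) 1%N; last first.
  have [a al|e he] := @mon_hom l; first by have [k _ ->] := hT _ (hl a al).1; exists k.
  apply: ell_charge he; apply: contraNN s1 => /eqP[s2]; have {}s2 : (2 * size l)%N = 2%N by exact: s2.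
  by apply/eqP; move: (size l) s2 => q; lia.
case: l s1 hl => [|[u N] [|? ?]] // _ hl.
have [k kn /= uk] := hT _ (hl _ (mem_head _ _)).1.
rewrite /mon /= uk.
have [N0|N0] := lerP 0 N; first by rewrite (vmode_vac0 char0) // (lin0 (ell_lin n)).
have [->|N1] := eqVneq N (-1); first by rewrite (vmode_vac char0) ell_fi0.
have -> : N = - (absz N - 2).+2%:Z by lia.
exact: ell_deriv (Hspan_phiH k).
Qed.

End Minimality.

(** * The theorem over the complex numbers *)

Lemma CC_char0 (n : nat) : n.+1%:R != 0 :> CC.
Proof. by rewrite (pnatr_eq0 (Rdefinitions.R)[i]). Qed.

Lemma inVA1P (v : V CC) : inVA1 v <-> supp (fun k => ~~ odd `|k.1|%N) (v : Fock CC).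
Proof. by split=> h k; have := h k; rewrite mem_dom. Qed.

Lemma CommP (v : V CC) : Comm v <-> Heven (v : Fock CC).
Proof.
split=> [[/inVA1P hv hc]|hv].
  apply: (comm_Heven CC_char0) => // n m; apply: hc.
    (* [e^alpha] lies in [W] as the monomial [e^alpha(-1) 1]. *)
    apply/gen_spanP/spn_id; exists [:: (ealpha, -1)].
      by move=> a; rewrite inE => /eqP ->.
    by rewrite /mon /= (vmode_vac CC_char0).
  by apply/inVA1P; exact: suppb.
split; first by apply/inVA1P; exact: (Heven_even CC_char0).
by move=> u /gen_spanP hu n m w _; exact: (Heven_comm CC_char0).
Qed.

Lemma phiE : phi = @phiH CC.
Proof. by apply: funext => n; exact: (expmode_expmode CC_char0). Qed.

Lemma SsetE : Sset = fun x => exists n, x = phiH CC n.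
Proof. by rewrite /Sset phiE. Qed.

Theorem theorem3p1 :
  (forall x, Sset x -> Comm x) /\
  strongly_generates Sset Comm /\
  (forall T : V CC -> Prop,
     (forall x, T x -> Sset x) -> (exists x, Sset x /\ ~ T x) ->
     ~ generates T Comm).
Proof.
rewrite SsetE; split; [|split].
- by move=> _ [n ->]; apply/CommP; exact: (Heven_phiH CC_char0).
- move=> v; split=> [/CommP hv|/gen_spanP hv].
    by apply/gen_spanP; exact: (phispan_Heven CC_char0).
  by apply/CommP; exact: (Heven_mon CC_char0 hv).
move=> T hT [_ [[n ->] nT]] gT.
have /gT/gen_spanP : Comm (phiH CC n) by apply/CommP; exact: (Heven_phiH CC_char0).
apply: (phiH_not_generated CC_char0) => x Tx; have [k xk] := hT x Tx.
by exists k => //; apply: contra_notN nT => /eqP <-; rewrite -xk.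
Qed.
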